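(* Let $L$ be a completely solvable Lie algebra of dimension $n\ge 1$ over a field $\mathbb{F}$ (of arbitrary characteristic), and let $U(L)$ be its universal enveloping algebra. Then $I(n) = 0$ for every proper two-sided ideal $I$ of $U(L)$. In particular, every projective $U(L)$-module is either finitely generated or free.
   Context: For a two-sided ideal $I$ of a ring, $I(1) := \bigcap_{k\in\mathbb{N}} I^k$, and inductively $I(m) := (I(m-1))(1)$ for $m\ge 2$. A finite-dimensional Lie algebra $L$ over a field is completely solvable if it has a chain of ideals of $L$, $0 = L_0 \subset L_1 \subset \cdots \subset L_n = L$, such that $\dim L_i = i$ for every $i$. *)

(* Defs.v *)
From HB Require Import structures.
From mathcomp Require Import all_boot all_order all_algebra.
From mathcomp Require Import boolp classical_sets.

Set Implicit Arguments.
Unset Strict Implicit.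
Unset Printing Implicit Defensive.

Import GRing.Theory.
Local Open Scope ring_scope.
Local Open Scope classical_set_scope.
Local Open Scope quotient_scope.

HB.mixin Record Lmodule_isLieAlgebra (F : fieldType) L of GRing.Lmodule F L := {
  lie : L -> L -> L;
  lie_linearl : forall y, linear (lie^~ y);
  lie_linearr : forall x, linear (lie x);
  liexx : forall x, lie x x = 0;
  lie_jacobi : forall x y z,
    lie x (lie y z) + lie y (lie z x) + lie z (lie x y) = 0
}.

#[short(type="lieAlgType")]
HB.structure Definition LieAlgebra (F : fieldType) :=
  {L of Lmodule_isLieAlgebra F L & GRing.Lmodule F L}.

#[short(type="finDimLieAlgType")]
HB.structure Definition FinDimLieAlgebra (F : fieldType) :=
  {L of LieAlgebra F L & Vector F L}.

Definition lie_ideal (F : fieldType) (L : finDimLieAlgType F)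
    (V : {vspace L}) : Prop :=
  forall x y : L, y \in V -> lie x y \in V.

(* Only the values c 0, ..., c (dim L) of the chain matter. *)
Definition completely_solvable (F : fieldType) (L : finDimLieAlgType F) : Prop :=
  exists c : nat -> {vspace L},
    [/\ c 0%N = 0%VS,
        c (\dim {:L}) = fullv,
        forall i, (i < \dim {:L})%N -> (c i <= c i.+1)%VS,
        forall i, (i <= \dim {:L})%N -> lie_ideal (c i)
      & forall i, (i <= \dim {:L})%N -> \dim (c i) = i].

Definition lie_to_commutator (F : fieldType) (L : lieAlgType F) (A : algType F)
    (f : {linear L -> A}) : Prop :=
  forall x y : L, f (lie x y) = f x * f y - f y * f x.

(* U with iota : L -> U is a universal enveloping algebra of L.  The type
   algType excludes the zero ring; this loses nothing, as there is exactly one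
   map to it from anything. *)
Definition is_universal_enveloping (F : fieldType) (L : lieAlgType F)
    (U : algType F) (iota : {linear L -> U}) : Prop :=
  lie_to_commutator iota /\
  forall (A : algType F) (f : {linear L -> A}), lie_to_commutator f ->
    exists g : {lrmorphism U -> A},
      g \o iota =1 f /\
      forall h : {lrmorphism U -> A}, h \o iota =1 f -> h =1 g.

Definition two_sided_ideal (R : pzRingType) (I : set R) : Prop :=
  [/\ I 0, forall x y, I x -> I y -> I (x + y),
      forall a x, I x -> I (a * x) & forall a x, I x -> I (x * a)].

Definition ideal_mul (R : pzRingType) (I J : set R) : set R :=
  [set x | exists (n : nat) (a b : 'I_n -> R),
     (forall i, I (a i) /\ J (b i)) /\ x = \sum_(i < n) a i * b i].

Fixpoint ideal_exp (R : pzRingType) (I : set R) (k : nat) : set R :=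
  if k is k'.+1 then ideal_mul I (ideal_exp I k') else setT.

Definition ideal_residual (R : pzRingType) (I : set R) : set R :=
  \bigcap_k ideal_exp I k.

(* I(m), extended by I(0) := I. *)
Definition ideal_iter_residual (R : pzRingType) (I : set R) (m : nat) : set R :=
  iter m (@ideal_residual R) I.

(* Modules are left modules, possibly infinitely generated. *)
Definition projective_module (R : pzRingType) (P : lmodType R) : Prop :=
  forall (M N : lmodType R) (g : {linear M -> N}) (f : {linear P -> N}),
    (forall y, exists x, g x = y) ->
    exists h : {linear P -> M}, g \o h =1 f.

Definition finitely_generated_module (R : pzRingType) (M : lmodType R) : Prop :=
  exists (n : nat) (e : 'I_n -> M),
    forall x, exists a : 'I_n -> R, x = \sum_(i < n) a i *: e i.

Definition linearly_independent (R : pzRingType) (M : lmodType R)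
    (B : set M) : Prop :=
  forall (s : seq M) (a : M -> R), uniq s -> {in s, forall b, B b} ->
    \sum_(b <- s) a b *: b = 0 -> {in s, forall b, a b = 0}.

Definition generating (R : pzRingType) (M : lmodType R) (B : set M) : Prop :=
  forall x : M, exists (s : seq M) (a : M -> R),
    {in s, forall b, B b} /\ x = \sum_(b <- s) a b *: b.

Definition free_module (R : pzRingType) (M : lmodType R) : Prop :=
  exists B : set M, linearly_independent B /\ generating B.

(* Every Lie algebra has a universal enveloping algebra: formal expressions in
   the elements of L, identified when they have the same value under every
   linear map from L to an associative algebra that sends brackets to
   commutators. *)
Module EnvelopingExistence.
Section Existence.
Context (F : fieldType) (L : lieAlgType F).

Inductive term : Type :=
  | Cst of F | Gen of L | Add of term & term | Mul of term & term.

HB.instance Definition _ := gen_eqMixin term.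
HB.instance Definition _ := gen_choiceMixin term.

Fixpoint eval (A : algType F) (f : {linear L -> A}) (t : term) : A :=
  match t with
  | Cst c => c%:A
  | Gen x => f x
  | Add t u => eval f t + eval f u
  | Mul t u => eval f t * eval f u
  end.

Definition same_value (t u : term) : Prop :=
  forall (A : algType F) (f : {linear L -> A}),
    lie_to_commutator f -> eval f t = eval f u.

Definition same_valueb (t u : term) : bool := `[< same_value t u >].

Lemma same_valueb_refl : reflexive same_valueb.
Proof. by move=> t; apply/asboolP. Qed.

Lemma same_valueb_sym : symmetric same_valueb.
Proof.
by move=> t u; apply/asboolP/asboolP => h A f hf; rewrite h.
Qed.

Lemma same_valueb_trans : transitive same_valueb.
Proof.
by move=> t u v /asboolP h1 /asboolP h2; apply/asboolP => A f hf; rewrite h1 ?h2.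
Qed.

Canonical same_value_equiv :=
  EquivRel same_valueb same_valueb_refl same_valueb_sym same_valueb_trans.

Definition env := {eq_quot same_value_equiv}.
HB.instance Definition _ := Choice.on env.
HB.instance Definition _ := Quotient.on env.
HB.instance Definition _ := EqQuotient.on env.

Definition value (A : algType F) (f : {linear L -> A}) (x : env) : A :=
  eval f (repr x).

Lemma value_pi (A : algType F) (f : {linear L -> A}) t :
  lie_to_commutator f -> value f (\pi_env t) = eval f t.
Proof.
move=> hf; rewrite /value.
have /eqmodP/asboolP h : repr (\pi_env t) = t %[mod env] by rewrite reprK.
exact: h.
Qed.

Lemma value_ext (x y : env) :
  (forall (A : algType F) (f : {linear L -> A}),
     lie_to_commutator f -> value f x = value f y) -> x = y.
Proof.
move=> h; rewrite -[x]reprK -[y]reprK; apply/eqmodP/asboolP; exact: h.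
Qed.

Definition ecst (c : F) : env := \pi_env (Cst c).
Definition egen (x : L) : env := \pi_env (Gen x).
Definition eadd (x y : env) : env := \pi_env (Add (repr x) (repr y)).
Definition emul (x y : env) : env := \pi_env (Mul (repr x) (repr y)).
Definition eopp (x : env) : env := emul (ecst (-1)) x.

Section Value.
Context (A : algType F) (f : {linear L -> A}) (hf : lie_to_commutator f).

Lemma value_cst c : value f (ecst c) = c%:A. Proof. exact: value_pi. Qed.
Lemma value_gen x : value f (egen x) = f x. Proof. exact: value_pi. Qed.
Lemma value_add x y : value f (eadd x y) = value f x + value f y.
Proof. exact: value_pi. Qed.
Lemma value_mul x y : value f (emul x y) = value f x * value f y.
Proof. exact: value_pi. Qed.
Lemma value_opp x : value f (eopp x) = - value f x.
Proof. by rewrite value_mul value_cst scaleN1r mulN1r. Qed.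

Definition valueE := (value_add, value_mul, value_opp, value_cst, value_gen).
End Value.

Lemma eaddA : associative eadd.
Proof. by move=> x y z; apply: value_ext => A f hf; rewrite !valueE // addrA. Qed.
Lemma eaddC : commutative eadd.
Proof. by move=> x y; apply: value_ext => A f hf; rewrite !valueE // addrC. Qed.
Lemma eadd0 : left_id (ecst 0) eadd.
Proof.
by move=> x; apply: value_ext => A f hf; rewrite !valueE // scale0r add0r.
Qed.
Lemma eaddN : left_inverse (ecst 0) eopp eadd.
Proof.
by move=> x; apply: value_ext => A f hf; rewrite !valueE // scale0r addNr.
Qed.
HB.instance Definition _ := GRing.isZmodule.Build env eaddA eaddC eadd0 eaddN.

Lemma emulA : associative emul.
Proof. by move=> x y z; apply: value_ext => A f hf; rewrite !valueE // mulrA. Qed.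
Lemma emul1x : left_id (ecst 1) emul.
Proof.
by move=> x; apply: value_ext => A f hf; rewrite !valueE // scale1r mul1r.
Qed.
Lemma emulx1 : right_id (ecst 1) emul.
Proof.
by move=> x; apply: value_ext => A f hf; rewrite !valueE // scale1r mulr1.
Qed.
Lemma emulDl : left_distributive emul (fun x y : env => x + y).
Proof. by move=> x y z; apply: value_ext => A f hf; rewrite !valueE // mulrDl. Qed.
Lemma emulDr : right_distributive emul (fun x y : env => x + y).
Proof. by move=> x y z; apply: value_ext => A f hf; rewrite !valueE // mulrDr. Qed.

Lemma zero_lie_to_commutator :
  @lie_to_commutator F L F^o (\0 : {linear L -> F^o}).
Proof. by move=> x y; rewrite /= mulr0 subrr. Qed.

Lemma ecst1_neq0 : ecst 1 != 0.
Proof.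
apply/eqP => /(congr1 (value (\0 : {linear L -> F^o}))).
rewrite !(value_cst zero_lie_to_commutator) scale1r scale0r.
by move/eqP; rewrite oner_eq0.
Qed.
HB.instance Definition _ := GRing.Zmodule_isNzRing.Build env
  emulA emul1x emulx1 emulDl emulDr ecst1_neq0.

Definition escale (c : F) (x : env) : env := ecst c * x.

Lemma value_scale (A : algType F) (f : {linear L -> A}) c x :
  lie_to_commutator f -> value f (escale c x) = c *: value f x.
Proof. by move=> hf; rewrite value_mul // value_cst // mulr_algl. Qed.

Lemma escaleA a b x : escale a (escale b x) = escale (a * b) x.
Proof. by apply: value_ext => A f hf; rewrite !value_scale // scalerA. Qed.
Lemma escale1 : left_id 1 escale.
Proof. by move=> x; apply: value_ext => A f hf; rewrite value_scale // scale1r. Qed.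
Lemma escaleDr : right_distributive escale +%R.
Proof. by move=> a x y; rewrite /escale mulrDr. Qed.
Lemma escaleDl x : {morph escale^~ x : a b / a + b}.
Proof.
move=> a b; apply: value_ext => A f hf.
by rewrite value_add // !value_scale // scalerDl.
Qed.
HB.instance Definition _ := GRing.Zmodule_isLmodule.Build F env
  escaleA escale1 escaleDr escaleDl.

Lemma escaleAl (a : F) (x y : env) : a *: (x * y) = (a *: x) * y.
Proof. exact: mulrA. Qed.
HB.instance Definition _ := GRing.Lmodule_isLalgebra.Build F env escaleAl.

Section ValueRing.
Context (A : algType F) (f : {linear L -> A}) (hf : lie_to_commutator f).

Lemma valueZ (c : F) (x : env) : value f (c *: x) = c *: value f x.
Proof. exact: value_scale. Qed.
Lemma valueD (x y : env) : value f (x + y) = value f x + value f y.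
Proof. exact: value_add. Qed.
Lemma valueM (x y : env) : value f (x * y) = value f x * value f y.
Proof. exact: value_mul. Qed.
Lemma valueN (x : env) : value f (- x) = - value f x.
Proof. exact: value_opp. Qed.
Lemma value1 : value f (1 : env) = 1.
Proof. by rewrite [LHS]value_cst // scale1r. Qed.
End ValueRing.

Lemma escaleAr (a : F) (x y : env) : a *: (x * y) = x * (a *: y).
Proof.
apply: value_ext => A f hf.
by rewrite (valueZ hf) (valueM hf x y) (valueM hf x) (valueZ hf) scalerAr.
Qed.
HB.instance Definition _ := GRing.Lalgebra_isAlgebra.Build F env escaleAr.

Lemma egen_linear : linear egen.
Proof.
move=> a x y; apply: value_ext => A f hf.
by rewrite (valueD hf) (valueZ hf) !(value_gen hf) linearP.
Qed.
HB.instance Definition _ := GRing.isLinear.Build F L env *:%R egen egen_linear.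

Section Lift.
Context (A : algType F) (f : {linear L -> A}) (hf : lie_to_commutator f).
(* The proof is an argument so that the instances below can depend on it. *)
Definition lift of lie_to_commutator f := value f.

Lemma lift_linear : linear (lift hf).
Proof. by move=> a x y; rewrite /lift valueD // valueZ. Qed.
HB.instance Definition _ := GRing.isLinear.Build F env A *:%R (lift hf) lift_linear.

Lemma lift_monoid_morphism : monoid_morphism (lift hf).
Proof.
by split=> [|x y]; rewrite /lift ?(valueM hf) ?(value1 hf).
Qed.
HB.instance Definition _ :=
  GRing.isMonoidMorphism.Build env A (lift hf) lift_monoid_morphism.
End Lift.

Lemma envP : @is_universal_enveloping F L env egen.
Proof.
split=> [x y | A f hf].
  apply: value_ext => A f hf.
  by rewrite (valueD hf) (valueN hf) !(valueM hf) !(value_gen hf).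
exists (lift hf); split=> [x | h hE x]; first exact: value_gen.
rewrite /= /lift /value -[in LHS](reprK x).
elim: (repr x) => [c | y | t IHt u IHu | t IHt u IHu] /=.
- have -> : \pi_env (Cst c) = c *: (1 : env) :> env.
    apply: value_ext => B g hg.
    by rewrite (valueZ hg) (value1 hg) (value_cst hg).
  by rewrite linearZ /= rmorph1.
- exact: hE.
- rewrite -IHt -IHu -rmorphD; congr (h _).
  by apply: value_ext => B g hg; rewrite (valueD hg) !(value_pi _ hg).
- rewrite -IHt -IHu -rmorphM; congr (h _).
  by apply: value_ext => B g hg; rewrite (valueM hg) !(value_pi _ hg).
Qed.

End Existence.
End EnvelopingExistence.

Lemma universal_enveloping_exists (F : fieldType) (L : lieAlgType F) :
  exists (U : algType F) (iota : {linear L -> U}), is_universal_enveloping iota.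
Proof. by do 2!eexists; exact: EnvelopingExistence.envP. Qed.

(* Main.v *)
Require Import Defs.
From HB Require Import structures.
From mathcomp Require Import all_boot all_order all_algebra.
From mathcomp Require Import finmap monalg.
From mathcomp Require Import boolp classical_sets.

(** The enveloping algebra [U] of a completely solvable Lie algebra [L] of dimension
    [n] is reached from the field in [n] steps. A flag of ideals of [L] gives subrings
    [B 0], ..., [B n] of [U], from the scalars up to [U]; each [B (k + 1)] arises from
    [B k] by adjoining an element [y k] that acts on [B k] by a derivation, is an
    eigenvector of the adjoint action of [L] modulo [B k], and has independent powers
    over [B k]. The last point is the Poincare-Birkhoff-Witt theorem
    ([enveloping_step], [enveloping_tower]). Both assertions are deduced from such a
    [tower].

    For the iterated residuals of a proper ideal [I], let [M] be a maximal ideal that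
    contains [I], and let [Q k] be its intersection with [B k]. Then the intersection
    of the powers of [Q (k + 1) U] lies in [Q k U] ([residual_step]); hence [I(m)] lies
    in [Q (n - m) U], and [Q 0] is zero ([tower_residual]). In the step one first
    descends from [U] to [B (k + 1)], as [U] is free over it. There, in degrees in
    [y k] taken modulo [Q k], the nonzero elements of [Q (k + 1)] have degree at least
    [1], and the lower bounds for the degrees of the nonzero elements of two ideals
    stable under [L] add up when the ideals are multiplied ([order_ge_mul]); so a
    common element of all powers of [Q (k + 1)] is zero modulo [Q k]. This additivity
    would be clear if leading coefficients were invertible; instead of a localization,
    the proof uses that they form a stable ideal outside [M], which can be cancelled
    modulo [M] ([maximal_stable_prime]).

    By Hilbert's basis theorem for each step of the tower ([noetherian_adjoin]), [U]
    is noetherian on both sides. Let [P] be a projective module that is not finitely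
    generated. If [P] were finitely generated modulo [I P] for a proper ideal [I], its
    coordinates in a dual basis outside some finite set would lie in all powers of [I];
    so [P] would be finitely generated modulo [I(1) P], and after [n] rounds modulo
    [I(n) P], which is zero ([spanned_of_mod_ideal]). As this is excluded, for every
    finite set of elements there is a linear form that vanishes on it and takes the
    value [1] somewhere ([unimodular_form]); thus [P] has free summands of any finite
    rank. As in Bass's theorem that big projective modules are free, it follows that
    [P] is free if it is countably generated ([countable_basis]): each generator is
    moved into a free summand by an automorphism ([biorthogonal_absorb]). The general
    case is reduced to this one by Kaplansky's method ([maximal_extension],
    [big_projective_free]). *)

Set Implicit Arguments.
Unset Strict Implicit.
Unset Printing Implicit Defensive.

Import GRing.Theory.
Local Open Scope ring_scope.
Local Open Scope classical_set_scope.

(** * Additive subgroups and subrings given as sets *)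

Definition additive_set (V : zmodType) (S : set V) : Prop :=
  S 0 /\ forall a b, S a -> S b -> S (a - b).

Section AdditiveSet.
Context (V : zmodType) (S : set V) (S_add : additive_set S).

Lemma additive0 : S 0. Proof. by case: S_add. Qed.
Lemma additiveB a b : S a -> S b -> S (a - b).
Proof. by case: S_add => _; apply. Qed.
Lemma additiveN a : S a -> S (- a).
Proof. by move=> Sa; rewrite -sub0r; apply: additiveB => //; exact: additive0. Qed.
Lemma additiveD a b : S a -> S b -> S (a + b).
Proof. by move=> Sa Sb; rewrite -[b]opprK; apply/additiveB/additiveN. Qed.
Lemma additive_sum I (r : seq I) (P : pred I) (f : I -> V) :
  (forall i, P i -> S (f i)) -> S (\sum_(i <- r | P i) f i).
Proof. by move=> Sf; apply: big_ind => //; [exact: additive0 | exact: additiveD]. Qed.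
Lemma additive_subl a b : S (a - b) -> S b -> S a.
Proof. by move=> Sab Sb; rewrite -[a](subrK b); apply: additiveD. Qed.
Lemma additive_subr a b : S (a - b) -> S a -> S b.
Proof. by move=> Sab Sa; rewrite -[b](subKr a); apply: additiveB. Qed.
Lemma additiveMn k a : S a -> S (a *+ k).
Proof.
move=> Sa; elim: k => [|k IH]; rewrite ?mulr0n ?mulrS; first exact: additive0.
exact: additiveD.
Qed.
End AdditiveSet.

Definition subring_set (R : nzRingType) (B : set R) : Prop :=
  [/\ additive_set B, B 1 & forall a b, B a -> B b -> B (a * b)].

Definition commutator (R : nzRingType) (z a : R) : R := z * a - a * z.

Lemma commutatorM (R : nzRingType) (z a b : R) :
  commutator z (a * b) = commutator z a * b + a * commutator z b.
Proof. by rewrite /commutator mulrBl mulrBr !mulrA addrA subrK. Qed.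

Lemma commutatorD (R : nzRingType) (z a b : R) :
  commutator z (a + b) = commutator z a + commutator z b.
Proof. by rewrite /commutator mulrDl mulrDr opprD addrACA. Qed.

Lemma commutator0 (R : nzRingType) (z : R) : commutator z 0 = 0.
Proof. by rewrite /commutator mulr0 mul0r subrr. Qed.

Lemma commutatorl (R : nzRingType) (z a : R) : z * a = a * z + commutator z a.
Proof. by rewrite /commutator addrC subrK. Qed.

(** * The filtration by degree modulo an ideal of coefficients *)

(** Under these hypotheses, adjoining [y] to [B] behaves modulo [Q] like forming
    skew polynomials over [B / Q]. The case [Q = 0] serves for Hilbert's basis
    theorem, the case where [Q] comes from a maximal ideal for the residuals. *)
Record skew_data (R : nzRingType) (B Q : set R) (y : R) : Prop := SkewData {
  skew_ring : subring_set B;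
  skew_yB : forall b, B b -> B (commutator y b);
  skew_Q : additive_set Q;
  skew_QsubB : Q `<=` B;
  skew_BQ : forall b q, B b -> Q q -> Q (b * q);
  skew_QB : forall q b, Q q -> B b -> Q (q * b);
  skew_yQ : forall q, Q q -> Q (commutator y q)
}.

Section Filtration.
Context (R : nzRingType) (B Q : set R) (y : R) (H : skew_data B Q y).

Let yB := skew_yB H.
Let Q_add := skew_Q H.
Let QsubB := skew_QsubB H.
Let BQ := skew_BQ H.
Let QB := skew_QB H.
Let yQ := skew_yQ H.
Let B_add : additive_set B. Proof. by case: (skew_ring H). Qed.
Let B1 : B 1. Proof. by case: (skew_ring H). Qed.
Let BM a b : B a -> B b -> B (a * b).
Proof. by case: (skew_ring H) => _ _; apply. Qed.

(** Degrees are taken modulo [Q]: a power of [y] with coefficient in [Q] does not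
    count. *)
Definition degree_lt m : set R := [set w | exists p : {poly R},
  [/\ forall i, B p`_i, forall i, (m <= i)%N -> Q p`_i & w = p.[y]]].

Lemma degree_lt_ind m (S : set R) : additive_set S ->
  (forall i b, (i < m)%N -> B b -> S (b * y ^+ i)) ->
  (forall i q, Q q -> S (q * y ^+ i)) ->
  degree_lt m `<=` S.
Proof.
move=> S_add SB SQ w [p [pB pQ ->]]; rewrite horner_coef.
apply: additive_sum => // i _; have [lt_im|le_mi] := ltnP i m; first exact: SB.
exact/SQ/pQ.
Qed.

Lemma degree_lt_additive m : additive_set (degree_lt m).
Proof.
split=> [|_ _ [p [pB pQ ->]] [q [qB qQ ->]]].
  by exists 0; rewrite horner0; split=> // i *; rewrite coef0; exact: additive0.
exists (p - q); rewrite hornerD hornerN; split=> // i *; rewrite coefB.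
  exact: additiveB.
by apply: additiveB => //; [exact: pQ | exact: qQ].
Qed.
Hint Resolve degree_lt_additive : core.

Lemma degree_lt_mono m m' : (m <= m')%N -> degree_lt m `<=` degree_lt m'.
Proof.
move=> le_mm' _ [p [pB pQ ->]]; exists p; split=> // i le_m'i.
exact/pQ/(leq_trans le_mm').
Qed.

Lemma degree_lt_monomial m i b : (i < m)%N -> B b -> degree_lt m (b * y ^+ i).
Proof.
move=> lt_im Bb; exists (b *: 'X^i); split=> [j|j le_mj|].
- by rewrite coefZ coefXn; case: eqP => _; rewrite ?mulr1 ?mulr0 //; exact: additive0.
- rewrite coefZ coefXn; case: eqP => [eji|_]; last by rewrite mulr0; exact: additive0.
  by move: le_mj; rewrite eji leqNgt lt_im.
- by rewrite hornerZ hornerXn.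
Qed.

Lemma degree_lt_coefQ m i q : Q q -> degree_lt m (q * y ^+ i).
Proof.
move=> Qq; exists (q *: 'X^i); rewrite hornerZ hornerXn; split=> // j *;
  rewrite coefZ coefXn; case: eqP => _; rewrite ?mulr1 ?mulr0 //;
  by [exact: QsubB | exact: additive0].
Qed.

Lemma degree_lt0W m : degree_lt 0 `<=` degree_lt m.
Proof. exact: degree_lt_mono. Qed.

Lemma degree_lt_mulBl m b w : B b -> degree_lt m w -> degree_lt m (b * w).
Proof.
move=> Bb [p [pB pQ ->]]; exists (b *: p); rewrite hornerZ.
by split=> // i *; rewrite coefZ; [exact: BM | apply: BQ => //; exact: pQ].
Qed.

Lemma coefQ_mul m q w : Q q -> degree_lt m w -> degree_lt 0 (q * w).
Proof.
move=> Qq [p [pB pQ ->]]; exists (q *: p); rewrite hornerZ.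
by split=> // i *; rewrite coefZ; [apply: BM => //; exact: QsubB | exact: QB].
Qed.

Lemma degree_lt_mul_yr m w : degree_lt m w -> degree_lt m.+1 (w * y).
Proof.
case=> p [pB pQ ->]; exists (p * 'X); rewrite hornerMX; split=> // -[|i] *;
  by rewrite coefMX //=; try exact: additive0; apply: pQ.
Qed.

Lemma degree_lt0_mul_yr w : degree_lt 0 w -> degree_lt 0 (w * y).
Proof.
case=> p [pB pQ ->]; exists (p * 'X); rewrite hornerMX; split=> // -[|i] *;
  by rewrite coefMX //=; try exact: additive0; apply: pQ.
Qed.

Lemma preim_additive (S : set R) (f : R -> R) :
  additive_set S -> {morph f : a b / a - b} -> additive_set [set w | S (f w)].
Proof.
move=> S_add fB; split=> [|a b Sa Sb] /=; last by rewrite fB; apply: additiveB.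
by rewrite -(subrr 0) fB subrr; exact: additive0.
Qed.

Let mulr_preim (S : set R) b : additive_set S -> additive_set [set w | S (w * b)].
Proof. by move=> S_add; apply: preim_additive => // u v; rewrite mulrBl. Qed.
Let mull_preim (S : set R) b : additive_set S -> additive_set [set w | S (b * w)].
Proof. by move=> S_add; apply: preim_additive => // u v; rewrite mulrBr. Qed.

Lemma degree_lt_mul_yl m w : degree_lt m w -> degree_lt m.+1 (y * w).
Proof.
move: w; apply: degree_lt_ind => [|i b lt_im Bb|i q Qq] /=.
- exact: mull_preim.
- rewrite mulrA (commutatorl y) mulrDl -mulrA -exprS; apply: additiveD => //.
    exact: degree_lt_monomial.
  by apply: degree_lt_monomial; [exact: ltnW | exact: yB].
- rewrite mulrA (commutatorl y) mulrDl -mulrA -exprS; apply: additiveD => //.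
    exact: degree_lt_coefQ.
  by apply: degree_lt_coefQ; exact: yQ.
Qed.

Lemma degree_lt0_mul_yl w : degree_lt 0 w -> degree_lt 0 (y * w).
Proof.
move: w; apply: degree_lt_ind => [|//|i q Qq] /=; first exact: mull_preim.
rewrite mulrA (commutatorl y) mulrDl -mulrA -exprS; apply: additiveD => //.
  exact: degree_lt_coefQ.
by apply: degree_lt_coefQ; exact: yQ.
Qed.

Lemma degree_lt_mul_Xl m i w : degree_lt m w -> degree_lt (i + m) (y ^+ i * w).
Proof.
move=> Gw; elim: i => [|i IH]; first by rewrite expr0 mul1r.
by rewrite exprS -mulrA; apply: degree_lt_mul_yl.
Qed.

Lemma degree_lt0_mul_Xl i w : degree_lt 0 w -> degree_lt 0 (y ^+ i * w).
Proof.
move=> Gw; elim: i => [|i IH]; first by rewrite expr0 mul1r.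
by rewrite exprS -mulrA; apply: degree_lt0_mul_yl.
Qed.

Lemma degree_lt_mul_Xr m i w : degree_lt m w -> degree_lt (m + i) (w * y ^+ i).
Proof.
move=> Gw; elim: i => [|i IH]; first by rewrite expr0 mulr1 addn0.
by rewrite exprSr mulrA addnS; apply: degree_lt_mul_yr.
Qed.

(** Moving a power of [y] across a coefficient only creates lower terms; this
    is what makes leading coefficients multiplicative. *)
Lemma expy_mulB i b : B b -> degree_lt i (y ^+ i * b - b * y ^+ i).
Proof.
move=> Bb; elim: i => [|i IH].
  by rewrite expr0 mul1r mulr1 subrr; exact: additive0.
have -> : y ^+ i.+1 * b - b * y ^+ i.+1 =
    y * (y ^+ i * b - b * y ^+ i) + commutator y b * y ^+ i.
  rewrite /commutator mulrBr mulrBl !mulrA -exprS -[b * y * _]mulrA -exprS.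
  by rewrite addrA subrK.
apply: additiveD => //; first exact: degree_lt_mul_yl.
by apply: degree_lt_monomial => //; exact: yB.
Qed.

Lemma degree_lt_mulBr m w b : B b -> degree_lt m w -> degree_lt m (w * b).
Proof.
move=> Bb; move: w; apply: degree_lt_ind => [|i c lt_im Bc|i q Qq] /=.
- exact: mulr_preim.
- rewrite -mulrA -[y ^+ i * b](subrK (b * y ^+ i)) mulrDr mulrA.
  apply: additiveD => //; last by apply: degree_lt_monomial => //; exact: BM.
  apply: degree_lt_mulBl => //.
  by apply: degree_lt_mono (ltnW lt_im) _ _; exact: expy_mulB.
- apply: degree_lt0W; rewrite -mulrA -[y ^+ i * b](subrK (b * y ^+ i)) mulrDr mulrA.
  apply: additiveD => //; last by apply: degree_lt_coefQ; exact: QB.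
  exact: coefQ_mul (expy_mulB _ Bb).
Qed.

Definition adjoin_set : set R := \bigcup_m degree_lt m.

Lemma adjoin_additive : additive_set adjoin_set.
Proof.
split=> [|a b [m _ Ga] [m' _ Gb]]; first by exists 0; last exact: additive0.
exists (maxn m m') => //; apply: additiveB => //.
  exact: degree_lt_mono (leq_maxl _ _) _ _.
exact: degree_lt_mono (leq_maxr _ _) _ _.
Qed.

Lemma adjoin_degree_lt m w : degree_lt m w -> adjoin_set w.
Proof. by exists m. Qed.

Lemma adjoinB b : B b -> adjoin_set b.
Proof.
by move=> Bb; exists 1 => //; rewrite -[b]mulr1 -(expr0 y); apply: degree_lt_monomial.
Qed.

Lemma adjoin_monomial b i : B b -> adjoin_set (b * y ^+ i).
Proof. by move=> Bb; exists i.+1 => //; apply: degree_lt_monomial. Qed.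

Lemma adjoin_ind (S : set R) : additive_set S ->
  (forall b i, B b -> S (b * y ^+ i)) -> adjoin_set `<=` S.
Proof.
move=> S_add SB w [m _ Gw]; move: w Gw.
by apply: degree_lt_ind => // *; apply: SB => //; exact: QsubB.
Qed.

Lemma degree_lt0_mulr w v : degree_lt 0 w -> adjoin_set v -> degree_lt 0 (w * v).
Proof.
move=> Gw; move: v; apply: adjoin_ind => [|b i Bb] /=; first exact: mull_preim.
rewrite mulrA; elim: i => [|i IH]; first by rewrite mulr1; apply: degree_lt_mulBr.
by rewrite exprSr mulrA; apply: degree_lt0_mul_yr.
Qed.

Lemma degree_lt0_mull w v : degree_lt 0 w -> adjoin_set v -> degree_lt 0 (v * w).
Proof.
move=> Gw; move: v; apply: adjoin_ind => [|b i Bb] /=; first exact: mulr_preim.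
by rewrite -mulrA; apply: degree_lt_mulBl => //; apply: degree_lt0_mul_Xl.
Qed.

Lemma degree_lt_mul a b w v :
  degree_lt a w -> degree_lt b.+1 v -> degree_lt (a + b) (w * v).
Proof.
move=> Gw Gv; move: w Gw; apply: degree_lt_ind => [|i c lt_ia Bc|i q Qq] /=.
- exact: mulr_preim.
- rewrite -mulrA; apply: degree_lt_mulBl => //.
  by apply: degree_lt_mono (degree_lt_mul_Xl i Gv); rewrite addnS ltn_add2r.
- apply: degree_lt0W; apply: degree_lt0_mulr; last exact: adjoin_degree_lt Gv.
  exact: degree_lt_coefQ.
Qed.

Lemma adjoin_mul w v : adjoin_set w -> adjoin_set v -> adjoin_set (w * v).
Proof.
case=> a _ Gw [b _ Gv]; exists (a + b)%N => //; apply: degree_lt_mul => //.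
exact: degree_lt_mono Gv.
Qed.

Lemma adjoin_y : adjoin_set y.
Proof. by rewrite -[y]mul1r -[X in _ * X]expr1; apply: adjoin_monomial. Qed.

Lemma adjoin_subring : subring_set adjoin_set.
Proof.
by split; [exact: adjoin_additive | exact: adjoinB | exact: adjoin_mul].
Qed.

Lemma degree_ltS m w : degree_lt m.+1 w ->
  exists2 b, B b & degree_lt m (w - b * y ^+ m).
Proof.
case=> p [pB pQ ->]; exists p`_m => //; exists (p - p`_m *: 'X^m).
split=> [i|i le_mi|]; last by rewrite hornerD hornerN hornerZ hornerXn.
  rewrite coefB coefZ coefXn; apply: additiveB => //.
  by case: eqP => _; rewrite ?mulr1 ?mulr0 //; exact: additive0.
rewrite coefB coefZ coefXn; move: le_mi; rewrite leq_eqVlt eq_sym.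
case: eqP => [->|_] /= lt_mi; first by rewrite mulr1 subrr; exact: additive0.
by rewrite mulr0 subr0; apply: pQ.
Qed.

Lemma degree_lt_lead m w b :
  B b -> degree_lt m (w - b * y ^+ m) -> degree_lt m.+1 w.
Proof.
move=> Bb Gw; apply: additive_subl (degree_lt_mono (leqnSn m) Gw) _ => //.
exact: degree_lt_monomial.
Qed.

(** A leading coefficient is determined modulo [Q] once the powers of [y] are
    independent over [B]. *)
Lemma degree_lt_coef m b :
  (forall p : {poly R}, (forall i, B p`_i) -> p.[y] = 0 -> p = 0) ->
  B b -> degree_lt m (b * y ^+ m) -> Q b.
Proof.
move=> y_free Bb [p [pB pQ e]].
have /y_free : forall i, B (b *: 'X^m - p)`_i.
  move=> i; rewrite coefB coefZ coefXn; apply: additiveB => //.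
  by case: eqP => _; rewrite ?mulr1 ?mulr0 //; exact: additive0.
rewrite hornerD hornerN hornerZ hornerXn e subrr => /(_ erefl)/polyP/(_ m).
rewrite coefB coefZ coefXn eqxx mulr1 coef0 => /eqP; rewrite subr_eq0 => /eqP ->.
exact: pQ.
Qed.

Lemma degree_lt_lead_mul m m' w v b c : B b -> B c ->
  degree_lt m (w - b * y ^+ m) -> degree_lt m' (v - c * y ^+ m') ->
  degree_lt (m + m') (w * v - b * c * y ^+ (m + m')).
Proof.
move=> Bb Bc Gw Gv.
have -> : w * v - b * c * y ^+ (m + m') = (w - b * y ^+ m) * v +
    (b * (y ^+ m * (v - c * y ^+ m')) + b * ((y ^+ m * c - c * y ^+ m) * y ^+ m')).
  rewrite exprD !mulrBl !mulrBr !mulrA.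
  by rewrite !subrKA.
apply: additiveD => //; first exact: degree_lt_mul (degree_lt_lead Bc Gv).
apply: additiveD => //; apply: degree_lt_mulBl => //; first exact: degree_lt_mul_Xl.
exact/degree_lt_mul_Xr/expy_mulB.
Qed.

End Filtration.

(** * Products of ideals *)

Section IdealMul.
Context (R : nzRingType).
Implicit Types I J S : set R.

Lemma ideal_mul_ind I J S : additive_set S ->
  (forall a b, I a -> J b -> S (a * b)) -> ideal_mul I J `<=` S.
Proof.
move=> S_add SIJ _ [n [a [b [ab ->]]]]; apply: additive_sum => // i _.
by case: (ab i) => ? ?; exact: SIJ.
Qed.

Lemma ideal_mulM I J a b : I a -> J b -> ideal_mul I J (a * b).
Proof.
by move=> Ia Jb; exists 1, (fun=> a), (fun=> b); rewrite big_ord1.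
Qed.

Lemma ideal_mul_additive I J : additive_set I -> additive_set (ideal_mul I J).
Proof.
move=> I_add; split=> [|_ _ [n [a [b [ab ->]]]] [m [c [d [cd ->]]]]].
  by exists 0, (fun=> 0), (fun=> 0); split=> [[]|] //; rewrite big_ord0.
exists (n + m)%N, (fun i => match split i with inl j => a j | inr j => - c j end),
  (fun i => match split i with inl j => b j | inr j => d j end); split.
  move=> i; case: (split i) => j; first exact: ab.
  by case: (cd j) => ? ?; split=> //; exact: additiveN.
rewrite big_split_ord /=; congr (_ + _).
  by apply: eq_bigr => i _; rewrite -[lshift m i]/(unsplit (inl _)) unsplitK.
rewrite -sumrN; apply: eq_bigr => i _.
by rewrite -[rshift n i]/(unsplit (inr _)) unsplitK mulNr.
Qed.

Lemma ideal_mulS I I' J J' : I `<=` I' -> J `<=` J' ->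
  ideal_mul I J `<=` ideal_mul I' J'.
Proof.
move=> sII sJJ _ [n [a [b [ab ->]]]]; exists n, a, b; split=> // i.
by case: (ab i) => ? ?; split; [exact: sII | exact: sJJ].
Qed.

Lemma ideal_expS I J k : I `<=` J -> ideal_exp I k `<=` ideal_exp J k.
Proof. by move=> sIJ; elim: k => //= k IH; apply: ideal_mulS. Qed.

Lemma ideal_residualS I J : I `<=` J -> ideal_residual I `<=` ideal_residual J.
Proof. by move=> sIJ x Ix k _; apply: ideal_expS sIJ _ (Ix k _). Qed.
End IdealMul.

(** * Orders of stable ideals add up *)

(** When [Z] generates the whole ring over [A], the right ideal of the whole ring that
    is generated by a stable ideal of [A] is two-sided. *)
Record stable_ideal (R : nzRingType) (Z A J : set R) : Prop := StableIdeal {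
  stable_additive : additive_set J;
  stable_sub : J `<=` A;
  stable_mull : forall a j, A a -> J j -> J (a * j);
  stable_mulr : forall a j, A a -> J j -> J (j * a);
  stable_comm : forall z j, Z z -> J j -> J (commutator z j)
}.

Lemma stable_setI (R : nzRingType) (Z A M : set R) : subring_set A ->
  (forall z a, Z z -> A a -> A (commutator z a)) -> two_sided_ideal M ->
  stable_ideal Z A (A `&` M).
Proof.
move=> [A_add A1 AM] ZA [M0 MD MlM MrM].
have MB a b : M a -> M b -> M (a - b).
  by move=> Ma Mb; apply: MD => //; rewrite -mulN1r; exact: MlM.
split.
- split=> [|a b [? ?] [? ?]]; first by split=> //; exact: additive0.
  by split; [exact: additiveB | exact: MB].
- by move=> a [].
- by move=> a j Aa [Aj Mj]; split; [exact: AM | exact: MlM].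
- by move=> a j Aa [Aj Mj]; split; [exact: AM | exact: MrM].
- by move=> z j Zz [Aj Mj]; split; [exact: ZA | apply: MB; [exact: MlM | exact: MrM]].
Qed.

Lemma stable_ideal_mul (R : nzRingType) (Z A J K : set R) : subring_set A ->
  stable_ideal Z A J -> stable_ideal Z A K -> stable_ideal Z A (ideal_mul J K).
Proof.
move=> [A_add _ AM] Jst Kst.
have JK_add := ideal_mul_additive K (stable_additive Jst).
have mul_pre (f : R -> R) : {morph f : a b / a - b} ->
    (forall j k, J j -> K k -> ideal_mul J K (f (j * k))) ->
    forall w, ideal_mul J K w -> ideal_mul J K (f w).
  move=> fB Sf; apply: ideal_mul_ind Sf; exact: preim_additive JK_add fB.
split=> //.
- apply: ideal_mul_ind => // a b Ja Kb.
  by apply: AM; [exact: stable_sub Jst _ Ja | exact: stable_sub Kst _ Kb].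
- move=> a w Aa; apply: (mul_pre ( *%R a)) => [u v|j k Jj Kk]; first exact: mulrBr.
  by rewrite mulrA; apply: ideal_mulM => //; exact: stable_mull Jst _ _ Aa Jj.
- move=> a w Aa; apply: (mul_pre (fun w => w * a)) => [u v|j k Jj Kk].
    exact: mulrBl.
  by rewrite -mulrA; apply: ideal_mulM => //; exact: stable_mulr Kst _ _ Aa Kk.
- move=> z w Zz; apply: mul_pre => [u v|j k Jj Kk].
    by rewrite /commutator mulrBr mulrBl !opprB addrACA [RHS]addrACA; congr (_ + _);
       rewrite addrC.
  rewrite commutatorM; apply: (additiveD JK_add); apply: ideal_mulM => //.
    exact: stable_comm Jst _ _ Zz Jj.
  exact: stable_comm Kst _ _ Zz Kk.
Qed.

Section Order.
Context (R : nzRingType) (B Z M : set R) (y : R).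
Context (B_ring : subring_set B).
Context (ZB : forall z b, Z z -> B b -> B (commutator z b)).
Context (M_ideal : two_sided_ideal M).

(** A maximal ideal is prime relative to stable ideals. If [C v] lies in [M], then
    [C u] lies in [M] for every [u] in [R v], as [C] can be moved across the
    generators; so [C] lies in the two-sided ideal of all [r] that send into [M]
    every [u] with [C u] in [M]. This ideal contains [M] properly, hence [1]. *)
Lemma maximal_stable_prime (C : set R) v :
  (forall K, two_sided_ideal K -> M `<=` K -> ~ (K `<=` M) -> K 1) ->
  (forall S, subring_set S -> B `<=` S -> Z `<=` S -> forall r, S r) ->
  stable_ideal Z B C -> ~ (C `<=` M) -> (forall c, C c -> M (c * v)) -> M v.
Proof.
move=> M_max Zgen Cst CM Cv.
have [M0 MD MlM MrM] := M_ideal.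
have M_add : additive_set M.
  by split=> // a b Ma Mb; apply: MD => //; rewrite -mulN1r; exact: MlM.
pose N := [set u | forall c, C c -> M (c * u)].
have N_add : additive_set N.
  split=> [|a b Na Nb] c Cc; first by rewrite mulr0.
  by rewrite mulrBr; apply: additiveB => //; [exact: Na | exact: Nb].
have RN r u : N u -> N (r * u).
  pose S := [set r | forall u, N u -> N (r * u)].
  suff SS : forall r, S r by exact: SS.
  apply: Zgen => [|b Bb v' Nv c Cc|z Zz v' Nv c Cc] /=.
  - split=> [|w Nw|a b Sa Sb w Nw]; rewrite ?mul1r //.
      split=> [w Nw|a b Sa Sb w Nw]; first by rewrite mul0r; exact: (additive0 N_add).
      by rewrite mulrBl; apply: (additiveB N_add); [exact: Sa | exact: Sb].
    by rewrite -mulrA; apply: Sa; exact: Sb.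
  - by rewrite mulrA; apply: Nv; exact: stable_mulr Cst _ _ Bb Cc.
  - have -> : c * (z * v') = z * (c * v') - commutator z c * v'.
      by rewrite mulrBl !mulrA subKr.
    apply: additiveB => //; first exact/MlM/Nv.
    exact/Nv/(stable_comm Cst).
pose K := [set r | forall u, N u -> M (r * u)].
suff : K 1 by move=> /(_ v Cv); rewrite mul1r.
apply: M_max => [|m Mm u _|]; last 1 first.
- by move=> KM; apply: CM => c Cc; apply: KM => u; exact.
- split=> [u _|a b Ka Kb u Nu|a r Kr u Nu|a r Kr u Nu].
  + by rewrite mul0r.
  + by rewrite mulrDl; apply: MD; [exact: Ka | exact: Kb].
  + by rewrite -mulrA; apply: MlM; exact: Kr.
  + by rewrite -mulrA; apply: Kr; exact: RN.
- exact: MrM.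
Qed.

End Order.

Definition lead_coefs (R : nzRingType) (B Q : set R) (y : R) (J : set R) d : set R :=
  [set c | B c /\ exists2 f, J f & degree_lt B Q y d (f - c * y ^+ d)].

(** If [B / Q] has no stable ideals but [0] and itself, a stable ideal [J] is
    generated modulo [Q] by a monic polynomial in [y], and [a] is a lower bound
    for the degree of that polynomial. *)
Definition order_ge (R : nzRingType) (B Q : set R) (y : R) (J : set R) a : Prop :=
  J `&` degree_lt B Q y a `<=` degree_lt B Q y 0.

Section LeadCoefs.
Context (R : nzRingType) (B Q : set R) (y : R) (H : skew_data B Q y).
Context (J : set R) (J_add : additive_set J) (d : nat).

Let B_add : additive_set B. Proof. by case: (skew_ring H). Qed.
Let G_add m : additive_set (degree_lt B Q y m) := degree_lt_additive H m.

Lemma lead_coefs_additive : additive_set (lead_coefs B Q y J d).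
Proof.
split=> [|a b [Ba [f Jf Gf]] [Bb [g Jg Gg]]].
  split; first exact: additive0.
  by exists 0; rewrite ?mul0r ?subr0; exact: additive0.
split; first exact: additiveB.
exists (f - g); first exact: additiveB.
have -> : f - g - (a - b) * y ^+ d = f - a * y ^+ d - (g - b * y ^+ d).
  by rewrite mulrBl !opprB addrACA [RHS]addrACA [- g - _]addrC.
exact: additiveB.
Qed.

Lemma lead_coefs_mull b a : (forall c x, B c -> J x -> J (c * x)) ->
  B b -> lead_coefs B Q y J d a -> lead_coefs B Q y J d (b * a).
Proof.
move=> BJ Bb [Ba [f Jf Gf]]; split; first by case: (skew_ring H) => _ _; apply.
exists (b * f); first exact: BJ.
by rewrite -mulrA -mulrBr; apply: (degree_lt_mulBl H).
Qed.
End LeadCoefs.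

Section OrderMul.
Context (R : nzRingType) (B Z M : set R) (y : R).
Context (B_ring : subring_set B).
Context (ZB : forall z b, Z z -> B b -> B (commutator z b)) (Zy : Z y).
Context (M_ideal : two_sided_ideal M).
Context (M_prime : forall C v, stable_ideal Z B C -> ~ (C `<=` M) ->
  (forall c, C c -> M (c * v)) -> M v).
Context (y_eigen : forall z, Z z -> exists g,
  [/\ B g, forall r, g * r = r * g & B (commutator z y - g * y)]).
Context (y_free : forall p : {poly R}, (forall i, B p`_i) -> p.[y] = 0 -> p = 0).

Let Q := B `&` M.
Let G := degree_lt B Q y.
Let A := adjoin_set B Q y.

Let Q_stable : stable_ideal Z B Q.
Proof. exact: stable_setI. Qed.

Lemma skew_data_setI : skew_data B Q y.
Proof.
split=> //.
- by move=> b; exact: ZB.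
- exact: stable_additive Q_stable.
- by move=> b [].
- by move=> b q Bb; exact: stable_mull Q_stable _ _ Bb.
- by move=> q b Qq Bb; exact: stable_mulr Q_stable _ _ Bb Qq.
- by move=> q; exact: stable_comm Q_stable _ _ Zy.
Qed.
Let H := skew_data_setI.
Let G_add m : additive_set (G m) := degree_lt_additive H m.
Hint Resolve G_add : core.

Lemma commutator_expy z g i : (forall r, g * r = r * g) ->
  Z z -> B (commutator z y - g * y) ->
  G i (commutator z (y ^+ i) - g *+ i * y ^+ i).
Proof.
move=> gC Zz Bzy; elim: i => [|i IH].
  by rewrite mulr0n mul0r subr0 expr0 /commutator mulr1 mul1r subrr; exact: additive0.
have -> : commutator z (y ^+ i.+1) - g *+ i.+1 * y ^+ i.+1 =
    (commutator z (y ^+ i) - g *+ i * y ^+ i) * y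
    + y ^+ i * (commutator z y - g * y).
  rewrite exprSr commutatorM mulrSr [(g *+ i + g) * _]mulrDl opprD addrACA.
  congr (_ + _); first by rewrite [RHS]mulrBl mulrA.
  by rewrite [RHS]mulrBr [X in _ = _ - X]mulrA -(gC (y ^+ i)) mulrA.
apply: additiveD => //; first exact: (degree_lt_mul_yr H).
rewrite -addn1; apply: (degree_lt_mul_Xl H).
by rewrite -[commutator z y - g * y]mulr1 -(expr0 y); apply: (degree_lt_monomial H).
Qed.

Lemma commutator_expyW z i : Z z -> G i.+1 (commutator z (y ^+ i)).
Proof.
move=> Zz; have [g [Bg gC Bzy]] := y_eigen Zz.
have [B_add _ _] := B_ring.
exact: (degree_lt_lead H (additiveMn B_add i Bg) (commutator_expy i gC Zz Bzy)).
Qed.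

Lemma degree_lt_comm m z w : Z z -> G m w -> G m (commutator z w).
Proof.
move=> Zz; move: w; apply: degree_lt_ind => [|i b lt_im Bb|i q Qq] /=.
- apply: preim_additive => // u v.
  by rewrite /commutator mulrBr mulrBl !opprB addrACA [RHS]addrACA; congr (_ + _);
     rewrite addrC.
- rewrite commutatorM; apply: additiveD => //.
    by apply: (degree_lt_monomial H) => //; exact: ZB.
  apply: (degree_lt_mulBl H) => //.
  by apply: degree_lt_mono lt_im _ _; exact: commutator_expyW.
- rewrite commutatorM; apply: additiveD => //.
    by apply: (degree_lt_coefQ H); exact: stable_comm Q_stable _ _ Zz Qq.
  by apply: degree_lt0W; apply: (coefQ_mul H) => //; exact: commutator_expyW.
Qed.

Lemma lead_coefs_stable J d : stable_ideal Z A J ->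
  stable_ideal Z B (lead_coefs B Q y J d).
Proof.
move=> Jst; have [B_add _ BM] := B_ring; have J_add := stable_additive Jst.
have AB := adjoinB H.
have add := lead_coefs_additive H J_add d.
have mull a j : B a -> lead_coefs B Q y J d j -> lead_coefs B Q y J d (a * j).
  apply: (lead_coefs_mull H) => b f Bb Jf; apply: (stable_mull Jst) => //.
  exact: AB.
split=> //.
- by move=> c [].
- move=> b c Bb [Bc [f Jf Gf]]; split; first exact: BM.
  exists (f * b); first by apply: (stable_mulr Jst) => //; exact: AB.
  have -> : f * b - c * b * y ^+ d =
      (f - c * y ^+ d) * b + c * (y ^+ d * b - b * y ^+ d).
    by rewrite mulrBl mulrBr !mulrA subrKA.
  apply: additiveD => //; first exact: (degree_lt_mulBr H).
  by apply: (degree_lt_mulBl H) => //; exact: (expy_mulB H).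
- move=> z c Zz Cc; have [Bc [f Jf Gf]] := Cc.
  have [g [Bg gC Bzy]] := y_eigen Zz.
  suff : lead_coefs B Q y J d (commutator z c + g *+ d * c).
    move=> Czc; apply: (additive_subl add _ (additiveN add _)).
      by rewrite opprK; exact: Czc.
    by apply: mull => //; exact: (additiveMn B_add).
  split.
    apply: additiveD => //; first exact: ZB.
    by apply: BM => //; exact: (additiveMn B_add).
  exists (commutator z f); first exact: stable_comm Jst _ _ Zz Jf.
  have gdC r : g *+ d * r = r * (g *+ d) by rewrite mulrnAl mulrnAr gC.
  have -> : commutator z f - (commutator z c + g *+ d * c) * y ^+ d =
     commutator z (f - c * y ^+ d) + c * (commutator z (y ^+ d) - g *+ d * y ^+ d).
    have -> : commutator z f = commutator z (f - c * y ^+ d) +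
        (commutator z c * y ^+ d + c * commutator z (y ^+ d)).
      by rewrite -commutatorM -commutatorD subrK.
    rewrite -addrA; congr (_ + _).
    rewrite [(_ + g *+ d * c) * _]mulrDl [RHS]mulrBr opprD addrACA subrr add0r.
    by rewrite gdC -!mulrA gdC.
  apply: additiveD => //; first exact: degree_lt_comm.
  by apply: (degree_lt_mulBl H) => //; exact: commutator_expy.
Qed.

(** Were [J] generated modulo [Q] by a monic polynomial [f] of degree [d >= a], an
    element of [J K] would be [f v] with [v] in [K], and its degree would be [d]
    plus that of [v]. In general there is one [f] of degree [d] for each leading
    coefficient [e], and what remains true is that, after multiplication by
    finitely many leading coefficients, [e w] equals [f v] modulo [Q] with the same
    [v] for all [e]. Leading coefficients form a stable ideal outside [M], so that
    multiplication by them loses nothing modulo [M]. *)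
Lemma order_ge_mul J K a b : stable_ideal Z A J -> stable_ideal Z A K ->
  order_ge B Q y J a -> order_ge B Q y K b ->
  order_ge B Q y (ideal_mul J K) (a + b).
Proof.
move=> Jst Kst ordJ ordK.
have [B_add _ BM] := B_ring.
have J_add := stable_additive Jst; have K_add := stable_additive Kst.
have KA := stable_sub Kst; have AB := adjoinB H.
have A_add := adjoin_additive H.

have [JG0|JG0] := pselect (J `<=` G 0).
  move=> w [JKw _]; move: w JKw; apply: ideal_mul_ind => // u k Ju Kk.
  by apply: (degree_lt0_mulr H); [exact: JG0 | exact: KA].
(* [d] is the least degree modulo [Q] of an element of [J] *)
have ex_d : exists d, `[< ~ (J `&` G d `<=` G 0) >].
  apply: contrapT => no_d; apply: JG0 => u Ju.
  have [m _ Gu] := stable_sub Jst Ju.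
  apply: contrapT => nGu; apply: no_d; exists m; apply/asboolP => JGm.
  exact/nGu/JGm.
case: (ex_minnP ex_d) => -[|d] /asboolP Jd d_min {ex_d}.
  by case: Jd => w [].
have {d_min} Jd0 : J `&` G d `<=` G 0.
  by apply: contrapT => nJ; have /d_min := asboolT nJ; rewrite ltnn.
have le_ad : (a <= d)%N.
  rewrite leqNgt; apply/negP => lt_da; apply: Jd => w [Jw Gw]; apply: ordJ; split=> //.
  exact: degree_lt_mono Gw.
pose C := lead_coefs B Q y J d.
have Cst : stable_ideal Z B C by exact: lead_coefs_stable.
have C_add := stable_additive Cst.
have CB := stable_sub Cst.
have CM : ~ (C `<=` M).
  move=> CM; apply: Jd => w [Jw Gw].
  have [c Bc Gwc] := degree_ltS H Gw.
  apply: Jd0; split=> //; apply: (additive_subl (G_add d) Gwc).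
  apply: (degree_lt_coefQ H); split=> //; apply: CM; split=> //.
  by exists w.
(* cancelling [C] on the left *)
have C_cancel b' : B b' -> (forall c, C c -> Q (c * b')) -> Q b'.
  move=> Bb Cb; split=> //; apply: M_prime Cst CM _ => c /Cb.
  by case.
have C_cancelG w : A w -> (forall c, C c -> G 0 (c * w)) -> G 0 w.
  case=> m _ Gw Cw; elim: m => [//|m IH] in Gw *.
  have [b' Bb Gwb] := degree_ltS H Gw.
  apply: IH; apply: (additive_subl (G_add m) Gwb).
  apply: (degree_lt_coefQ H); apply: C_cancel => // c Cc.
  apply: (degree_lt_coef H y_free); first by apply: BM => //; exact: CB.
  apply: (additive_subr (G_add m) _ (degree_lt0W m (Cw c Cc))).
  by rewrite -mulrA -mulrBr; apply: (degree_lt_mulBl H) => //; exact: CB.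
pose lead_of e f := J f /\ G d (f - e * y ^+ d).
have lead_uniq e f f' : lead_of e f -> lead_of e f' -> G 0 (f - f').
  move=> [Jf Gf] [Jf' Gf']; apply: Jd0; split; first exact: additiveB.
  have -> : f - f' = f - e * y ^+ d - (f' - e * y ^+ d).
    by rewrite opprB subrKA.
  exact: additiveB.
have lead_Bl c e f : B c -> lead_of e f -> lead_of (c * e) (c * f).
  move=> Bc [Jf Gf]; split; first by apply: (stable_mull Jst) => //; exact: AB.
  by rewrite -mulrA -mulrBr; apply: (degree_lt_mulBl H).
have lead_Br c e f : B c -> B e -> lead_of e f -> lead_of (e * c) (f * c).
  move=> Bc Be [Jf Gf]; split; first by apply: (stable_mulr Jst) => //; exact: AB.
  have -> : f * c - e * c * y ^+ d =
      (f - e * y ^+ d) * c + e * (y ^+ d * c - c * y ^+ d).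
    by rewrite mulrBl mulrBr !mulrA subrKA.
  apply: additiveD => //; first exact: (degree_lt_mulBr H).
  by apply: (degree_lt_mulBl H) => //; exact: (expy_mulB H).
(* [w] is a multiple of an element of degree [d], up to a leading coefficient *)
pose Theta w := exists2 v, K v &
  forall e f, C e -> lead_of e f -> G 0 (e * w - f * v).
have Theta_add : additive_set Theta.
  split=> [|w w' [v Kv hv] [v' Kv' hv']].
    by exists 0; [exact: additive0|move=> *; rewrite !mulr0 subrr; exact: additive0].
  exists (v - v'); first exact: additiveB.
  move=> e f Ce Lef; have -> : e * (w - w') - f * (v - v') =
     e * w - f * v - (e * w' - f * v').
    by rewrite !mulrBr !opprB addrACA [RHS]addrACA; congr (_ + _); rewrite addrC.
  by apply: additiveB => //; [exact: hv | exact: hv'].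
have Theta_C c w : C c -> Theta w -> Theta (c * w).
  move=> Cc [v Kv hv]; exists (c * v).
    by apply: (stable_mull Kst) => //; exact/AB/CB.
  move=> e f Ce Lef.
  have Cec : C (e * c) by apply: (stable_mull Cst) => //; exact: CB.
  have Lec : lead_of (e * c) (f * c) by apply: lead_Br => //; exact: CB.
  by rewrite !mulrA; exact: hv.
(* [Theta] holds after multiplication by any [t] leading coefficients *)
pose X := fix X t : set R :=
  if t is t'.+1 then [set w | forall c, C c -> X t' (c * w)] else Theta.
have X_add t : additive_set (X t).
  elim: t => [//|t IH]; split=> [|u v Xu Xv] c Cc.
    by rewrite mulr0; exact: (additive0 IH).
  by rewrite mulrBr; apply: (additiveB IH); [exact: Xu | exact: Xv].
have X_C t c w : C c -> X t w -> X t (c * w).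
  case: t => [|t] Cc Xw; first exact: Theta_C.
  move=> c' Cc'; rewrite mulrA; apply: Xw.
  by apply: (stable_mull Cst) => //; exact: CB.
have X_mono t t' : (t <= t')%N -> X t `<=` X t'.
  move/subnK <-; elim: (t' - t)%N => [//|k IH] w Xw c Cc.
  by apply: X_C => //; exact: IH.
(* pseudo-division of [u] by the elements of [J] of degree [d] *)
have JK_X t u k : J u -> G t u -> K k -> X t (u * k).
  elim: t u => [|t IH] u Ju Gu Kk.
    exists 0; first exact: additive0.
    move=> e f Ce _; rewrite mulr0 subr0; apply: (degree_lt_mulBl H); first exact: CB.
    by apply: (degree_lt0_mulr H) => //; exact: KA.
  have [le_td|lt_dt] := leqP t.+1 d.
    apply: (X_mono 0%N) => //; exists 0; first exact: additive0.
    move=> e f Ce _; rewrite mulr0 subr0; apply: (degree_lt_mulBl H); first exact: CB.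
    apply: (degree_lt0_mulr H); last exact: KA.
    by apply: Jd0; split=> //; exact: degree_lt_mono Gu.
  move=> c Cc; have [Bc [f Jf Gf]] := Cc; have [b' Bb Gub] := degree_ltS H Gu.
  pose v := b' * y ^+ (t - d).
  have Av : A v by exact: (adjoin_monomial H).
  have -> : c * (u * k) = (c * u - f * v) * k + f * (v * k).
    by rewrite mulrBl !mulrA subrK.
  have Jfv : J (f * v) by exact: stable_mulr Jst _ _ Av Jf.
  apply: (additiveD (X_add t)).
    apply: IH => //.
      by apply: additiveB => //; apply: (stable_mull Jst) => //; exact: AB.
    have -> : c * u - f * v = c * (u - b' * y ^+ t) - (f * v - c * b' * y ^+ t).
      by rewrite mulrBr opprB [c * (b' * _)]mulrA subrKA.
    apply: additiveB => //; first exact: (degree_lt_mulBl H).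
    rewrite -(subnKC (lt_dt : (d <= t)%N)).
    apply: (degree_lt_lead_mul H) => //.
    by rewrite subrr; exact: additive0.
  apply: (X_mono 0%N) => //; exists (c * (v * k)).
    by do 2?apply: (stable_mull Kst) => //; exact: AB.
  move=> e fe Ce Lef; rewrite (mulrA e f) (mulrA fe c) -mulrBl.
  apply: (degree_lt0_mulr H); last first.
    by apply: KA; exact: stable_mull Kst _ _ Av Kk.
  by apply: (lead_uniq (e * c)); [apply: lead_Bl | apply: lead_Br] => //; exact: CB.
(* if [v] had degree [m >= b] modulo [Q], then [f v] would have degree [d + m] *)
have Theta_G0 w : A w -> Theta w -> G (a + b) w -> G 0 w.
  move=> Aw [v Kv hv] Gw.
  suff Gv : G 0 v.
    apply: C_cancelG => // e Ce; have [Be [f Jf Gf]] := Ce.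
    have /hv {}hv : C e by [].
    apply: (additive_subl (G_add 0%N) (hv f _)) => //.
    by apply: (degree_lt0_mull H) => //; exact: (stable_sub Jst).
  have [m _ Gv] := KA _ Kv.
  elim: m => [//|m IH] in Gv *.
  have [le_mb|lt_bm] := leqP m.+1 b.
    by apply: ordK; split=> //; exact: degree_lt_mono Gv.
  have [b' Bb Gvb] := degree_ltS H Gv.
  apply: IH; apply: (additive_subl (G_add m) Gvb).
  apply: (degree_lt_coefQ H); apply: C_cancel => // e Ce.
  have [Be [f Jf Gf]] := Ce.
  apply: (degree_lt_coef H (m := (d + m)%N) y_free); first exact: BM.
  have Gew : G (d + m) (e * w).
    apply: (degree_lt_mulBl H) => //; apply: degree_lt_mono Gw.
    by rewrite leq_add.
  have Gfv : G (d + m) (f * v).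
    apply: (additive_subr (G_add _) _ Gew); apply: degree_lt0W.
    exact: hv.
  apply: (additive_subr (G_add _) _ Gfv).
  exact: (degree_lt_lead_mul H).
move=> w [JKw Gw].
have [t Xw] : exists t, X t w.
  pose S := [set u | exists t, X t u].
  suff : S w by [].
  move: w JKw {Gw}; apply: ideal_mul_ind => [|u k Ju Kk].
    split=> [|u v [t Xu] [t' Xv]]; first by exists 0%N; exact: (additive0 (X_add 0%N)).
    exists (maxn t t'); apply: (additiveB (X_add _)).
      exact: X_mono (leq_maxl _ _) _ _.
    exact: X_mono (leq_maxr _ _) _ _.
  by have [t _ Gu] := stable_sub Jst Ju; exists t; exact: JK_X.
have Aw : A w by exists (a + b)%N.
elim: t w {JKw} => [|t IH] w in Aw Gw Xw *; first exact: Theta_G0.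
apply: C_cancelG => // c Cc; have Bc := CB _ Cc; apply: IH.
- by apply: (adjoin_mul H) => //; exact: AB.
- exact: (degree_lt_mulBl H).
- exact: Xw.
Qed.

End OrderMul.

Lemma exists_maximal_ideal (R : nzRingType) (I : set R) :
  two_sided_ideal I -> ~ I 1 ->
  exists M : set R, [/\ two_sided_ideal M, ~ M 1, I `<=` M &
    forall K, two_sided_ideal K -> M `<=` K -> ~ (K `<=` M) -> K 1].
Proof.
move=> [I0 ID IlM IrM] I1.
(* adjoining [I] makes the empty chain harmless *)
pose P (A : set R) := two_sided_ideal (I `|` A) /\ ~ (I `|` A) 1.
have [F FP Ftot|A [[PA A1] A_max]] := @Zorn_bigcup _ P.
  split; last by move=> [//|[X FX X1]]; case: (FP _ FX) => _; apply; right.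
  split; first by left.
  - move=> x y [Ix|[X FX Xx]] [Iy|[Y FY Yy]].
    + by left; exact: ID.
    + have [[_ D _ _] _] := FP _ FY.
      have [|Yxy] := D x y (or_introl Ix) (or_intror Yy); first by left.
      by right; exists Y.
    + have [[_ D _ _] _] := FP _ FX.
      have [|Xxy] := D x y (or_intror Xx) (or_introl Iy); first by left.
      by right; exists X.
    + have [XY|YX] := Ftot _ _ FX FY.
        have [[_ D _ _] _] := FP _ FY.
        have [|Yxy] := D x y (or_intror (XY _ Xx)) (or_intror Yy); first by left.
        by right; exists Y.
      have [[_ D _ _] _] := FP _ FX.
      have [|Xxy] := D x y (or_intror Xx) (or_intror (YX _ Yy)); first by left.
      by right; exists X.
  - move=> a x [Ix|[X FX Xx]]; first by left; exact: IlM.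
    have [[_ _ D _] _] := FP _ FX.
    by have [|Xax] := D a x (or_intror Xx); [left | right; exists X].
  - move=> a x [Ix|[X FX Xx]]; first by left; exact: IrM.
    have [[_ _ _ D] _] := FP _ FX.
    by have [|Xax] := D a x (or_intror Xx); [left | right; exists X].
exists (I `|` A); split=> // K K_id AK nKA.
apply: contrapT => K1; have IK : I `|` K = K.
  apply/seteqP; split=> [x [Ix|//]|x Kx]; last by right.
  by apply: AK; left.
apply: (A_max K); last by rewrite /P IK.
by split=> [x Ax|KA]; [apply: AK; right | apply: nKA => x /KA; right].
Qed.

(** * Intersections of powers along a tower of subrings *)

(** An iterated ring of differential polynomials over a division ring. In the
    enveloping algebra of a Lie algebra with a full flag of ideals, [B k] is the
    enveloping algebra of the [k]-th ideal, [y k] spans the next ideal modulo that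
    one, and [Z] is the image of the Lie algebra. That [y k] is adjoined to [B k] is
    said by minimality, which is symmetric in left and right. *)
Record tower (R : nzRingType) (Z : set R) (n : nat) (B : nat -> set R)
    (y : nat -> R) : Prop := Tower {
  tower_ring : forall k, (k <= n)%N -> subring_set (B k);
  tower_base : forall b, B 0%N b -> b != 0 -> exists2 c, B 0%N c & c * b = 1;
  tower_top : forall r, B n r;
  tower_y : forall k, (k < n)%N -> Z (y k);
  tower_step : forall k, (k < n)%N ->
    [/\ B k `<=` B k.+1, B k.+1 (y k) & forall S, subring_set S ->
      B k `<=` S -> S (y k) -> B k.+1 `<=` S];
  tower_stable : forall k z b, (k <= n)%N -> Z z -> B k b -> B k (commutator z b);
  tower_eigen : forall k z, (k < n)%N -> Z z -> exists g,
    [/\ B k g, forall r, g * r = r * g & B k (commutator z (y k) - g * y k)];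
  tower_gen : forall S, subring_set S -> B 0%N `<=` S -> Z `<=` S -> forall r, S r;
  tower_free : forall k (p : {poly R}), (k < n)%N ->
    (forall i, B k p`_i) -> p.[y k] = 0 -> p = 0
}.

Lemma skew_data0 (R : nzRingType) (B : set R) (y : R) : subring_set B ->
  (forall b, B b -> B (commutator y b)) -> skew_data B [set 0] y.
Proof.
move=> B_ring yB; have [B_add _ _] := B_ring; split=> //.
- by split=> // _ _ -> ->; rewrite subrr.
- by move=> _ ->; exact: additive0.
- by move=> b _ _ ->; rewrite mulr0.
- by move=> _ b -> _; rewrite mul0r.
- by move=> _ ->; rewrite /commutator mulr0 mul0r subrr.
Qed.

Lemma adjoin_setE (R : nzRingType) (B B' Q : set R) (y : R) :
  skew_data B Q y -> B `<=` B' -> B' y -> subring_set B' ->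
  (forall S, subring_set S -> B `<=` S -> S y -> B' `<=` S) ->
  adjoin_set B Q y = B'.
Proof.
move=> H BB' By [B'_add B'1 mulB] B'_min; apply/seteqP; split.
  apply: (adjoin_ind H) => // b i Bb; apply: (mulB); first exact: BB'.
  by elim: i => [|i IH]; rewrite ?expr0 // exprS; exact: mulB.
apply: B'_min; first exact: (adjoin_subring H).
  exact: (adjoinB H).
exact: (adjoin_y H).
Qed.

Section TowerResidual.
Context (R : nzRingType) (Z : set R) (n : nat) (B : nat -> set R) (y : nat -> R).
Context (T : tower Z n B y).

Definition right_span (X : set R) : set R := ideal_mul X setT.

Lemma right_span_additive X : additive_set X -> additive_set (right_span X).
Proof. exact: ideal_mul_additive. Qed.

Lemma right_span_mulr X x r : additive_set X -> right_span X x -> right_span X (x * r).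
Proof.
move=> X_add; move: x; apply: ideal_mul_ind => [|a b Xa _] /=.
  by apply: (preim_additive (right_span_additive X_add)) => u v; rewrite mulrBl.
by rewrite -mulrA; apply: ideal_mulM.
Qed.

Lemma sub_right_span X : X `<=` right_span X.
Proof. by move=> x Xx; rewrite -[x]mulr1; apply: ideal_mulM. Qed.

Lemma tower_sub k l : (k <= l)%N -> (l <= n)%N -> B k `<=` B l.
Proof.
move=> /subnK <-; elim: (l - k)%N => [|j IH] /= le_jn b Bb //.
have [sub _ _] := tower_step T le_jn.
by apply: sub; apply: IH => //; exact: ltnW.
Qed.

(** Left multiplication by [Z] can be moved to the right of a stable ideal. *)
Lemma right_span_mull k X x r : (k <= n)%N -> stable_ideal Z (B k) X ->
  right_span X x -> right_span X (r * x).
Proof.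
move=> le_kn Xst; have X_add := stable_additive Xst.
have XR_add := right_span_additive X_add.
pose S := [set r | forall x, right_span X x -> right_span X (r * x)].
suff SS : forall r, S r by exact: SS.
have S_of s : (forall a, X a -> forall b, right_span X (s * (a * b))) -> S s.
  move=> Ss; rewrite /S /=; apply: ideal_mul_ind => [|a b Xa _] /=; last exact: Ss.
  by apply: (preim_additive XR_add) => u v; rewrite mulrBr.
apply: (tower_gen T) => [|s Bs|z Zz].
- split=> [|w Xw|a b Sa Sb w Xw]; rewrite ?mul1r //.
    split=> [w Xw|a b Sa Sb w Xw]; first by rewrite mul0r; exact: (additive0 XR_add).
    by rewrite mulrBl; apply: (additiveB XR_add); [exact: Sa | exact: Sb].
  by rewrite -mulrA; apply: Sa; exact: Sb.
- apply: S_of => a Xa b; rewrite mulrA; apply: ideal_mulM => //.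
  by apply: (stable_mull Xst) => //; exact: (tower_sub (leq0n k)).
- apply: S_of => a Xa b; rewrite mulrA (commutatorl z a) mulrDl -mulrA.
  apply: (additiveD XR_add); apply: ideal_mulM => //.
  exact: stable_comm Xst _ _ Zz Xa.
Qed.

(** The extension of [X] to [B (k + l)] in terms of coordinates with respect to the
    monomials in [y k, ..., y (k + l - 1)]; unlike [right_span X] it visibly commutes
    with intersections. *)
Fixpoint expansions k (X : set R) l : set R :=
  if l is l'.+1 then [set w | exists p : {poly R},
    (forall i, expansions k X l' p`_i) /\ w = p.[y (k + l')]]
  else X.

Lemma expansionsS k X X' l : X `<=` X' -> expansions k X l `<=` expansions k X' l.
Proof.
move=> XX'; elim: l => //= l IH _ [p [Xp ->]].
by exists p; split=> // i; exact: IH.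
Qed.

Lemma expansions_additive k X l : additive_set X -> additive_set (expansions k X l).
Proof.
move=> X_add; elim: l => [//|l IH]; split=> [|_ _ [p [Xp ->]] [q [Xq ->]]].
  by exists 0; rewrite horner0; split=> // i; rewrite coef0; exact: additive0.
exists (p - q); rewrite hornerD hornerN; split=> // i.
by rewrite coefB; apply: (additiveB IH); [exact: Xp | exact: Xq].
Qed.

Lemma tower_skew k : (k < n)%N -> skew_data (B k) [set 0] (y k).
Proof.
move=> lt_kn; apply: skew_data0; first exact: (tower_ring T (ltnW lt_kn)).
by move=> b; apply: (tower_stable T (ltnW lt_kn)); exact: (tower_y T lt_kn).
Qed.

Lemma tower_adjoin k Q : (k < n)%N -> skew_data (B k) Q (y k) ->
  adjoin_set (B k) Q (y k) = B k.+1.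
Proof.
move=> lt_kn H; have [sub Bky least] := tower_step T lt_kn.
exact: (adjoin_setE H sub Bky (tower_ring T lt_kn)).
Qed.

Lemma expansions_sub k X l : (k + l <= n)%N -> X `<=` B k ->
  expansions k X l `<=` B (k + l).
Proof.
move=> le_n XB; elim: l => [|l IH] in le_n *; rewrite ?addn0 // addnS in le_n *.
move=> _ [p [Xp ->]]; rewrite -(tower_adjoin le_n (tower_skew le_n)).
apply: (@adjoin_degree_lt _ _ _ _ (size p)); exists p; split=> // i.
  by apply: (IH (ltnW le_n)); exact: Xp.
by move=> le_pi; rewrite nth_default.
Qed.

(** The coordinates of [w] do not depend on [j], as expansions are unique. *)
Lemma expansions_bigcap k (X : nat -> set R) l w : (k + l <= n)%N ->
  (forall j, X j `<=` B k) -> (forall j, expansions k (X j) l w) ->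
  expansions k (\bigcap_j X j) l w.
Proof.
move=> le_n XB; elim: l => [|l IH] in w le_n *; first by move=> Xw j _; exact: Xw.
rewrite addnS in le_n => Xw; have [p [Xp wE]] := Xw 0%N.
exists p; split=> // i; apply: IH => [|j]; first exact: ltnW.
have [q [Xq wE']] := Xw j.
suff -> : p = q by exact: Xq.
apply/eqP; rewrite -subr_eq0; apply/eqP; apply: (tower_free T le_n).
  have [B_add _ _] := tower_ring T (ltnW le_n).
  move=> i'; rewrite coefB; apply: additiveB => //.
    by apply: (expansions_sub (ltnW le_n) (XB _)); exact: Xp.
  by apply: (expansions_sub (ltnW le_n) (XB _)); exact: Xq.
by rewrite hornerD hornerN -wE -wE' subrr.
Qed.

Lemma expansions_mulr k X l x r : (k + l <= n)%N ->
  (forall x b, X x -> B k b -> X (x * b)) ->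
  X x -> B (k + l) r -> expansions k X l (x * r).
Proof.
move=> le_n XB Xx; elim: l => [|l IH] in r le_n *; first by rewrite addn0; exact: XB.
rewrite addnS in le_n *; rewrite -(tower_adjoin le_n (tower_skew le_n)).
move=> [m _ [p [Bp _ ->]]]; exists (x *: p); rewrite hornerZ; split=> // i.
by rewrite coefZ; apply: IH; [exact: ltnW | exact: Bp].
Qed.

Lemma expansions_right_span k X l : additive_set X ->
  expansions k X l `<=` right_span X.
Proof.
move=> X_add; elim: l => [|l IH]; first exact: sub_right_span.
move=> _ [p [Xp ->]]; rewrite horner_coef.
apply: additive_sum; first exact: right_span_additive.
by move=> i _; apply: (right_span_mulr _ X_add); apply: IH; exact: Xp.
Qed.

Lemma right_span_expansions k X r : (k <= n)%N -> stable_ideal Z (B k) X ->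
  right_span X r -> expansions k X (n - k) r.
Proof.
move=> le_kn Xst; move: r; apply: ideal_mul_ind => [|a b Xa _].
  exact/expansions_additive/(stable_additive Xst).
apply: expansions_mulr; rewrite ?subnKC //; last exact: (tower_top T).
by move=> x c Xx Bc; exact: stable_mulr Xst _ _ Bc Xx.
Qed.

Section Step.
Context (M : set R) (M_ideal : two_sided_ideal M) (M1 : ~ M 1).
Context (M_max : forall K, two_sided_ideal K -> M `<=` K -> ~ (K `<=` M) -> K 1).

Let Q k := B k `&` M.

Lemma tower_stable_setI k : (k <= n)%N -> stable_ideal Z (B k) (Q k).
Proof.
move=> le_kn; apply: stable_setI => //; first exact: (tower_ring T le_kn).
by move=> z a; apply: (tower_stable T).
Qed.

Fixpoint stable_exp k j : set R :=
  if j is j'.+1 then ideal_mul (Q k) (stable_exp k j') else B k.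

Lemma stable_exp_stable k j : (k <= n)%N -> stable_ideal Z (B k) (stable_exp k j).
Proof.
move=> le_kn; have B_ring := tower_ring T le_kn; have [B_add B1 BM] := B_ring.
elim: j => [|j IH] /=.
  by split=> //; try (by move=> *; apply: BM); move=> z b; exact: (tower_stable T).
by apply: stable_ideal_mul => //; exact: tower_stable_setI.
Qed.

Lemma ideal_exp_right_span k j : (k <= n)%N ->
  ideal_exp (right_span (Q k)) j `<=` right_span (stable_exp k j).
Proof.
move=> le_kn; elim: j => [|j IH] /=.
  move=> r _; rewrite -[r]mul1r; apply: ideal_mulM => //.
  by case: (tower_ring T le_kn).
have st_add i := stable_additive (stable_exp_stable i le_kn).
apply: ideal_mul_ind => [|a b Qa Eb]; first exact/right_span_additive/(st_add j.+1).
move: a Qa; apply: ideal_mul_ind => [|q u Qq _].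
  by apply: (preim_additive (right_span_additive (st_add j.+1))) => c d; rewrite mulrBl.
have := right_span_mull u le_kn (stable_exp_stable j le_kn) (IH b Eb).
rewrite /= -mulrA; move: (u * b).
apply: ideal_mul_ind => [|p v Ep _].
  by apply: (preim_additive (right_span_additive (st_add j.+1))) => c d; rewrite mulrBr.
by rewrite /= mulrA; apply: ideal_mulM => //; apply: ideal_mulM.
Qed.

(** The elements of [Q (k + 1)] have positive order modulo [Q k], orders add up
    under multiplication, and only elements with all coefficients in [Q k]
    have infinite order. *)
Lemma stable_exp_bigcap k w : (k < n)%N -> (forall j, stable_exp k.+1 j w) ->
  degree_lt (B k) (Q k) (y k) 0 w.
Proof.
move=> lt_kn Ew; have le_kn := ltnW lt_kn.
have B_ring := tower_ring T le_kn.
have ZB z b : Z z -> B k b -> B k (commutator z b) by exact: (tower_stable T).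
have Zy := tower_y T lt_kn.
have M_prime C v : stable_ideal Z (B k) C -> ~ (C `<=` M) ->
    (forall c, C c -> M (c * v)) -> M v.
  apply: maximal_stable_prime => // S S_ring BS ZS; apply: (tower_gen T) => // b Bb.
  by apply: BS; exact: (tower_sub (leq0n k)).
have y_eigen z := tower_eigen T (z := z) lt_kn.
have y_free p := tower_free T (p := p) lt_kn.
have H : skew_data (B k) (Q k) (y k) by exact: (@skew_data_setI _ (B k) Z).
have AE := tower_adjoin lt_kn H.
have st j : stable_ideal Z (adjoin_set (B k) (Q k) (y k)) (stable_exp k.+1 j).
  by rewrite AE; exact: stable_exp_stable.
have ordQ : order_ge (B k) (Q k) (y k) (Q k.+1) 1.
  move=> u [[Bu Mu] Gu]; have [b Bb Gub] := degree_ltS H Gu.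
  rewrite expr0 mulr1 in Gub.
  suff Qb : Q k b.
    apply: (additive_subl (degree_lt_additive H 0) Gub).
    by rewrite -[b]mulr1 -(expr0 (y k)); exact: (degree_lt_coefQ H).
  split=> //; have [M0 MD MlM MrM] := M_ideal.
  have -> : b = u + -1 * (u - b) by rewrite mulN1r subKr.
  apply: (MD) => //; apply: MlM; have [p [_ pQ ->]] := Gub.
  rewrite horner_coef; apply: big_ind => [//||i _]; first exact: MD.
  by apply: MrM; case: (pQ i).
have ordE j : order_ge (B k) (Q k) (y k) (stable_exp k.+1 j) j.
  elim: j => [|j IH]; first by move=> u [].
  rewrite -[X in order_ge _ _ _ _ X]add1n.
  apply: (order_ge_mul (Z := Z)) => //.
  by rewrite AE; exact: tower_stable_setI.
have : B k.+1 w by exact: (Ew 0%N).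
by rewrite -AE => -[m _ Gw]; exact: (ordE m).
Qed.

(** The powers of the ideal generated by [Q (k + 1)] are generated by those of
    [Q (k + 1)] in [B (k + 1)]. In coordinates with respect to the monomials in
    [y (k + 1), ..., y (n - 1)] their intersection can be taken inside [B (k + 1)],
    where [stable_exp_bigcap] applies. *)
Lemma residual_step k : (k < n)%N ->
  ideal_residual (right_span (Q k.+1)) `<=` right_span (Q k).
Proof.
move=> lt_kn r Rr; have le_kn := ltnW lt_kn.
have Q_add := stable_additive (tower_stable_setI le_kn).
have : expansions k.+1 (\bigcap_j stable_exp k.+1 j) (n - k.+1) r.
  apply: expansions_bigcap; first by rewrite subnKC.
    by move=> j; exact: stable_sub (stable_exp_stable j lt_kn).
  move=> j; apply: right_span_expansions => //; first exact: stable_exp_stable.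
  exact/ideal_exp_right_span/Rr.
have G0_Q : \bigcap_j stable_exp k.+1 j `<=` right_span (Q k).
  move=> w Ew; have [p [_ pQ ->]] := stable_exp_bigcap lt_kn (fun j => Ew j I).
  rewrite horner_coef; apply: additive_sum; first exact: right_span_additive.
  by move=> i _; apply: ideal_mulM => //; exact: pQ.
move=> /(expansionsS G0_Q)/expansions_right_span.
move=> /(_ (right_span_additive Q_add)).
move: r {Rr}; apply: ideal_mul_ind; first exact: right_span_additive.
by move=> a b Qa _; exact: right_span_mulr.
Qed.

Lemma right_span_base : right_span (Q 0%N) `<=` [set 0].
Proof.
apply: ideal_mul_ind => [|b r [Bb Mb] _] /=.
  by split=> // _ _ -> ->; rewrite subrr.
have [->|b0] := eqVneq b 0; first by rewrite mul0r.
have [c _ cb] := tower_base T Bb b0; exfalso; apply: M1; rewrite -cb.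
by case: M_ideal => _ _ MlM _; exact: MlM.
Qed.

End Step.

(** Write [Q k] for the part in [B k] of a maximal ideal that contains [I].
    Each iterated residual descends one step of the tower:
    [I(m)] lies in the ideal generated by [Q (n - m)]. *)
Theorem tower_residual (I : set R) : two_sided_ideal I -> I <> setT ->
  ideal_iter_residual I n = [set 0].
Proof.
move=> I_id IT.
have I1 : ~ I 1.
  move=> I1; apply: IT; apply/seteqP; split=> // x _; rewrite -[x]mulr1.
  by case: I_id => _ _ IlM _; exact: IlM.
have [M [M_id M1 IM M_max]] := exists_maximal_ideal I_id I1.
have sub m : (m <= n)%N ->
    ideal_iter_residual I m `<=` right_span (B (n - m)%N `&` M).
  elim: m => [|m IH] le_mn.
    rewrite subn0 => x Ix; apply: sub_right_span; split; last exact: IM.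
    exact: (tower_top T).
  have lt : (n - m.+1 < n)%N by rewrite ltn_subrL (leq_trans _ le_mn).
  apply: subset_trans (residual_step M_id M_max lt).
  by rewrite subnSK //; apply: ideal_residualS; apply: IH; exact: ltnW.
apply/seteqP; split.
  by move=> x /(sub n (leqnn n)); rewrite subnn; exact: right_span_base.
move=> _ ->; elim: n => [|m IH] /=; first by case: I_id.
move=> k _; case: k => [//|k] /=; exists 0%N, (fun=> 0), (fun=> 0).
by split=> [[]|]; rewrite ?big_ord0.
Qed.

End TowerResidual.

(** * Noetherian rings *)

(** Membership is tested against all closed sets, which spares the choice of
    coefficients. *)
Definition left_span (R : nzRingType) (B : set R) (s : seq R) : set R :=
  [set w | forall S : set R, additive_set S ->
    (forall b x, B b -> S x -> S (b * x)) -> {in s, forall x, S x} -> S w].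

Definition noetherian_subring (R : nzRingType) (B : set R) : Prop :=
  forall I : set R, additive_set I -> I `<=` B ->
    (forall b x, B b -> I x -> I (b * x)) ->
  exists s : seq R, {in s, forall x, I x} /\ I `<=` left_span B s.

Definition left_noetherian (R : nzRingType) : Prop :=
  @noetherian_subring R setT.

Section LeftSpan.
Context (R : nzRingType) (B : set R).

Lemma left_span_additive s : additive_set (left_span B s).
Proof.
split=> [S S_add _ _|a b Sa Sb S S_add BS sS]; first exact: additive0.
by apply: additiveB => //; [exact: Sa | exact: Sb].
Qed.

Lemma left_span_mull s b x : B b -> left_span B s x -> left_span B s (b * x).
Proof. by move=> Bb sx S S_add BS sS; apply: (BS) => //; exact: sx. Qed.

Lemma mem_left_span s x : x \in s -> left_span B s x.
Proof. by move=> sx S _ _; apply. Qed.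

Lemma left_spanS s t : {subset s <= t} -> left_span B s `<=` left_span B t.
Proof. by move=> st w sw S S_add BS tS; apply: sw => // x /st; exact: tS. Qed.

Lemma noetherian_division :
  subring_set B -> (forall b, B b -> b != 0 -> exists2 c, B c & c * b = 1) ->
  noetherian_subring B.
Proof.
move=> [_ _ BM] Binv I I_add IB BI.
have [[b Ib b0]|I0] := pselect (exists2 b, I b & b != 0).
  exists [:: b]; split=> [x|w Iw]; first by rewrite inE => /eqP ->.
  have [c Bc cb] := Binv b (IB _ Ib) b0.
  rewrite -[w]mulr1 -cb mulrA; apply: left_span_mull.
    by apply: BM => //; exact: IB.
  by apply: mem_left_span; rewrite inE.
exists [::]; split=> // w Iw; have [->|w0] := eqVneq w 0.
  exact: additive0 (left_span_additive _).
by exfalso; apply: I0; exists w.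
Qed.
End LeftSpan.

(** Hilbert's basis theorem for a ring obtained by adjoining an element that
    normalizes the coefficient ring up to lower order. *)
Section Hilbert.
Context (R : nzRingType) (B : set R) (y : R).
Context (H : skew_data B [set 0] y) (B_noeth : noetherian_subring B).

Let G := degree_lt B [set 0] y.
Let A := adjoin_set B [set 0] y.
Let G_add m : additive_set (G m) := degree_lt_additive H m.
Let B_add : additive_set B. Proof. by case: (skew_ring H). Qed.
Let BM a b : B a -> B b -> B (a * b).
Proof. by case: (skew_ring H) => _ _; apply. Qed.

Lemma degree_lt0_eq0 w : G 0 w -> w = 0.
Proof.
move=> [p [_ p0 ->]]; suff -> : p = 0 by rewrite horner0.
by apply/polyP => i; rewrite coef0; exact: p0.
Qed.

Section Ideal.
Context (I : set R) (I_add : additive_set I) (IA : I `<=` A).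
Context (AI : forall a x, A a -> I x -> I (a * x)).

Let C m := lead_coefs B [set 0] y I m.

Lemma lead_coefs_left_ideal m :
  [/\ additive_set (C m), C m `<=` B & forall b c, B b -> C m c -> C m (b * c)].
Proof.
split=> [|c []//|b c]; first exact: (lead_coefs_additive H).
by apply: (lead_coefs_mull H) => a x Ba; apply: AI; exact: (adjoinB H).
Qed.

Lemma lead_shift j m f c : B c -> G m (f - c * y ^+ m) ->
  G (j + m) (y ^+ j * f - c * y ^+ (j + m)).
Proof.
move=> Bc Gf.
have -> : y ^+ j * f - c * y ^+ (j + m) =
    y ^+ j * (f - c * y ^+ m) + (y ^+ j * c - c * y ^+ j) * y ^+ m.
  by rewrite mulrBr mulrBl exprD !mulrA subrKA.
apply: additiveD => //; first exact: (degree_lt_mul_Xl H).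
exact/(degree_lt_mul_Xr H)/(expy_mulB H).
Qed.

Lemma adjoin_expy j : A (y ^+ j).
Proof.
rewrite -[y ^+ j]mul1r; apply: (adjoin_monomial H).
by case: (skew_ring H).
Qed.

Lemma lead_coefs_mono m m' : (m <= m')%N -> C m `<=` C m'.
Proof.
move=> /subnK <- c [Bc [f If Gf]]; split=> //.
exists (y ^+ (m' - m) * f); last exact: lead_shift.
by apply: AI => //; exact: adjoin_expy.
Qed.

Lemma lead_coefs_lift m (s : seq R) : {in s, forall c, C m c} ->
  exists t : seq R, {in t, forall x, I x} /\
    forall c, left_span B s c -> exists2 v, left_span A t v & G m (v - c * y ^+ m).
Proof.
move=> sC.
have /choice[lift liftP] : forall c, exists f,
    c \in s -> I f /\ G m (f - c * y ^+ m).
  move=> c; have [/sC[_ [f If Gf]]|_] := boolP (c \in s); last by exists 0.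
  by exists f.
exists [seq lift c | c <- s]; split=> [_ /mapP[c cs ->]|c sc].
  by have [] := liftP c cs.
set t := [seq lift c | c <- s]; have t_add := left_span_additive A t.
suff [] : lead_coefs B [set 0] y (left_span A t) m c by [].
apply: sc => [|b x Bb|x xs].
- exact: (lead_coefs_additive H).
- apply: (lead_coefs_mull H) => // a v Ba; apply: left_span_mull.
  exact: (adjoinB H).
- split; first by case: (sC x xs).
  exists (lift x); first by apply: mem_left_span; apply: map_f.
  by case: (liftP x xs).
Qed.
End Ideal.

(** Generators of the ideal of all leading coefficients are realized in some degree
    [m0]; with generators of the leading coefficients in each degree below [m0] they
    allow any element of [I] to be reduced to [0] by induction on the degree. *)
Theorem noetherian_adjoin : noetherian_subring A.
Proof.
move=> I I_add IA AI.
pose C m := lead_coefs B [set 0] y I m.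
have C_id m := lead_coefs_left_ideal I_add AI m.
have C_mono m m' : (m <= m')%N -> C m `<=` C m' by exact: lead_coefs_mono.
have C_bound (s : seq R) : {in s, forall c, (\bigcup_m C m) c} ->
    exists j, {in s, forall c, C j c}.
  elim: s => [|c s IH] sC; first by exists 0%N.
  have [j sj] : exists j, {in s, forall c, C j c}.
    by apply: IH => x xs; apply: sC; rewrite inE xs orbT.
  have [m _ Cc] : (\bigcup_m C m) c by apply: sC; rewrite inE eqxx.
  exists (maxn j m) => x; rewrite inE => /predU1P[->|xs].
    exact: C_mono (leq_maxr _ _) _ Cc.
  by apply: C_mono (leq_maxl _ _) _ _; exact: sj.
have U_add : additive_set (\bigcup_m C m).
  split=> [|a b [m _ Ca] [m' _ Cb]].
    by exists 0%N => //; have [C0 _ _] := C_id 0%N; exact: additive0.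
  exists (maxn m m') => //; have [C_add _ _] := C_id (maxn m m').
  apply: additiveB => //; first exact: C_mono (leq_maxl _ _) _ Ca.
  exact: C_mono (leq_maxr _ _) _ Cb.
have UB : \bigcup_m C m `<=` B by move=> c [m _]; have [_ CB _] := C_id m; exact: CB.
have BU b c : B b -> (\bigcup_m C m) c -> (\bigcup_m C m) (b * c).
  by move=> Bb [m _ Cc]; exists m => //; have [_ _ BC] := C_id m; exact: BC.
have [t0 [m0 [t0I t0P]]] : exists t, exists m, {in t, forall x, I x} /\
    forall c, (\bigcup_m C m) c ->
      exists2 v, left_span A t v & G m (v - c * y ^+ m).
  have [s [sU Us]] := B_noeth U_add UB BU.
  have [m sm] := C_bound s sU.
  have [t [tI tP]] := lead_coefs_lift sm.
  by exists t, m; split=> // c /Us; exact: tP.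
have /choice[t tP] : forall m, exists t, {in t, forall x, I x} /\
    forall c, C m c -> exists2 v, left_span A t v & G m (v - c * y ^+ m).
  move=> m; have [C_add CB BC] := C_id m.
  have [s [sC Cs]] := B_noeth C_add CB BC.
  have [t [tI tP]] := lead_coefs_lift sC.
  by exists t; split=> // c /Cs; exact: tP.
exists (t0 ++ flatten [seq t m | m <- iota 0 m0]); split.
  move=> x; rewrite mem_cat => /orP[/t0I//|/flattenP[_ /mapP[m _ ->]]].
  by have [tI _] := tP m; exact: tI.
set T := t0 ++ _; have T_add := left_span_additive A T.
have TI : left_span A T `<=` I.
  move=> w; apply=> // x; rewrite mem_cat => /orP[/t0I//|/flattenP[_ /mapP[m _ ->]]].
  by have [tI _] := tP m; exact: tI.
move=> w Iw; have [m _ Gw] := IA w Iw.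
elim: m => [|m IH] in w Iw Gw *.
  by rewrite (degree_lt0_eq0 Gw); exact: (additive0 T_add).
have [c Bc Gwc] := degree_ltS H Gw.
have Cc : C m c by split=> //; exists w.
have [v Tv Gv] : exists2 v, left_span A T v & G m (v - c * y ^+ m).
  have [lt_mm0|le_m0m] := ltnP m m0.
    have [_ /(_ c Cc)[v tv Gv]] := tP m; exists v => //.
    apply: left_spanS tv => x xt; rewrite mem_cat; apply/orP; right.
    by apply/flattenP; exists (t m) => //; apply: map_f; rewrite mem_iota.
  have [|v tv Gv] := t0P c; first by exists m.
  exists (y ^+ (m - m0) * v).
    apply: left_span_mull; first exact: adjoin_expy.
    by apply: left_spanS tv => x xt; rewrite mem_cat xt.
  by rewrite -{1 3}(subnK le_m0m); apply: lead_shift.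
rewrite -[w](subrK v); apply: (additiveD T_add) => //; apply: IH.
  by apply: additiveB => //; exact: TI.
have -> : w - v = w - c * y ^+ m - (v - c * y ^+ m).
  by rewrite opprB subrKA.
exact: additiveB.
Qed.
End Hilbert.

Lemma noetherian_chain (R : nzRingType) n (B : nat -> set R) (y : nat -> R) :
  (forall k, (k <= n)%N -> subring_set (B k)) ->
  (forall b, B 0%N b -> b != 0 -> exists2 c, B 0%N c & c * b = 1) ->
  (forall k b, (k < n)%N -> B k b -> B k (commutator (y k) b)) ->
  (forall k, (k < n)%N -> [/\ B k `<=` B k.+1, B k.+1 (y k) &
    forall S, subring_set S -> B k `<=` S -> S (y k) -> B k.+1 `<=` S]) ->
  noetherian_subring (B n).
Proof.
move=> B_ring B0 By step.
suff Bk k : (k <= n)%N -> noetherian_subring (B k) by exact: Bk.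
elim: k => [|k IH] lt_kn; first by apply: noetherian_division; first exact: B_ring.
have H : skew_data (B k) [set 0] (y k).
  apply: skew_data0 => [|b]; first exact/B_ring/ltnW.
  exact: By.
have [sub Bky least] := step k lt_kn.
rewrite -(adjoin_setE H sub Bky (B_ring _ lt_kn) least).
by apply: noetherian_adjoin => //; apply: IH; exact: ltnW.
Qed.

Lemma tower_left_noetherian (R : nzRingType) Z n (B : nat -> set R) y :
  tower Z n B y -> left_noetherian R.
Proof.
move=> T; rewrite /left_noetherian.
have -> : [set: R] = B n by apply/seteqP; split=> // x _; exact: tower_top T x.
apply: (@noetherian_chain R n B y).
- exact: tower_ring T.
- exact: tower_base T.
- move=> k b lt_kn; apply: (tower_stable T (ltnW lt_kn)).
  exact: (tower_y T lt_kn).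
- by move=> k lt_kn; exact: (tower_step T lt_kn).
Qed.

(** The recursive description of the tower is symmetric, so that it also
    applies to the opposite ring. *)
Lemma tower_right_noetherian (R : nzRingType) Z n (B : nat -> set R) y :
  tower Z n B y -> left_noetherian R^c.
Proof.
move=> T; rewrite /left_noetherian.
have -> : [set: R^c] = B n by apply/seteqP; split=> // x _; exact: tower_top T x.
have base_inv (b : R) : B 0%N b -> b != 0 -> exists2 c, B 0%N c & b * c = 1.
  move=> Bb b0; have [c Bc cb] := tower_base T Bb b0.
  have c0 : c != 0 by apply/eqP => c0; move: (oner_neq0 R); rewrite -cb c0 mul0r eqxx.
  have [d Bd dc] := tower_base T Bc c0.
  exists c => //; suff -> : b = d by exact: dc.
  by rewrite -[b]mul1r -dc -mulrA cb mulr1.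
have conv_ring (S : set R) : @subring_set R^c S -> subring_set S.
  by move=> [S_add S1 SM]; split=> // a b Sa Sb; exact: (SM b a).
apply: (@noetherian_chain R^c n B y).
- move=> k le_kn; have [B_add B1 BM] := tower_ring T le_kn.
  by split=> // a b Ba Bb; exact: (BM b a).
- exact: base_inv.
- move=> k b lt_kn Bb; have [B_add _ _] := tower_ring T (ltnW lt_kn).
  have -> : @commutator R^c (y k) b = - (@commutator R (y k) b).
    by rewrite /commutator opprB.
  apply: (additiveN B_add); apply: (tower_stable T (ltnW lt_kn)) => //.
  exact: (tower_y T lt_kn).
- move=> k lt_kn; have [sub By least] := tower_step T lt_kn.
  by split=> // S /conv_ring; exact: least.
Qed.

(** * Submodules, linear forms and dual bases *)

Section Submodule.
Context (R : nzRingType) (P : lmodType R).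
Implicit Types S N X : set P.

Definition submodule_set S : Prop :=
  S 0 /\ forall a u v, S u -> S v -> S (a *: u + v).

Definition linear_form (f : P -> R) : Prop :=
  forall a u v, f (a *: u + v) = a * f u + f v.

Definition mspan X : set P :=
  [set p | forall S, submodule_set S -> X `<=` S -> S p].

Section SubmoduleTheory.
Context S (S_sub : submodule_set S).

Lemma submod0 : S 0. Proof. by case: S_sub. Qed.
Lemma submodZ a u : S u -> S (a *: u).
Proof.
by move=> Su; rewrite -[_ *: _]addr0; have [S0 SP] := S_sub; exact: SP.
Qed.
Lemma submodD u v : S u -> S v -> S (u + v).
Proof. by move=> Su Sv; rewrite -[u]scale1r; have [_ SP] := S_sub; exact: SP. Qed.
Lemma submodB u v : S u -> S v -> S (u - v).
Proof. by move=> Su Sv; rewrite -scaleN1r; apply: submodD => //; exact: submodZ. Qed.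
Lemma submod_sum I (r : seq I) (Q : pred I) (F : I -> P) :
  (forall i, Q i -> S (F i)) -> S (\sum_(i <- r | Q i) F i).
Proof. by move=> SF; apply: big_ind => //; [exact: submod0 | exact: submodD]. Qed.
End SubmoduleTheory.

Lemma mspan_submod X : submodule_set (mspan X).
Proof.
split=> [S S_sub _|a u v Xu Xv S S_sub XS]; first exact: submod0.
by case: (S_sub) => _; apply; [exact: Xu | exact: Xv].
Qed.

Lemma sub_mspan X : X `<=` mspan X.
Proof. by move=> x Xx S _; apply. Qed.

Lemma mspan_sub X S : submodule_set S -> X `<=` S -> mspan X `<=` S.
Proof. by move=> S_sub XS p; apply. Qed.

Lemma mspanS X Y : X `<=` Y -> mspan X `<=` mspan Y.
Proof.
by move=> XY; apply: mspan_sub (mspan_submod Y) _ => x /XY; exact: sub_mspan.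
Qed.

Section FormTheory.
Context (f : P -> R) (f_lin : linear_form f).

Lemma form0 : f 0 = 0.
Proof.
have := f_lin 1 0 0; rewrite scale1r addr0 mul1r => /eqP.
by rewrite addrC -subr_eq subrr eq_sym => /eqP.
Qed.
Lemma formZ a u : f (a *: u) = a * f u.
Proof. by rewrite -[_ *: _]addr0 f_lin form0 addr0. Qed.
Lemma formD u v : f (u + v) = f u + f v.
Proof. by rewrite -[u]scale1r f_lin mul1r scale1r. Qed.
Lemma formB u v : f (u - v) = f u - f v.
Proof. by rewrite formD -scaleN1r formZ mulN1r. Qed.
Lemma form_sum I (r : seq I) (Q : pred I) (F : I -> P) :
  f (\sum_(i <- r | Q i) F i) = \sum_(i <- r | Q i) f (F i).
Proof. by apply: big_morph; [exact: formD | exact: form0]. Qed.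

Lemma form_ker : submodule_set [set p | f p = 0].
Proof.
by split=> [|a u v /= fu fv]; rewrite /= ?form0 // f_lin fu fv mulr0 addr0.
Qed.
End FormTheory.

Definition spanned_by (N : set P) (s : seq P) : Prop :=
  {in s, forall x, N x} /\ N `<=` mspan [set x | x \in s].

Lemma mspan_seqP (s : seq P) p : mspan [set x | x \in s] p ->
  exists a : 'I_(size s) -> R, p = \sum_i a i *: s`_i.
Proof.
apply: (mspan_sub (S := [set p | exists a : 'I_(size s) -> R, p = \sum_i a i *: s`_i])).
  split=> [|a _ _ [c ->] [d ->]].
    by exists (fun=> 0); rewrite big1 // => i _; rewrite scale0r.
  exists (fun i => a * c i + d i); rewrite scaler_sumr -big_split /=.
  by apply: eq_bigr => i _; rewrite scalerDl scalerA.
move=> x xs /=; have lt_xs : (index x s < size s)%N by rewrite index_mem.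
exists (fun i => if i == Ordinal lt_xs then 1 else 0).
rewrite (bigD1 (Ordinal lt_xs)) //= eqxx scale1r nth_index // big1 ?addr0 //.
by move=> i /negPf ->; rewrite scale0r.
Qed.

Lemma spanned_by_fg (s : seq P) : spanned_by setT s -> finitely_generated_module P.
Proof.
move=> [_ sP]; exists (size s), (fun i => s`_i) => x.
by have [a ->] := mspan_seqP (sP x I); exists a.
Qed.

(** A module has such a system iff it is projective. The submodule [N] allows direct
    summands of [P] to be treated inside [P]; the finite support is part of the
    data, so that the forms can live on all of [P]. *)
Record dual_basis (N : set P) (X : eqType) (c : X -> P) (phi : X -> P -> R)
    (supp : P -> seq X) : Prop := DualBasis {
  dual_submod : submodule_set N;
  dual_mem : forall x, N (c x);
  dual_form : forall x, linear_form (phi x);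
  dual_uniq : forall p, uniq (supp p);
  dual_supp : forall p x, N p -> x \notin supp p -> phi x p = 0;
  dual_sum : forall p, N p -> p = \sum_(x <- supp p) phi x p *: c x
}.
End Submodule.

Lemma ideal_exp_two_sided (R : nzRingType) (I : set R) k :
  two_sided_ideal I -> two_sided_ideal (ideal_exp I k).
Proof.
move=> [I0 ID IlM IrM].
have I_add : additive_set I.
  by split=> // a b Ia Ib; apply: ID => //; rewrite -mulN1r; exact: IlM.
elim: k => [//|k [E0 ED ElM ErM]] /=.
have E_add := ideal_mul_additive (ideal_exp I k) I_add.
split=> [|x y Ex Ey|a|a].
- exact: additive0.
- exact: additiveD.
- apply: ideal_mul_ind => [|b e Ib Ee] /=.
    by apply: (preim_additive E_add) => u v; rewrite mulrBr.
  by rewrite mulrA; apply: ideal_mulM => //; exact: IlM.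
- apply: ideal_mul_ind => [|b e Ib Ee] /=.
    by apply: (preim_additive E_add) => u v; rewrite mulrBl.
  by rewrite -mulrA; apply: ideal_mulM => //; exact: ErM.
Qed.

Lemma ideal_residual_two_sided (R : nzRingType) (I : set R) :
  two_sided_ideal I -> two_sided_ideal (ideal_residual I).
Proof.
move=> I_id; have E k := ideal_exp_two_sided k I_id.
split=> [k _|x y Ix Iy k _|a x Ix k _|a x Ix k _]; have [E0 ED ElM ErM] := E k.
- exact: E0.
- by apply: ED; [exact: Ix | exact: Iy].
- by apply: ElM; exact: Ix.
- by apply: ErM; exact: Ix.
Qed.

(** * Big projective modules have free summands *)

Section DualBasis.
Context (R : nzRingType) (P : lmodType R) (N : set P) (X : eqType).
Context (c : X -> P) (phi : X -> P -> R) (supp : P -> seq X).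
Context (D : dual_basis N c phi supp).

Let N_sub := dual_submod D.
Let cN := dual_mem D.
Let phi_lin := dual_form D.

(** It contains [N] iff [s] generates [N] modulo [I N]. *)
Definition span_mod (s : seq P) (I : set R) : set P :=
  mspan ([set x | x \in s] `|` [set p | exists a u, [/\ I a, N u & p = a *: u]]).

Lemma span_mod_seq s I x : x \in s -> span_mod s I x.
Proof. by move=> xs; apply: sub_mspan; left. Qed.

Lemma span_mod_ideal s (I : set R) a u : I a -> N u -> span_mod s I (a *: u).
Proof. by move=> Ia Nu; apply: sub_mspan; right; exists a, u. Qed.

Lemma span_mod_sub s (I : set R) : submodule_set (span_mod s I).
Proof. exact: mspan_submod. Qed.

(** Substituting [N = span s + I^k N] into [N = span s + I N] gives
    [N = span s + I^(k+1) N]. *)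
Lemma span_mod_exp s (I : set R) k : two_sided_ideal I ->
  N `<=` span_mod s I -> N `<=` span_mod s (ideal_exp I k).
Proof.
move=> [I0 ID IlM IrM] Ns.
elim: k => [|k IH] p Np.
  by rewrite -[p]scale1r; exact: span_mod_ideal.
have T_sub := span_mod_sub s (ideal_exp I k.+1).
have absorb q : span_mod s (ideal_exp I k) q ->
    forall a, I a -> span_mod s (ideal_exp I k.+1) (a *: q).
  move: q; apply: mspan_sub => [|q [qs|[b [u [Eb Nu ->]]]] a Ia].
  - split=> [a _|b u v Su Sv a Ia]; first by rewrite scaler0; exact: (submod0 T_sub).
    rewrite scalerDr scalerA.
    by apply: (submodD T_sub); [apply: Su; exact: IrM | exact: Sv].
  - by apply: (submodZ T_sub); exact: span_mod_seq.
  - by rewrite scalerA; apply: span_mod_ideal => //; exact: ideal_mulM.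
have := Ns p Np; move: p {Np}; apply: mspan_sub => // p [ps|[a [u [Ia Nu ->]]]].
  exact: span_mod_seq.
by apply: absorb => //; exact: IH.
Qed.

(** Outside the supports of the elements of [s], every coordinate of an element of
    [N] lies in all the powers of [I]. *)
Lemma span_mod_residual s (I : set R) : two_sided_ideal I ->
  {in s, forall x, N x} -> N `<=` span_mod s I ->
  exists s', {in s', forall x, N x} /\ N `<=` span_mod s' (ideal_residual I).
Proof.
move=> I_id sN Ns; pose X0 := flatten [seq supp q | q <- s].
exists [seq c x | x <- X0]; split=> [_ /mapP[x _ ->]|p Np]; first exact: cN.
rewrite (dual_sum D Np); apply: (submod_sum (span_mod_sub _ _)) => x _.
have [xX0|xX0] := boolP (x \in X0).
  by apply: (submodZ (span_mod_sub _ _)); apply: span_mod_seq; exact: map_f.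
apply: span_mod_ideal => // k _.
have [E0 ED ElM ErM] := ideal_exp_two_sided k I_id.
have := span_mod_exp (k := k) I_id Ns Np.
apply: (mspan_sub (S := [set p | ideal_exp I k (phi x p)])).
  split=> [|a u v Eu Ev] /=; first by rewrite (form0 (phi_lin x)).
  by rewrite phi_lin; apply: ED => //; exact: ElM.
move=> q [qs|[a [u [Ea Nu ->]]]] /=; last first.
  by rewrite (formZ (phi_lin x)); exact: ErM.
rewrite (dual_supp D (sN _ qs)) //; apply: contra xX0 => xq.
by apply/flattenP; exists (supp q) => //; exact: map_f.
Qed.

Lemma spanned_of_mod_ideal s (I : set R) m : two_sided_ideal I ->
  ideal_iter_residual I m = [set 0] -> {in s, forall x, N x} ->
  N `<=` span_mod s I -> exists s', spanned_by N s'.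
Proof.
move=> I_id Im sN Ns.
have [s' [s'N Ns']] : exists s', {in s', forall x, N x} /\
    N `<=` span_mod s' (ideal_iter_residual I m).
  have : two_sided_ideal (ideal_iter_residual I m) /\ exists s',
      {in s', forall x, N x} /\ N `<=` span_mod s' (ideal_iter_residual I m).
    elim: m {Im} => [|m [I'_id [s' [s'N Ns']]]] /=; first by split=> //; exists s.
    split; first exact: ideal_residual_two_sided.
    exact: span_mod_residual Ns'.
  by case.
exists s'; split=> // p /Ns'; rewrite Im; apply: mspan_sub; first exact: mspan_submod.
move=> q [qs|[_ [u [-> _ ->]]]]; first exact: sub_mspan.
by rewrite scale0r; exact: (submod0 (mspan_submod _)).
Qed.

Context (residual0 : forall I : set R, two_sided_ideal I -> ~ I 1 ->
  exists m, ideal_iter_residual I m = [set 0]).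
Context (noethl : left_noetherian R) (noethr : left_noetherian R^c).
Context (N_big : ~ exists s, spanned_by N s).

Definition vanishing (s : seq X) : set P :=
  [set p | N p /\ {in s, forall x, phi x p = 0}].

Lemma vanishing_sub s : submodule_set (vanishing s).
Proof.
split=> [|a u v [Nu su] [Nv sv]].
  by split=> [|x _]; [exact: (submod0 N_sub) | exact: (form0 (phi_lin x))].
split=> [|x xs]; first by case: N_sub => _; apply.
by rewrite phi_lin su // sv // mulr0 addr0.
Qed.

(** The values of [phi x] on [vanishing s] form a left ideal; by noetherianity,
    imposing one more condition [phi x p = 0] costs finitely many generators. *)
Lemma vanishing_cofinite s : exists t : seq P, {in t, forall x, N x} /\
  forall p, N p -> exists2 q, mspan [set x | x \in t] q & vanishing s (p - q).
Proof.
elim: s => [|x s [t [tN tP]]].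
  exists [::]; split=> // p Np; exists 0; last by rewrite subr0.
  exact: (submod0 (mspan_submod _)).
pose J := [set r | exists2 k, vanishing s k & phi x k = r].
have K_sub := vanishing_sub s.
have [|//||g [gJ Jg]] := noethl (I := J).
- split=> [|_ _ [k Kk <-] [l Kl <-]].
    by exists 0; [exact: (submod0 K_sub) | exact: (form0 (phi_lin x))].
  by exists (k - l); [exact: (submodB K_sub) | exact: (formB (phi_lin x))].
- move=> b _ _ [k Kk <-]; exists (b *: k); first exact: (submodZ K_sub).
  exact: (formZ (phi_lin x)).
have /choice[lift liftP] : forall r, exists k, r \in g -> vanishing s k /\ phi x k = r.
  move=> r; have [/gJ[k Kk kr]|_] := boolP (r \in g); last by exists 0.
  by exists k.
exists (t ++ [seq lift r | r <- g]); split.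
  move=> y; rewrite mem_cat => /orP[/tN//|/mapP[r rg ->]].
  by have [[]] := liftP r rg.
set t' := t ++ _ => p Np; have t'_sub := mspan_submod [set y | y \in t'].
have [q tq Kpq] := tP p Np.
have [q' t'q' [Kq' q'E]] : exists2 q', mspan [set y | y \in t'] q' &
    vanishing s q' /\ phi x q' = phi x (p - q).
  have Jpq : J (phi x (p - q)) by exists (p - q).
  pose S := [set r | exists2 q', mspan [set y | y \in t'] q' &
    vanishing s q' /\ phi x q' = r].
  suff : S (phi x (p - q)) by [].
  apply: (Jg _ Jpq) => [|b _ _ [q' t'q' [Kq' <-]]|r rg].
  - split=> [|_ _ [k tk [Kk <-]] [l tl [Kl <-]]].
      exists 0; first exact: (submod0 t'_sub).
      by split; [exact: (submod0 K_sub) | exact: (form0 (phi_lin x))].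
    exists (k - l); first exact: (submodB t'_sub).
    by split; [exact: (submodB K_sub) | exact: (formB (phi_lin x))].
  - exists (b *: q'); first exact: (submodZ t'_sub).
    by split; [exact: (submodZ K_sub) | exact: (formZ (phi_lin x))].
  - exists (lift r); last exact: liftP.
    by apply: sub_mspan; rewrite /= mem_cat map_f ?orbT.
exists (q + q').
  apply: (submodD t'_sub) => //; apply: mspanS tq => y /= yt.
  by rewrite mem_cat yt.
have Kpq' : vanishing s (p - (q + q')).
  by rewrite opprD addrA; exact: (submodB K_sub).
split=> [|y]; first by case: Kpq'.
rewrite inE => /predU1P[->|ys]; last by case: Kpq' => _; apply.
by rewrite opprD addrA (formB (phi_lin x)) q'E subrr.
Qed.

(** Otherwise all coordinates of the elements of [vanishing s] lie in a proper
    two-sided ideal [I], and [N] is finitely generated modulo [I N] by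
    [vanishing_cofinite]; hence [N] is finitely generated, as the iterated residuals
    of [I] reach [0]. *)
Lemma vanishing_big s (A : set R) : additive_set A ->
  (forall a r, A a -> A (a * r)) -> ~ A 1 ->
  exists k x, vanishing s k /\ ~ A (phi x k).
Proof.
move=> A_add A_mulr A1; apply: contrapT => noK.
have KA k x : vanishing s k -> A (phi x k).
  by move=> Kk; apply: contrapT => nA; apply: noK; exists k, x.
pose I := [set r | forall S : set R, additive_set S -> (forall a r, S a -> S (a * r)) ->
  (forall k x, vanishing s k -> S (phi x k)) -> S r].
have I_id : two_sided_ideal I.
  split=> [S S_add _ _|a b Ia Ib S S_add Sr SK|a r Ir S S_add Sr SK|a r Ir S S_add Sr SK].
  - exact: additive0.
  - by apply: (additiveD S_add); [exact: Ia | exact: Ib].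
  - apply: (Ir [set r | S (a * r)]) => [|b d Sb|k x Kk] /=.
    + by apply: (preim_additive S_add) => u v; rewrite mulrBr.
    + by rewrite mulrA; exact: Sr.
    + rewrite -(formZ (phi_lin x)); apply: SK.
      exact: (submodZ (vanishing_sub s)).
  - by apply: (Sr); exact: Ir.
have I1 : ~ I 1 by move=> I1; apply: A1; exact: I1.
have [m Im] := residual0 I_id I1.
have [t [tN tP]] := vanishing_cofinite s.
apply: N_big; apply: (spanned_of_mod_ideal I_id Im tN) => p Np.
have [q tq Kpq] := tP p Np; rewrite -[p](subrK q).
apply: (submodD (span_mod_sub _ _)); last first.
  by apply: mspanS tq => y yt; left.
have Npq : N (p - q) by case: Kpq.
rewrite (dual_sum D Npq); apply: (submod_sum (span_mod_sub _ _)) => x _.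
by apply: span_mod_ideal => // S _ _; apply.
Qed.

(** When this right ideal is the unit ideal, some combination of coordinate forms
    outside [s] takes the value [1] at [p]. *)
Definition content (s : seq X) (p : P) : set R :=
  [set r | forall S : set R, additive_set S -> (forall a r, S a -> S (a * r)) ->
    (forall x, x \notin s -> S (phi x p)) -> S r].

Lemma content_additive s p : additive_set (content s p).
Proof.
split=> [S S_add _ _|a b Sa Sb S S_add Sr Sp]; first exact: additive0.
by apply: (additiveB S_add); [exact: Sa | exact: Sb].
Qed.

Lemma content_mulr s p a r : content s p a -> content s p (a * r).
Proof. by move=> Sa S S_add Sr Sp; apply: (Sr); exact: Sa. Qed.

Lemma mem_content s p x : x \notin s -> content s p (phi x p).
Proof. by move=> xs S _ _; apply. Qed.

(** Add to [p] an element whose coordinates vanish on [s] and on the support of [p]: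
    the coordinates of [p] are kept and new ones appear. *)
Lemma content_grows s p : N p -> ~ content s p 1 ->
  exists p', [/\ N p', content s p `<=` content s p' &
    ~ (content s p' `<=` content s p)].
Proof.
move=> Np p1.
have [k [x [[Nk Kk] xk]]] :=
  vanishing_big (s ++ supp p) (content_additive s p) (@content_mulr s p) p1.
have x_out : x \notin s ++ supp p.
  apply/negP => xs; apply: xk; rewrite Kk //.
  exact: (additive0 (content_additive s p)).
move: x_out; rewrite mem_cat negb_or => /andP[xs xp].
exists (p + k); split=> [||sub].
- exact: (submodD N_sub).
- move=> r; apply; [exact: content_additive | exact: content_mulr |].
  move=> y ys; have [yp|yp] := boolP (y \in supp p).
    have -> : phi y p = phi y (p + k).
      by rewrite (formD (phi_lin y)) Kk ?addr0 // mem_cat yp orbT.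
    exact: mem_content.
  by rewrite (dual_supp D) //; exact: (additive0 (content_additive _ _)).
- apply: xk; apply: sub; have -> : phi x k = phi x (p + k).
    by rewrite (formD (phi_lin x)) (dual_supp D Np xp) add0r.
  exact: mem_content.
Qed.

(** By the ascending chain condition on right ideals, [content_grows] cannot be
    iterated forever. *)
Lemma unit_content s : exists2 p, N p & content s p 1.
Proof.
apply: contrapT => no_p.
have /choice[next nextP] : forall p, exists p', N p -> [/\ N p',
    content s p `<=` content s p' & ~ (content s p' `<=` content s p)].
  move=> p; have [Np|nNp] := pselect (N p); last by exists p.
  have [|p' ?] := @content_grows s p Np; last by exists p'.
  by move=> p1; apply: no_p; exists p.
pose q k := iter k next 0.
have Nq k : N (q k).
  elim: k => [|k IH] /=; first exact: (submod0 N_sub).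
  by case: (nextP _ IH).
have q_mono k l : (k <= l)%N -> content s (q k) `<=` content s (q l).
  move=> /subnK <-; elim: (l - k)%N => [//|j IH] r /IH.
  by case: (nextP _ (Nq (j + k)%N)) => _ sub _; exact: sub.
pose U := \bigcup_k content s (q k).
have U_add : @additive_set R^c U.
  split=> [|a b [k _ ka] [l _ lb]].
    by exists 0%N => //; exact: (additive0 (content_additive _ _)).
  exists (maxn k l) => //; apply: (additiveB (content_additive _ _)).
    exact: q_mono (leq_maxl _ _) _ ka.
  exact: q_mono (leq_maxr _ _) _ lb.
have [//||g [gU Ug]] := noethr U_add.
  by move=> b a _ [k _ ka]; exists k => //; exact: content_mulr.
have [l gl] : exists l, {in g, forall r, content s (q l) r}.
  elim: g gU {Ug} => [|r g IH] gU; first by exists 0%N.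
  have [l gl] : exists l, {in g, forall r, content s (q l) r}.
    by apply: IH => r' r'g; apply: gU; rewrite inE r'g orbT.
  have [k _ kr] : U r by apply: gU; rewrite inE eqxx.
  exists (maxn k l) => r'; rewrite inE => /predU1P[->|r'g].
    exact: q_mono (leq_maxl _ _) _ kr.
  by apply: q_mono (leq_maxr _ _) _ _; exact: gl.
have [_ _] := nextP _ (Nq l); apply=> r rl.
have Ur : U r by exists l.+1.
apply: (Ug r Ur) => //; first exact: content_additive.
by move=> b x _ qx; exact: content_mulr.
Qed.

Lemma unimodular_form (t : seq P) : {in t, forall q, N q} ->
  exists f p, [/\ linear_form f, N p, {in t, forall q, f q = 0} & f p = 1].
Proof.
move=> tN; pose s := flatten [seq supp q | q <- t].
have [p Np p1] := unit_content s.
pose S := [set r | exists f, [/\ linear_form f, {in t, forall q, f q = 0} & f p = r]].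
suff [f [f_lin ft fp]] : S 1 by exists f, p.
apply: p1 => [|_ r [f [f_lin ft <-]]|x xs].
- split=> [|_ _ [f [f_lin ft <-]] [g [g_lin gt <-]]].
    by exists (fun=> 0); split=> // a u v; rewrite mulr0 addr0.
  exists (fun p => f p - g p); split=> // [a u v|q qt].
    by rewrite f_lin g_lin mulrBr opprD addrACA.
  by rewrite ft // gt // subrr.
- exists (fun p => f p * r); split=> // [a u v|q qt].
    by rewrite f_lin mulrDl mulrA.
  by rewrite ft // mul0r.
- exists (phi x); split=> // q qt; rewrite (dual_supp D (tN q qt)) //.
  apply: contra xs => xq; apply/flattenP; exists (supp q) => //.
  exact: map_f.
Qed.

End DualBasis.

(** * Countably generated big projective modules are free *)

(** A basis of the quotient of [N1] by [N0], lifted to [P]. *)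
Definition relative_basis (R : nzRingType) (P : lmodType R) (N0 N1 B : set P) : Prop :=
  [/\ B `<=` N1,
      forall p, N1 p -> exists2 u, mspan B u & N0 (p - u) &
      forall (s : seq P) (a : P -> R), uniq s -> {in s, forall b, B b} ->
        N0 (\sum_(b <- s) a b *: b) -> {in s, forall b, a b = 0}].

Section Biorthogonal.
Context (R : nzRingType) (P : lmodType R) (N : set P) (X : eqType).
Context (c : X -> P) (phi : X -> P -> R) (supp : P -> seq X).
Context (D : dual_basis N c phi supp).
Context (unimodular : forall t : seq P, {in t, forall q, N q} ->
  exists f p, [/\ linear_form f, N p, {in t, forall q, f q = 0} & f p = 1]).

Let N_sub := dual_submod D.

Definition biorthogonal n (p : nat -> P) (f : nat -> P -> R) : Prop :=
  [/\ forall i, (i < n)%N -> N (p i), forall i, (i < n)%N -> linear_form (f i) &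
      forall i j, (i < n)%N -> (j < n)%N -> f i (p j) = (i == j)%:R].

(** For a biorthogonal system, this is the projection along the [p i] on the common
    kernel of the [f i]. *)
Definition cut n (p : nat -> P) (f : nat -> P -> R) (u : P) : P :=
  u - \sum_(i < n) f i u *: p i.

Section Cut.
Context n p f (pf : biorthogonal n p f).

Let f_lin i : (i < n)%N -> linear_form (f i).
Proof. by case: pf => _ f_lin _; exact: f_lin. Qed.

Lemma cut_linear a u v : cut n p f (a *: u + v) = a *: cut n p f u + cut n p f v.
Proof.
rewrite /cut scalerBr addrACA -opprD scaler_sumr -big_split /=; congr (_ - _).
by apply: eq_bigr => i _; rewrite f_lin // scalerDl scalerA.
Qed.

Lemma cut_mem u : N u -> N (cut n p f u).
Proof.
move=> Nu; apply: (submodB N_sub) => //; apply: (submod_sum N_sub) => i _.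
by apply: (submodZ N_sub); case: pf => pN _ _; exact: pN.
Qed.

Lemma form_comb j (a : 'I_n -> R) (lt_jn : (j < n)%N) :
  f j (\sum_(i < n) a i *: p i) = a (Ordinal lt_jn).
Proof.
rewrite (form_sum (f_lin lt_jn)) (bigD1 (Ordinal lt_jn)) //=.
have [_ _ fp] := pf; rewrite (formZ (f_lin lt_jn)) fp // eqxx mulr1.
rewrite big1 ?addr0 // => i ne_ij; rewrite (formZ (f_lin lt_jn)) fp //.
by move: ne_ij; rewrite eq_sym -val_eqE /= => /negPf ->; rewrite mulr0.
Qed.

Lemma form_cut j u : (j < n)%N -> f j (cut n p f u) = 0.
Proof.
by move=> lt_jn; rewrite (formB (f_lin lt_jn)) (form_comb (fun i => f i u)) subrr.
Qed.

Lemma cut_id u : (forall i, (i < n)%N -> f i u = 0) -> cut n p f u = u.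
Proof.
by move=> fu; rewrite /cut big1 ?subr0 // => i _; rewrite fu ?scale0r.
Qed.

Lemma cut_p j : (j < n)%N -> cut n p f (p j) = 0.
Proof.
move=> lt_jn; rewrite /cut (bigD1 (Ordinal lt_jn)) //=.
have [_ _ fp] := pf; rewrite fp // eqxx scale1r big1 ?addr0 ?subrr // => i ne_ij.
by rewrite fp //; move: ne_ij; rewrite -val_eqE /= => /negPf ->; rewrite scale0r.
Qed.
End Cut.

(** A unimodular form that vanishes on [t] and on the system so far, with an element
    on which it takes the value [1], projected by [cut], extends the system. *)
Lemma biorthogonal_grow n p f m (t : seq P) : biorthogonal n p f ->
  {in t, forall q, N q} -> exists p' f',
  [/\ biorthogonal (n + m) p' f',
      forall i, (i < n)%N -> p' i = p i /\ f' i = f i &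
      forall i, (n <= i < n + m)%N -> {in t, forall q, f' i q = 0}].
Proof.
move=> pf tN; elim: m => [|m [p1 [f1 [pf1 pE1 f1t]]]].
  exists p, f; rewrite addn0; split=> // i.
  by rewrite ltnNge; case: leqP.
have [p1N f1_lin f1p] := pf1.
pose t' := t ++ [seq p1 i | i <- iota 0 (n + m)].
have [|h [u [h_lin Nu ht hu]]] := unimodular (t := t').
  move=> q; rewrite mem_cat => /orP[/tN//|/mapP[i]].
  by rewrite mem_iota => /= lt_i ->; exact: p1N.
have hp i : (i < n + m)%N -> h (p1 i) = 0.
  by move=> lt_i; apply: ht; rewrite mem_cat map_f ?orbT // mem_iota.
pose v := cut (n + m) p1 f1 u.
exists (fun i => if i == (n + m)%N then v else p1 i),
  (fun i => if i == (n + m)%N then h else f1 i).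
have lt_or i : (i < n + m.+1)%N -> i == (n + m)%N = false -> (i < n + m)%N.
  by rewrite addnS ltnS leq_eqVlt => /orP[->|].
split.
- split=> [i lt_i|i lt_i|i j lt_i lt_j].
  + by case: eqP => [_|/eqP/negbTE/(lt_or _ lt_i)/p1N//]; exact: cut_mem.
  + by case: eqP => // /eqP/negbTE/(lt_or _ lt_i)/f1_lin.
  + have [ei|ni] := eqVneq i (n + m)%N; have [ej|nj] := eqVneq j (n + m)%N.
    * rewrite ei ej eqxx /v (formB h_lin) hu (form_sum h_lin) big1 ?subr0 // => l _.
      by rewrite (formZ h_lin) hp ?mulr0.
    * by rewrite hp ?(lt_or j) ?(negPf nj) // ei eq_sym (negPf nj).
    * by rewrite /v (form_cut pf1) ?(lt_or i) ?(negPf ni) // ej (negPf ni).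
    * by rewrite f1p // ?(lt_or i) ?(lt_or j) ?(negPf ni) ?(negPf nj).
- move=> i lt_in; have -> : i == (n + m)%N = false.
    by apply/negbTE; rewrite neq_ltn (leq_trans lt_in) // leq_addr.
  exact: pE1.
- move=> i /andP[le_ni lt_i] q qt; case: eqP => [_|/eqP/negbTE ne].
    by apply: ht; rewrite mem_cat qt.
  by apply: f1t; rewrite // le_ni lt_or.
Qed.

(** A finite form of Eilenberg's swindle. Expand [q'], the part of [q] outside
    the span of the system, as a combination of [b 0, ..., b (m - 1)] with
    coefficients [phi' i q'], and grow the system by further pairs [(e i, f' i)].
    The unipotent automorphism [u + e |-> u + Phi u + e], where
    [Phi u = \sum_i phi' i u *: e i], takes [q'] into the span of the elements
    [b i + e i]; pulling these back gives a biorthogonal system whose span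
    contains [q']. *)
Lemma biorthogonal_absorb n p f q : biorthogonal n p f -> N q ->
  exists n' p' f', [/\ (n <= n')%N, biorthogonal n' p' f',
    forall i, (i < n)%N -> p' i = p i &
    exists a : nat -> R, q = \sum_(i < n') a i *: p' i].
Proof.
move=> pf Nq; have [pN f_lin fp] := pf.
pose q' := cut n p f q; have Nq' : N q' by exact: cut_mem.
pose m := size (supp q').
pose ci i := nth 0 [seq c x | x <- supp q'] i.
pose phii i := nth (fun=> 0) [seq phi x | x <- supp q'] i.
have phii_lin i : linear_form (phii i).
  rewrite /phii; have [lt_im|le_mi] := ltnP i m; last first.
    by rewrite nth_default ?size_map // => a u v; rewrite mulr0 addr0.
  case: (supp q') @m lt_im => [//|x0 s] m lt_im; rewrite (nth_map x0) //.
  exact: dual_form D _.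
have ciN i : N (ci i).
  rewrite /ci; have [lt_im|le_mi] := ltnP i m; last first.
    by rewrite nth_default ?size_map //; exact: (submod0 N_sub).
  case: (supp q') @m lt_im => [//|x0 s] m lt_im; rewrite (nth_map x0) //.
  exact: dual_mem D _.
have q'E : q' = \sum_(i < m) phii i q' *: ci i.
  rewrite {1}(dual_sum D Nq') /m /phii /ci.
  case: (supp q') => [|x0 s]; first by rewrite big_nil big_ord0.
  rewrite (big_nth x0) big_mkord; apply: eq_bigr => i _.
  by rewrite !(nth_map x0).
pose b i := cut n p f (ci i).
have bN i : N (b i) by exact: cut_mem.
have q'b : q' = \sum_(i < m) phii i q' *: b i.
  have cut0 : cut n p f 0 = 0.
    by rewrite cut_id // => i lt_in; rewrite (form0 (f_lin i lt_in)).
  have cut_sum (F : 'I_m -> P) : cut n p f (\sum_i F i) = \sum_i cut n p f (F i).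
    apply: big_morph => [u v|//].
    by rewrite -[u]scale1r cut_linear // !scale1r.
  have cut_q' : cut n p f q' = q'.
    by rewrite cut_id // => i lt_in; exact: (form_cut pf).
  rewrite -[LHS]cut_q' {1}q'E cut_sum; apply: eq_bigr => i _.
  by rewrite -[_ *: ci i]addr0 cut_linear // cut0 addr0.
have [|p1 [f1 [pf1 pE1 f1t]]] :=
    biorthogonal_grow m (t := q' :: [seq b i | i <- iota 0 m]) pf.
  by move=> u; rewrite inE => /predU1P[->//|/mapP[i _ ->]].
have [p1N f1_lin f1p] := pf1.
pose e i := p1 (n + i)%N; pose fe i := f1 (n + i)%N.
have lt_e i : (i < m)%N -> (n + i < n + m)%N by rewrite ltn_add2l.
have fe_lin i : (i < m)%N -> linear_form (fe i) by move/lt_e/f1_lin.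
have le_e i : (i < m)%N -> (n <= n + i < n + m)%N by move/lt_e => ->; rewrite leq_addr.
have fe_q' i : (i < m)%N -> fe i q' = 0.
  by move=> lt_i; apply: f1t; rewrite ?le_e // inE eqxx.
have fe_b i j : (i < m)%N -> (j < m)%N -> fe i (b j) = 0.
  move=> lt_i lt_j; apply: f1t; rewrite ?le_e // inE; apply/orP; right.
  by apply: map_f; rewrite mem_iota.
have fe_e i j : (i < m)%N -> (j < m)%N -> fe i (e j) = (i == j)%:R.
  by move=> lt_i lt_j; rewrite /fe /e f1p ?lt_e // eqn_add2l.
have fe_p i j : (i < m)%N -> (j < n)%N -> fe i (p j) = 0.
  move=> lt_i lt_j; have [<- _] := pE1 j lt_j; rewrite /fe f1p ?lt_e //; last first.
    by rewrite (leq_trans lt_j) ?leq_addr.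
  by rewrite eq_sym (ltn_eqF (leq_trans lt_j (leq_addr _ _))).
have f_e i j : (i < n)%N -> (j < m)%N -> f i (e j) = 0.
  move=> lt_i lt_j; have [_ <-] := pE1 i lt_i; rewrite /e f1p ?lt_e //; last first.
    by rewrite (leq_trans lt_i) ?leq_addr.
  by rewrite (ltn_eqF (leq_trans lt_i (leq_addr _ _))).
have f_b i j : (i < n)%N -> f i (b j) = 0 by move=> lt_i; exact: (form_cut pf).
have eN i : (i < m)%N -> N (e i) by move/lt_e/p1N.
pose phi' i u := phii i (cut (n + m) p1 f1 u).
have phi'_lin i : linear_form (phi' i).
  by move=> a u v; rewrite /phi' cut_linear // phii_lin.
have phi'_p1 i j : (j < n + m)%N -> phi' i (p1 j) = 0.
  by move=> lt_j; rewrite /phi' cut_p // (form0 (phii_lin i)).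
have phi'_e i j : (j < m)%N -> phi' i (e j) = 0 by move/lt_e/phi'_p1.
have phi'_p i j : (j < n)%N -> phi' i (p j) = 0.
  move=> lt_j; have [<- _] := pE1 j lt_j.
  by apply: phi'_p1; rewrite (leq_trans lt_j) ?leq_addr.
have phi'_q' i : phi' i q' = phii i q'.
  rewrite /phi' cut_id // => j lt_j; have [lt_jn|le_nj] := ltnP j n.
    by have [_ ->] := pE1 j lt_jn; exact: (form_cut pf).
  by rewrite -(subnKC le_nj); apply: fe_q'; rewrite ltn_subLR.
pose Phi u := \sum_(i < m) phi' i u *: e i.
have PhiN u : N (Phi u).
  by apply: (submod_sum N_sub) => i _; apply: (submodZ N_sub); exact: eN.
have Phi0 (g : P -> R) u : linear_form g ->
    (forall i, (i < m)%N -> g (e i) = 0) -> g (Phi u) = 0.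
  move=> g_lin ge; rewrite (form_sum g_lin) big1 // => i _.
  by rewrite (formZ g_lin) ge ?mulr0.
have fe_Phi i u : (i < m)%N -> fe i (Phi u) = phi' i u.
  move=> lt_i; rewrite (form_sum (fe_lin _ lt_i)) (bigD1 (Ordinal lt_i)) //=.
  rewrite (formZ (fe_lin _ lt_i)) fe_e // eqxx mulr1 big1 ?addr0 // => j ne_ji.
  rewrite (formZ (fe_lin _ lt_i)) fe_e //.
  by rewrite -val_eqE /= in ne_ji; rewrite eq_sym (negPf ne_ji) mulr0.
pose g i := b i + e i - Phi (b i).
pose gf i u := fe i u + phi' i u.
have gN i : (i < m)%N -> N (g i).
  move=> lt_i; apply: (submodB N_sub) => //.
  by apply: (submodD N_sub) => //; exact: eN.
have gf_lin i : (i < m)%N -> linear_form (gf i).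
  by move=> lt_i a u v; rewrite /gf fe_lin // phi'_lin mulrDr addrACA.
have gf_g i j : (i < m)%N -> (j < m)%N -> gf i (g j) = (i == j)%:R.
  move=> lt_i lt_j; have fel := fe_lin _ lt_i; have phl := phi'_lin i.
  rewrite /gf /g (formB fel) (formB phl) (formD fel) (formD phl).
  rewrite fe_b // fe_e // fe_Phi // phi'_e // (Phi0 (phi' i)) //.
    by rewrite add0r addr0 subr0 subrK.
  by move=> l; exact: phi'_e.
have gf_p i j : (i < m)%N -> (j < n)%N -> gf i (p j) = 0.
  by move=> lt_i lt_j; rewrite /gf fe_p // phi'_p // addr0.
have f_g i j : (i < n)%N -> (j < m)%N -> f i (g j) = 0.
  move=> lt_i lt_j; have fl := f_lin i lt_i.
  rewrite /g (formB fl) (formD fl) f_b // f_e // Phi0 //.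
    by rewrite addr0 subrr.
  by move=> l; exact: f_e.
pose p2 i := if (i < n)%N then p i else g (i - n)%N.
pose f2 i := if (i < n)%N then f i else gf (i - n)%N.
have sub_m i : (i < n + m)%N -> (n <= i)%N -> (i - n < m)%N.
  by move=> ? ?; rewrite ltn_subLR.
exists (n + m)%N, p2, f2; split.
- exact: leq_addr.
- split=> [i lt_i|i lt_i|i j lt_i lt_j]; rewrite /p2 /f2.
  + by case: ltnP => [/pN//|le_ni]; apply: gN; exact: sub_m.
  + by case: ltnP => [/f_lin//|le_ni]; apply: gf_lin; exact: sub_m.
  + case: (ltnP i n) => [lt_in|le_ni]; case: (ltnP j n) => [lt_jn|le_nj].
    * exact: fp.
    * by rewrite f_g ?sub_m // (ltn_eqF (leq_trans lt_in le_nj)).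
    * by rewrite gf_p ?sub_m // eq_sym (ltn_eqF (leq_trans lt_jn le_ni)).
    * by rewrite gf_g ?sub_m // -(eqn_add2l n) !subnKC.
- by move=> i lt_in; rewrite /p2 lt_in.
exists (fun i => if (i < n)%N then f i q else phii (i - n)%N q').
rewrite big_split_ord /= {1}(_ : q = \sum_(i < n) f i q *: p i + q'); last first.
  by rewrite addrC subrK.
congr (_ + _); first by apply: eq_bigr => i _; rewrite /p2 ltn_ord.
have -> : \sum_(i < m) (if (n + i < n)%N then f (n + i)%N q else phii (n + i - n)%N q')
    *: p2 (n + i)%N = \sum_(i < m) phii i q' *: g i.
  by apply: eq_bigr => i _; rewrite /p2 ltnNge leq_addr /= addKn.
have -> : \sum_(i < m) phii i q' *: g i = q' + \sum_(i < m) phii i q' *: e i -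
    \sum_(i < m) phii i q' *: Phi (b i).
  rewrite [X in _ = X + _ - _]q'b -sumrN -!big_split; apply: eq_bigr => i _.
  by rewrite /g scalerBr scalerDr.
suff -> : \sum_(i < m) phii i q' *: Phi (b i) = \sum_(i < m) phii i q' *: e i.
  by rewrite addrK.
rewrite /Phi; under eq_bigr => i _ do rewrite scaler_sumr.
rewrite exchange_big; apply: eq_bigr => l _.
under eq_bigr => i _ do rewrite scalerA.
rewrite -scaler_suml -phi'_q' {2}q'b (form_sum (phi'_lin l)); congr (_ *: _).
by apply: eq_bigr => i _; rewrite (formZ (phi'_lin l)).
Qed.

(** Absorbing the generators one after another, the stages of the system increase
    to a basis. The forms of each stage show that its vectors are independent. *)
Lemma countable_basis (q : nat -> P) : (forall k, N (q k)) ->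
  N `<=` mspan (range q) -> exists B, relative_basis [set 0] N B.
Proof.
move=> qN Nq.
pose sys := (nat * (nat -> P) * (nat -> P -> R))%type.
have /choice[next nextP] : forall z : nat * sys, exists z' : sys,
    biorthogonal z.2.1.1 z.2.1.2 z.2.2 ->
    [/\ (z.2.1.1 <= z'.1.1)%N, biorthogonal z'.1.1 z'.1.2 z'.2,
      forall i, (i < z.2.1.1)%N -> z'.1.2 i = z.2.1.2 i &
      exists a : nat -> R, q z.1 = \sum_(i < z'.1.1) a i *: z'.1.2 i].
  move=> [k [[n p] f]] /=.
  have [pf|npf] := pselect (biorthogonal n p f); last by exists (n, p, f).
  have [n' [p' [f' ?]]] := biorthogonal_absorb pf (qN k).
  by exists (n', p', f').
pose st := fix st k : sys :=
  if k is k'.+1 then next (k', st k') else (0%N, fun=> 0, fun _ _ => 0).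
have stP k : biorthogonal (st k).1.1 (st k).1.2 (st k).2.
  by elim: k => [|k IH] //=; case: (nextP (k, st k) IH).
pose Bk k := [set (st k).1.2 i | i in [set i | (i < (st k).1.1)%N]].
have Bk_mono k l : (k <= l)%N -> Bk k `<=` Bk l.
  move=> /subnK <-; elim: (l - k)%N => [//|j IH] b /IH [i lt_i <-].
  have [le_n _ pE _] := nextP ((j + k)%N, st (j + k)%N) (stP (j + k)%N).
  exists i; first exact: leq_trans lt_i le_n.
  exact: pE.
exists (\bigcup_k Bk k); split.
- by move=> _ [k _ [i lt_i <-]]; have [pN _ _] := stP k; exact: pN.
- move=> p Np; exists p; last by rewrite subrr.
  apply: (mspan_sub (mspan_submod _)) (Nq p Np) => _ [k _ <-].
  have [_ _ _ [a ->]] := nextP (k, st k) (stP k).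
  apply: (submod_sum (mspan_submod _)) => i _; apply: (submodZ (mspan_submod _)).
  by apply: sub_mspan; exists k.+1 => //; exists i => //=.
- move=> s a s_uniq sB s0 b bs.
  have [k sk] : exists k, {in s, forall b, Bk k b}.
    elim: s sB {s_uniq s0 bs} => [|b' s IH] sB; first by exists 0%N.
    have [k sk] : exists k, {in s, forall b, Bk k b}.
      by apply: IH => x xs; apply: sB; rewrite inE xs orbT.
    have [l _ lb] : (\bigcup_k Bk k) b' by apply: sB; rewrite inE eqxx.
    exists (maxn k l) => x; rewrite inE => /predU1P[->|xs].
      exact: Bk_mono (leq_maxr _ _) _ lb.
    by apply: Bk_mono (leq_maxl _ _) _ _; exact: sk.
  have [i lt_i ib] := sk b bs; have [pN f_lin fp] := stP k.
  have fl := f_lin i lt_i; have /(congr1 ((st k).2 i)) := s0.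
  rewrite (form0 fl) (form_sum fl) (bigD1_seq b) //= (formZ fl) -[X in (st k).2 i X]ib.
  rewrite fp // eqxx mulr1 big1_seq ?addr0 // => b' /andP[ne_b b's].
  have [j lt_j jb] := sk b' b's; rewrite (formZ fl) -jb fp //.
  case: eqP => [eij|_]; last by rewrite mulr0.
  by move: ne_b; rewrite -ib -jb eij eqxx.
Qed.

End Biorthogonal.

(** * Dual bases of projective modules *)

Section FreeModule.
Context (R : nzRingType) (P : lmodType R).

Definition malg_eval (g : {malg R[P]}) : P := \sum_(x <- msupp g) g@_x *: x.

Lemma malg_evalE (s : seq P) (g : {malg R[P]}) : uniq s -> {subset msupp g <= s} ->
  malg_eval g = \sum_(x <- s) g@_x *: x.
Proof.
move=> s_uniq gs; rewrite (bigID (mem (msupp g))) /= addrC big1 ?add0r; last first.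
  by move=> x xg; rewrite mcoeff_outdom // scale0r.
rewrite -[RHS]big_filter; apply: perm_big; apply: uniq_perm.
- exact: fset_uniq.
- exact: filter_uniq.
- by move=> x; rewrite mem_filter; case xg : (x \in msupp g) => //=; rewrite gs.
Qed.

Lemma malg_eval_linear : linear malg_eval.
Proof.
move=> a g h; set s := undup (msupp g ++ msupp h ++ msupp (a *: g + h)).
have sE k : {subset msupp k <= msupp g ++ msupp h ++ msupp (a *: g + h)} ->
    malg_eval k = \sum_(x <- s) k@_x *: x.
  move=> ks; apply: malg_evalE; first exact: undup_uniq.
  by move=> x /ks; rewrite mem_undup.
rewrite !sE ?scaler_sumr -?big_split /=;
  try by move=> x xs; rewrite !mem_cat xs ?orbT.
by apply: eq_bigr => x _; rewrite mcoeffD mcoeffZ scalerDl scalerA.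
Qed.
HB.instance Definition _ :=
  GRing.isLinear.Build R {malg R[P]} P *:%R malg_eval malg_eval_linear.

Lemma malg_eval_surj y : exists g, malg_eval g = y.
Proof.
exists << 1 *g y >>; rewrite (@malg_evalE [:: y]) ?big_seq1 ?mcoeffU ?eqxx ?scale1r //.
move=> x; rewrite inE; apply: contraLR => ne_xy.
by rewrite -mcoeff_eq0 mcoeffU [y == x]eq_sym (negPf ne_xy).
Qed.
End FreeModule.

Lemma projective_dual_basis (R : nzRingType) (P : lmodType R) :
  projective_module P -> exists (phi : P -> P -> R) (supp : P -> seq P),
  dual_basis setT id phi supp.
Proof.
move=> projP.
have [h hE] := projP _ _ (@malg_eval R P : {linear _ -> _})
  (idfun : {linear P -> P}) (@malg_eval_surj R P).
exists (fun x p => (h p)@_x), (fun p => msupp (h p)); split=> //.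
- by move=> x a u v; rewrite linearP mcoeffD mcoeffZ.
- by move=> p; exact: fset_uniq.
- by move=> p x _; exact: mcoeff_outdom.
- by move=> p _; rewrite -[LHS]hE.
Qed.

(** * Reduction to countably generated modules *)

Lemma relative_basis_compose (R : nzRingType) (P : lmodType R) (N0 N1 N2 B C : set P) :
  submodule_set N0 -> submodule_set N1 -> N0 `<=` N1 -> N1 `<=` N2 ->
  relative_basis N0 N1 B -> relative_basis N1 N2 C ->
  relative_basis N0 N2 (B `|` C).
Proof.
move=> N0_sub N1_sub N01 N12 [BN1 B_gen B_free] [CN2 C_gen C_free].
have BC_sub := mspan_submod (B `|` C); split.
- by move=> b [/BN1/N12|/CN2].
- move=> p /C_gen[u Cu /B_gen[v Bv Npuv]]; exists (u + v); last by rewrite opprD addrA.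
  apply: (submodD BC_sub).
    by apply: mspanS Cu => x; right.
  by apply: mspanS Bv => x; left.
- move=> s a s_uniq sBC s0.
  pose inC := [pred b | `[< C b >]].
  have sB : {in [seq b <- s | predC inC b], forall b, B b}.
    by move=> b; rewrite mem_filter => /andP[/asboolPn nCb /sBC[]].
  have B_sum : N1 (\sum_(b <- [seq b <- s | predC inC b]) a b *: b).
    rewrite big_seq; apply: (submod_sum N1_sub) => b /sB/BN1.
    exact: submodZ.
  have C0 : {in [seq b <- s | inC b], forall b, a b = 0}.
    apply: C_free; first exact: filter_uniq.
      by move=> b; rewrite mem_filter => /andP[/asboolP].
    have := N01 _ s0; rewrite (bigID inC) /= => N1s.
    rewrite big_filter; move: B_sum; rewrite big_filter /= => B_sum.
    by have := submodB N1_sub N1s B_sum; rewrite addrK.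
  have B0 : {in [seq b <- s | predC inC b], forall b, a b = 0}.
    apply: B_free => //; first exact: filter_uniq.
    move: s0; rewrite (bigID inC) /= big_filter big1_seq ?add0r // => b /andP[Cb bs].
    by rewrite C0 ?scale0r // mem_filter bs andbT.
  move=> b bs; have [Cb|nCb] := boolP (inC b).
    by apply: C0; rewrite mem_filter bs andbT.
  by apply: B0; rewrite mem_filter bs andbT.
Qed.

Lemma generating_mspan (R : nzRingType) (P : lmodType R) (B : set P) :
  (forall p, mspan B p) -> generating B.
Proof.
move=> BP x.
pose S := [set x | exists (s : seq P) (a : P -> R),
  [/\ uniq s, {in s, forall b, B b} & x = \sum_(b <- s) a b *: b]].
suff [s [a [_ sB ->]]] : S x by exists s, a.
apply: BP => [|b Bb]; last first.
  exists [:: b], (fun=> 1); split=> // [y|]; first by rewrite inE => /eqP ->.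
  by rewrite big_seq1 scale1r.
split=> [|k _ _ [s [a [s_uniq sB ->]]] [t [d [t_uniq tB ->]]]].
  by exists [::], (fun=> 0); split=> //; rewrite big_nil.
have extend (u v : seq P) (f : P -> R) : uniq u -> uniq v -> {subset u <= v} ->
    \sum_(b <- u) f b *: b = \sum_(b <- v) (if b \in u then f b else 0) *: b.
  move=> u_uniq v_uniq uv; rewrite [RHS](bigID (mem u)) /= [X in _ = _ + X]big1 ?addr0.
    rewrite -[RHS]big_filter [RHS](eq_big_seq (fun b => f b *: b)).
      apply: perm_big; apply: uniq_perm => //; first exact: filter_uniq.
      by move=> b; rewrite mem_filter; case bu : (b \in u) => //=; rewrite uv.
    by move=> b; rewrite mem_filter => /andP[/= -> _].
  by move=> b /negPf ->; rewrite scale0r.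
have st_uniq := undup_uniq (s ++ t).
have sub_s : {subset s <= undup (s ++ t)}.
  by move=> b bs; rewrite mem_undup mem_cat bs.
have sub_t : {subset t <= undup (s ++ t)}.
  by move=> b bt; rewrite mem_undup mem_cat bt orbT.
exists (undup (s ++ t)), (fun b => k * (if b \in s then a b else 0) +
  (if b \in t then d b else 0)); split=> // [b|].
  by rewrite mem_undup mem_cat => /orP[/sB|/tB].
rewrite (extend _ _ a s_uniq st_uniq sub_s) (extend _ _ d t_uniq st_uniq sub_t).
by rewrite scaler_sumr -big_split; apply: eq_bigr => b _; rewrite scalerDl scalerA.
Qed.

Lemma relative_basis_free (R : nzRingType) (P : lmodType R) (B : set P) :
  relative_basis [set 0] setT B -> free_module P.
Proof.
move=> [_ B_gen B_free]; exists B; split=> [s a s_uniq sB s0|].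
  exact: B_free s_uniq sB s0.
apply: generating_mspan => p; have [u Bu] := B_gen p I.
by move=> /eqP; rewrite subr_eq0 => /eqP ->.
Qed.

(** Every element of the closure is reached by a finite walk, encoded by its starting
    point and its successive positions in the lists [supp x]. *)
Lemma countable_closure (T : choiceType) (supp : T -> seq T) (g0 : nat -> T) :
  exists g : nat -> T, range g0 `<=` range g /\
    forall x y, range g x -> y \in supp x -> range g y.
Proof.
pose walk (z : nat * seq nat) := foldl (fun x j => nth x (supp x) j) (g0 z.1) z.2.
pose g k :=
  if (choice.unpickle k : option (nat * seq nat)) is Some z then walk z else g0 0%N.
have gP z : range g (walk z) by exists (choice.pickle z) => //; rewrite /g choice.pickleK.
exists g; split=> [_ [k _ <-]|x y [k _ <-] xy]; first exact: (gP (k, [::])).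
have [z zE] : exists z, g k = walk z.
  by rewrite /g; case: (choice.unpickle k) => [z|]; [exists z | exists (0%N, [::])].
have := gP (z.1, rcons z.2 (index y (supp (walk z)))).
by rewrite /walk foldl_rcons -/(walk z) nth_index // -zE.
Qed.

Section Kaplansky.
Context (R : nzRingType) (P : lmodType R).
Context (residual0 : forall I : set R, two_sided_ideal I -> ~ I 1 ->
  exists m, ideal_iter_residual I m = [set 0]).
Context (noethl : left_noetherian R) (noethr : left_noetherian R^c).
Context (phi : P -> P -> R) (supp : P -> seq P).
Context (D : dual_basis setT id phi supp).

Lemma big_countable_basis (N : set P) (c : P -> P) (q : nat -> P) :
  dual_basis N c phi supp -> (forall k, N (q k)) -> N `<=` mspan (range q) ->
  ~ (exists s, spanned_by N s) -> exists B, relative_basis [set 0] N B.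
Proof.
move=> DN qN Nq N_big; apply: (countable_basis DN) qN Nq => t tN.
exact: (unimodular_form DN residual0 noethl noethr N_big tN).
Qed.

Let phi_lin := dual_form D.

(** Kaplansky's condition: elements of [S] have their coordinates in [S]. *)
Definition supp_closed (S : set P) : Prop :=
  forall x y, S x -> y \in supp x -> S y.

(** For a closed set [S] these are a direct summand and a projection on it, by
    [coord_proj_mem] and [coord_proj_id]. *)
Definition coord_sub (S : set P) : set P :=
  [set p | forall y, ~ S y -> phi y p = 0].
Definition coord_proj (S : set P) (p : P) : P :=
  \sum_(x <- supp p | `[< S x >]) phi x p *: x.

Lemma coord_sub_submod S : submodule_set (coord_sub S).
Proof.
split=> [y _|a u v Su Sv y nSy]; first by rewrite (form0 (phi_lin y)).
by rewrite phi_lin Su // Sv // mulr0 addr0.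
Qed.

Lemma coord_subS S T : S `<=` T -> coord_sub S `<=` coord_sub T.
Proof. by move=> ST p Sp y nTy; apply: Sp => /ST. Qed.

Lemma coord_projE S s p : uniq s -> {subset supp p <= s} ->
  coord_proj S p = \sum_(x <- s | `[< S x >]) phi x p *: x.
Proof.
move=> s_uniq ps; rewrite /coord_proj.
rewrite [RHS](bigID (mem (supp p))) /= [X in _ = _ + X]big1 ?addr0; last first.
  by move=> x /andP[_ xp]; rewrite (dual_supp D) // scale0r.
rewrite -[LHS]big_filter -[RHS]big_filter; apply: perm_big; apply: uniq_perm.
- by apply: filter_uniq; exact: (dual_uniq D).
- exact: filter_uniq.
- move=> x; rewrite !mem_filter -andbA; congr (_ && _).
  by case xp : (x \in supp p) => //=; rewrite ps.
Qed.

Lemma coord_proj_linear S : linear (coord_proj S).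
Proof.
move=> a u v; pose s := undup (supp u ++ supp v ++ supp (a *: u + v)).
have sE k : {subset supp k <= supp u ++ supp v ++ supp (a *: u + v)} ->
    coord_proj S k = \sum_(x <- s | `[< S x >]) phi x k *: x.
  move=> ks; apply: coord_projE; first exact: undup_uniq.
  by move=> x /ks; rewrite mem_undup.
rewrite !sE ?scaler_sumr -?big_split /=;
  try by move=> x xs; rewrite !mem_cat xs ?orbT.
by apply: eq_bigr => x _; rewrite phi_lin scalerDl scalerA.
Qed.
HB.instance Definition _ S :=
  GRing.isLinear.Build R P P *:%R (coord_proj S) (coord_proj_linear S).

Lemma coord_proj_span S p : mspan S (coord_proj S p).
Proof.
apply: (submod_sum (mspan_submod S)) => x /asboolP Sx.
by apply: (submodZ (mspan_submod S)); exact: sub_mspan.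
Qed.

Lemma coord_sub_mem S x : supp_closed S -> S x -> coord_sub S x.
Proof.
move=> S_cl Sx y nSy; apply: (dual_supp D) => //.
by apply/negP => yx; apply: nSy; exact: S_cl yx.
Qed.

Lemma mspan_coord_sub S : supp_closed S -> mspan S `<=` coord_sub S.
Proof.
move=> S_cl; apply: mspan_sub; first exact: coord_sub_submod.
by move=> x; exact: coord_sub_mem.
Qed.

Lemma coord_proj_mem S p : supp_closed S -> coord_sub S (coord_proj S p).
Proof. by move=> S_cl; apply: mspan_coord_sub => //; exact: coord_proj_span. Qed.

Lemma coord_proj_id S p : coord_sub S p -> coord_proj S p = p.
Proof.
move=> Sp; rewrite [RHS](dual_sum D) // /coord_proj [RHS](bigID (fun x => `[< S x >])) /=.
by rewrite [X in _ = _ + X]big1 ?addr0 // => x /asboolPn nSx; rewrite Sp // scale0r.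
Qed.

Lemma idempotent_dual_basis (e : {linear P -> P}) : (forall p, e (e p) = e p) ->
  dual_basis [set p | e p = p] e phi supp.
Proof.
move=> ee; split=> //=.
- by split=> [|a u v /= eu ev]; rewrite /= ?linear0 // linearP eu ev.
- exact: (dual_uniq D).
- by move=> p x _; exact: (dual_supp D).
- move=> p ep; rewrite -{1}ep [in LHS](dual_sum D (p := p)) // linear_sum.
  by apply: eq_bigr => x _; rewrite linearZ.
Qed.

Definition fg_over (S T : set P) : Prop :=
  exists s : seq P, forall p, coord_sub T p ->
    exists2 u, mspan [set x | x \in s] u & coord_sub S (p - u).

(** Choose elements with nonzero coordinates at infinitely many distinct places
    outside [S], and close up. Finitely many generators have only finitely many
    coordinates, so they cannot span the result modulo [coord_sub S]. *)
Lemma countable_extension S : supp_closed S ->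
  ~ (exists s : seq P, forall p, mspan (S `|` [set x | x \in s]) p) ->
  exists g : nat -> P, let T := S `|` range g in
    [/\ supp_closed T, supp_closed (range g) & ~ fg_over S T].
Proof.
move=> S_cl big.
have /choice[next nextP] : forall s : seq P, exists z : P * P,
    [/\ ~ S z.2, z.2 \notin s & phi z.2 z.1 != 0].
  move=> s; apply: contrapT => no_z; apply: big; exists s => p.
  have U_sub := mspan_submod (S `|` [set x | x \in s]).
  rewrite (dual_sum D (p := p)) //; apply: (submod_sum U_sub) => x _.
  have [Sx|nSx] := pselect (S x).
    by apply: (submodZ U_sub); apply: sub_mspan; left.
  have [xs|xs] := boolP (x \in s).
    by apply: (submodZ U_sub); apply: sub_mspan; right.
  have [->|nz] := eqVneq (phi x p) 0.
    by rewrite scale0r; exact: (submod0 U_sub).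
  by exfalso; apply: no_z; exists (p, x).
pose xs := fix xs k := if k is k'.+1 then (next (xs k')).2 :: xs k' else [::].
have [g [g0g g_cl]] := countable_closure supp (fun k => (next (xs k)).1).
have T_cl : supp_closed (S `|` range g).
  by move=> x y [Sx|gx] xy; [left; exact: S_cl xy | right; exact: g_cl xy].
exists g; split=> // -[s sP].
pose X0 := flatten [seq supp q | q <- s].
have xsX0 k : {subset xs k <= X0}.
  elim: k => [//|k IH] y /=; rewrite inE => /predU1P[->|]; last exact: IH.
  have [nS _ nz] := nextP (xs k); set x := (next (xs k)).2 in nS nz *.
  have Tp : coord_sub (S `|` range g) (next (xs k)).1.
    by apply: coord_sub_mem => //; right; apply: g0g; exists k.
  have [u su Spu] := sP _ Tp.
  apply: contraNT nz => xX0.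
  have xu : phi x u = 0.
    apply: (mspan_sub (form_ker (phi_lin x))) su => q qs /=.
    apply: (dual_supp D) => //; apply: contra xX0 => xq.
    by apply/flattenP; exists (supp q) => //; exact: map_f.
  by have := Spu x nS; rewrite (formB (phi_lin x)) xu subr0 => ->.
have xs_uniq k : uniq (xs k).
  by elim: k => [//|k IH] /=; rewrite IH andbT; case: (nextP (xs k)).
have xs_size k : size (xs k) = k by elim: k => //= k ->.
have := uniq_leq_size (xs_uniq (size X0).+1) (xsX0 _).
by rewrite xs_size ltnn.
Qed.

(** The image of [e], which takes [p] in [coord_sub T] to [p - coord_proj S p], is a
    countably generated complement of [coord_sub S] in [coord_sub T]. *)
Lemma extension_basis S (g : nat -> P) : let T := S `|` range g in
  supp_closed S -> supp_closed T -> ~ fg_over S T ->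
  exists B, relative_basis (coord_sub S) (coord_sub T) B.
Proof.
move=> T S_cl T_cl big; have ST : S `<=` T by left.
have S_sub := coord_sub_submod S; have T_sub := coord_sub_submod T.
pose e : {linear P -> P} :=
  (coord_proj T : {linear P -> P}) \- (coord_proj S \o coord_proj T).
have eE p : e p = coord_proj T p - coord_proj S (coord_proj T p) by [].
clearbody e.
have eST p : coord_sub T p -> coord_sub S (p - e p).
  by move=> Tp; rewrite eE (coord_proj_id Tp) subKr; exact: coord_proj_mem.
have e_T p : coord_sub T (e p).
  rewrite eE; apply: (submodB T_sub); first exact: coord_proj_mem.
  by apply: coord_subS ST _ _; exact: coord_proj_mem.
have Se p : coord_proj S (e p) = 0.
  by rewrite eE linearB /= (coord_proj_id (coord_proj_mem (coord_proj T p) S_cl)) subrr.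
have ee p : e (e p) = e p.
  by rewrite [LHS]eE (coord_proj_id (e_T p)) Se subr0.
have DN := idempotent_dual_basis ee.
have eS x : coord_sub S x -> e x = 0.
  move=> Sx; have Tx : coord_sub T x by exact: coord_subS ST _ Sx.
  by rewrite eE (coord_proj_id Tx) (coord_proj_id Sx) subrr.
have [|p ep|[s [sN Ns]]|B [BN B_gen B_free]] :=
    big_countable_basis (q := fun k => e (g k)) DN.
- by move=> k; exact: ee.
- have pT : mspan T p.
    have Tp : coord_sub T p by rewrite -ep; exact: e_T.
    by rewrite -(coord_proj_id Tp); exact: coord_proj_span.
  rewrite -ep; pose M := range (fun k => e (g k)); have M_sub := mspan_submod M.
  apply: (pT [set p | mspan M (e p)]) => [|x [Sx|[k _ <-]]] /=.
  + split=> [|a u v Mu Mv] /=; first by rewrite linear0; exact: (submod0 M_sub).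
    by rewrite linearP; case: M_sub => _; apply.
  + by rewrite eS; [exact: (submod0 M_sub) | exact: coord_sub_mem].
  + by apply: sub_mspan; exists k.
- apply: big; exists s => p Tp; exists (e p); last exact: eST.
  by apply: Ns; exact: ee.
exists B; split.
- by move=> b /BN /= <-; exact: e_T.
- move=> p Tp; have [u Bu] := B_gen (e p) (ee p).
  by move=> /eqP; rewrite subr_eq0 => /eqP uE; exists u => //; rewrite -uE; exact: eST.
- move=> s a s_uniq sB Ss; apply: (B_free s a s_uniq sB).
  have : e (\sum_(b <- s) a b *: b) = \sum_(b <- s) a b *: b.
    rewrite linear_sum; apply: eq_big_seq => b /sB/BN /= eb.
    by rewrite linearZ /= eb.
  by rewrite eS.
Qed.

Lemma chain_seq (T : choiceType) (F : set (set T)) (A0 : set T) (s : seq T) : F A0 ->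
  total_on F subset -> {in s, forall x, (\bigcup_(A in F) A) x} ->
  exists2 A, F A & {in s, forall x, A x}.
Proof.
move=> FA0 F_tot; elim: s => [|x s IH] sF; first by exists A0.
have [A FA sA] : exists2 A, F A & {in s, forall x, A x}.
  by apply: IH => y ys; apply: sF; rewrite inE ys orbT.
have [A' FA' A'x] : (\bigcup_(A in F) A) x by apply: sF; rewrite inE eqxx.
have [AA'|A'A] := F_tot _ _ FA FA'.
  by exists A' => // y; rewrite inE => /predU1P[->//|/sA]; exact: AA'.
by exists A => // y; rewrite inE => /predU1P[->|/sA//]; exact: A'A.
Qed.

(** Transfinite exhaustion, by Zorn's lemma on pairs of a closed set [S] that
    contains [T0] and a basis of [coord_sub S] modulo [coord_sub T0]; a pair is
    encoded as a subset of a disjoint sum, so that unions of chains are unions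
    of sets. *)
Lemma maximal_extension (T0 : set P) : supp_closed T0 ->
  exists S B, [/\ T0 `<=` S, supp_closed S,
    relative_basis (coord_sub T0) (coord_sub S) B &
    exists s : seq P, forall p, mspan (S `|` [set x | x \in s]) p].
Proof.
move=> T0_cl.
pose SA (A : set (P + P)) := T0 `|` [set x | A (inl x)].
pose BA (A : set (P + P)) := [set x | A (inr x)].
pose good A := supp_closed (SA A) /\
  relative_basis (coord_sub T0) (coord_sub (SA A)) (BA A).
have T0_sub := coord_sub_submod T0.
have good0 : good set0.
  have SA0 : SA set0 = T0 by apply/seteqP; split=> [x [|//]|x Tx] //; left.
  rewrite /good SA0; split=> //; split=> [b []|p Tp|s a s_uniq s0 _ b /s0 []].
  by exists 0; [exact: (submod0 (mspan_submod _)) | rewrite subr0].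
have [F Fgood F_tot|A [[A_cl A_basis] A_max]] := @Zorn_bigcup _ good.
  have [[A0 FA0]|F0] := pselect (exists A, F A); last first.
    suff -> : \bigcup_(X in F) X = set0 by [].
    by apply/seteqP; split=> // x [A FA _]; exfalso; apply: F0; exists A.
  set U := \bigcup_(X in F) X.
  have SU A : F A -> SA A `<=` SA U.
    by move=> FA x [Tx|Ax]; [left | right; exists A].
  have in_chain (s : seq P) : {in s, forall x, SA U x} ->
      exists2 A, F A & {in s, forall x, SA A x}.
    move=> sU; pose t := [seq inl x | x <- s & ~~ `[< T0 x >]] : seq (P + P).
    have [z /mapP[x + ->]|A FA tA] := chain_seq (s := t) FA0 F_tot.
      rewrite mem_filter => /andP[/asboolPn nTx xs].
      by case: (sU x xs).
    exists A => // x xs; have [Tx|nTx] := pselect (T0 x); first by left.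
    right; apply: tA; apply: map_f; rewrite mem_filter xs andbT.
    exact/asboolPn.
  split=> [x y Ux xy|].
    have [|A FA sA] := in_chain [:: x]; first by move=> z; rewrite inE => /eqP ->.
    have [A_cl _] := Fgood A FA; apply: (SU A FA); apply: A_cl xy.
    by apply: sA; rewrite inE eqxx.
  split.
  - move=> b [A FA Ab]; have [_ [BS _ _]] := Fgood A FA.
    by apply: coord_subS (SU A FA) _ _; exact: BS.
  - move=> p Up; have [|A FA sA] := in_chain [seq x <- supp p | `[< SA U x >]].
      by move=> x; rewrite mem_filter => /andP[/asboolP].
    have [A_cl [_ A_gen _]] := Fgood A FA.
    have [|u Au Tpu] := A_gen p.
      rewrite -(coord_proj_id Up) /coord_proj -big_filter big_seq.
      have A_sub := coord_sub_submod (SA A).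
      apply: (submod_sum A_sub) => x /sA Ax.
      by apply: (submodZ A_sub); exact: coord_sub_mem.
    by exists u => //; apply: mspanS Au => x Ax; exists A.
  - move=> s a s_uniq sU; have [z /mapP[x xs ->]|A FA sA] :=
        chain_seq (s := [seq inr x | x <- s] : seq (P + P)) FA0 F_tot.
      exact: sU.
    have [_ [_ _ A_free]] := Fgood A FA; apply: A_free => // x xs.
    by apply: sA; exact: map_f.
have SA_cl : supp_closed (SA A) by [].
exists (SA A), (BA A); split=> //; first by left.
apply: contrapT => big.
have [g /= [T_cl _ T_big]] := countable_extension SA_cl big.
have [C C_basis] := extension_basis SA_cl T_cl T_big.
set T := SA A `|` range g in T_cl T_big C_basis.
pose A' : set (P + P) := [set z | match z with
  | inl x => T x | inr b => (BA A `|` C) b end].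
have SA' : SA A' = T.
  apply/seteqP; split=> [x [Tx|//]|x Tx]; last by right.
  by left; left.
apply: (A_max A').
  split=> [[x|b] Ab|A'A]; [by left; right | by left |].
  apply: T_big; exists [::] => p Tp; exists 0; first exact: (submod0 (mspan_submod _)).
  rewrite subr0; apply: coord_subS Tp => x Tx.
  by right; exact: (A'A (inl x)).
split; first by rewrite SA'.
rewrite SA'; apply: relative_basis_compose A_basis C_basis => //.
- exact: coord_sub_submod.
- by apply: coord_subS => x; left.
- by apply: coord_subS => x; left.
Qed.

(** Fix a countable closed set [T0] for which [coord_sub T0] is not finitely generated.
    A maximal extension [S] of it leaves a complement of [coord_sub S] that is
    finitely generated. This remainder together with [coord_sub T0] is the image of
    [e]: it is countably generated and not finitely generated, so it has a basis,
    which completes that of [coord_sub S] modulo [coord_sub T0]. *)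
Theorem big_projective_free : ~ (exists s, spanned_by [set: P] s) -> free_module P.
Proof.
move=> big.
have [_ y []|[s sP]|g0 /=] := countable_extension (S := set0).
  apply: big; exists s; split=> // p _.
  by apply: mspanS (sP p) => x [].
rewrite set0U => -[_ T0_cl T0_big]; set T0 := range g0 in T0_cl T0_big.
have [S [B [T0S S_cl B_basis [s sP]]]] := maximal_extension T0_cl.
have T0_sub := coord_sub_submod T0; have S_sub := coord_sub_submod S.
pose e : {linear P -> P} := (idfun : {linear P -> P}) \- (coord_proj S : {linear P -> P})
  \+ (coord_proj T0 \o coord_proj S).
have eE p : e p = p - coord_proj S p + coord_proj T0 (coord_proj S p) by [].
clearbody e.
have Se p : coord_proj S (e p) = coord_proj T0 (coord_proj S p).
  rewrite eE linearD linearB /= (coord_proj_id (coord_proj_mem p S_cl)) subrr add0r.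
  by apply: coord_proj_id; apply: coord_subS T0S _ _; exact: coord_proj_mem.
have T0_S p : coord_sub T0 p -> coord_sub S p by exact: coord_subS.
have eT0 p : coord_sub T0 p -> e p = p.
  move=> Tp; rewrite eE (coord_proj_id (T0_S _ Tp)) (coord_proj_id Tp).
  by rewrite subrr add0r.
have ee p : e (e p) = e p.
  have Tp : coord_sub T0 (coord_proj T0 (coord_proj S p)) by exact: coord_proj_mem.
  by rewrite [LHS]eE Se (coord_proj_id Tp) subrK.
have DN := idempotent_dual_basis ee; set N := [set p | e p = p] in DN.
have N_sub := dual_submod DN.
have eS p : coord_sub S p -> e p = coord_proj T0 p.
  by move=> Sp; rewrite eE (coord_proj_id Sp) subrr add0r.
pose q k := if (k < size s)%N then e s`_k else g0 (k - size s)%N.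
have [k|p ep|[t [tN Nt]]|C C_basis] := big_countable_basis (q := q) DN.
- rewrite /q; case: ifP => _ /=; first exact: ee.
  by apply: eT0; apply: coord_sub_mem => //; exists (k - size s)%N.
- have M_sub := mspan_submod (range q); rewrite -ep.
  apply: (sP p [set p | mspan (range q) (e p)]) => [|x [Sx|xs]] /=.
  + split=> [|a u v Mu Mv] /=; first by rewrite linear0; exact: (submod0 M_sub).
    by rewrite linearP; case: M_sub => _; apply.
  + rewrite eS; last exact: coord_sub_mem.
    apply: mspanS (coord_proj_span x) => _ [k _ <-].
    by exists (size s + k)%N => //; rewrite /q ltnNge leq_addr /= addKn.
  + apply: sub_mspan; exists (index x s) => //.
    by rewrite /q index_mem (xs : x \in s) nth_index.
- apply: T0_big; exists [seq coord_proj T0 (coord_proj S u) | u <- t] => p Tp.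
  exists p; last by rewrite subrr; exact: submod0 (coord_sub_submod _).
  set t' := [seq _ | u <- t]; have t'_sub := mspan_submod [set x | x \in t'].
  have : mspan [set x | x \in t] p by apply: Nt; exact: eT0.
  rewrite -[X in mspan [set x | x \in t'] X](coord_proj_id Tp).
  rewrite -[in X in _ -> mspan _ X](coord_proj_id (T0_S _ Tp)).
  apply: (mspan_sub (S := [set p | mspan [set x | x \in t']
    (coord_proj T0 (coord_proj S p))])) => [|u ut] /=.
    split=> [|a u v Mu Mv] /=; first by rewrite !linear0; exact: (submod0 t'_sub).
    by rewrite !linearP; case: t'_sub => _; apply.
  by apply: sub_mspan; apply: (map_f (fun u => coord_proj T0 (coord_proj S u)) ut).
apply: (@relative_basis_free _ _ (C `|` B)).
have [BS B_gen B_free] := B_basis.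
apply: relative_basis_compose C_basis _ => //.
- by split=> [|a u v /= -> ->]; rewrite /= ?scaler0 ?addr0.
- by move=> _ ->; exact: (submod0 N_sub).
split=> // [p _|t a t_uniq tB Nt].
  have [u Bu Tpu] := B_gen (coord_proj S p) (coord_proj_mem p S_cl).
  exists u => //.
  have -> : p - u = (coord_proj S p - u) + (p - coord_proj S p).
    by rewrite [RHS]addrC subrKA.
  apply: (submodD N_sub); first exact: eT0.
  rewrite /N /= eE linearB /= (coord_proj_id (coord_proj_mem p S_cl)) subrr.
  by rewrite subr0 linear0 addr0.
apply: (B_free t a t_uniq tB).
have St : coord_sub S (\sum_(b <- t) a b *: b).
  rewrite big_seq; apply: (submod_sum S_sub) => b /tB/BS.
  exact: (submodZ S_sub).
by rewrite -Nt (eS _ St); exact: coord_proj_mem.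
Qed.

End Kaplansky.

(** * Projective modules over rings with vanishing iterated residuals *)

Theorem projective_fg_or_free (R : nzRingType) (P : lmodType R) :
  (forall I : set R, two_sided_ideal I -> ~ I 1 ->
     exists m, ideal_iter_residual I m = [set 0]) ->
  left_noetherian R -> left_noetherian R^c -> projective_module P ->
  finitely_generated_module P \/ free_module P.
Proof.
move=> residual0 noethl noethr /projective_dual_basis[phi [supp D]].
have [[s sP]|big] := pselect (exists s, spanned_by [set: P] s).
  by left; exact: spanned_by_fg sP.
right; exact: big_projective_free D big.
Qed.

(** * Enveloping algebras: generation and derivations *)

Section EnvelopingInd.
Import EnvelopingExistence.

(** By uniqueness, the identity factors through the algebra of formal expressions,
    whose elements are built from scalars and generators. *)
Lemma enveloping_ind (F : fieldType) (L : lieAlgType F) (U : algType F)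
    (iota : {linear L -> U}) (S : set U) : is_universal_enveloping iota ->
  (forall k, S k%:A) -> (forall x, S (iota x)) ->
  (forall u v, S u -> S v -> S (u + v)) -> (forall u v, S u -> S v -> S (u * v)) ->
  forall u, S u.
Proof.
move=> [iota_comm univ] Sk Si SD SM u.
have [gen_comm _] := envP L.
have [g [gE _]] := univ _ _ gen_comm.
pose h : {lrmorphism env L -> U} :=
  lift iota_comm.
have hgE : (h \o g) \o iota =1 iota.
  move=> x; rewrite /= -[g (iota x)]/((g \o iota) x) gE.
  exact: value_gen.
have [k [_ k_uniq]] := univ _ _ iota_comm.
have -> : u = h (g u).
  by rewrite -[RHS]/((h \o g) u) (k_uniq (h \o g) hgE) -(k_uniq idfun (fun=> erefl)).
change (S (eval iota (repr (g u)))).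
elim: (repr (g u) : term L) => [c|x|t St t' St'|t St t' St'] /=.
- exact: Sk.
- exact: Si.
- exact: SD.
- exact: SM.
Qed.

End EnvelopingInd.

Lemma enveloping_hom_eq (F : fieldType) (L : lieAlgType F) (U A : algType F)
    (iota : {linear L -> U}) (g h : {lrmorphism U -> A}) :
  is_universal_enveloping iota -> g \o iota =1 h \o iota -> g =1 h.
Proof.
move=> envU gh; apply: (enveloping_ind envU (S := [set u | g u = h u])) => /=.
- by move=> k; rewrite !linearZ !rmorph1.
- exact: gh.
- by move=> u v /= gu gv; rewrite !raddfD /= gu gv.
- by move=> u v /= gu gv; rewrite !rmorphM /= gu gv.
Qed.

Definition derivation (F : fieldType) (A : algType F) (d : A -> A) : Prop :=
  forall a b, d (a * b) = d a * b + a * d b.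

Lemma derivation1 (F : fieldType) (A : algType F) (d : A -> A) : derivation d -> d 1 = 0.
Proof.
move=> d_der; have := d_der 1 1; rewrite !mul1r mulr1 => /eqP.
by rewrite -subr_eq subrr eq_sym => /eqP.
Qed.

(** The algebra [A[e]] with [e ^+ 2 = 0], whose elements [a + b e] are the
    pairs [(a, b)]: a linear map [d] is a derivation iff [a + d a e] is
    multiplicative in [a]. *)
Section DualNumbers.
Context (F : fieldType) (A : algType F).

Definition dual_numbers : Type := (A * A)%type.
HB.instance Definition _ := GRing.Lmodule.copy dual_numbers (A * A)%type.

Definition dual_mul (x y : dual_numbers) : dual_numbers :=
  (x.1 * y.1, x.1 * y.2 + x.2 * y.1).

Lemma dual_mulA : associative dual_mul.
Proof.
move=> x y z; rewrite /dual_mul /= mulrA; congr (_, _).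
by rewrite mulrDr mulrDl !mulrA addrA.
Qed.
Lemma dual_mul1x : left_id ((1, 0) : dual_numbers) dual_mul.
Proof. by case=> a b; rewrite /dual_mul /= !mul1r mul0r addr0. Qed.
Lemma dual_mulx1 : right_id ((1, 0) : dual_numbers) dual_mul.
Proof. by case=> a b; rewrite /dual_mul /= !mulr1 mulr0 add0r. Qed.
Lemma dual_mulDl : left_distributive dual_mul (fun x y : dual_numbers => x + y).
Proof.
by move=> x y z; congr (_, _); rewrite /= ?mulrDl // addrACA.
Qed.
Lemma dual_mulDr : right_distributive dual_mul (fun x y : dual_numbers => x + y).
Proof.
by move=> x y z; congr (_, _); rewrite /= ?mulrDr // addrACA.
Qed.
Lemma dual_one_neq0 : ((1, 0) : dual_numbers) != 0.
Proof. by rewrite xpair_eqE oner_eq0. Qed.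
HB.instance Definition _ := GRing.Zmodule_isNzRing.Build dual_numbers
  dual_mulA dual_mul1x dual_mulx1 dual_mulDl dual_mulDr dual_one_neq0.

Lemma dual_scaleAl (k : F) (x y : dual_numbers) :
  k *: (x * y) = (k *: x : dual_numbers) * y.
Proof.
congr (_, _); first exact: scalerAl.
by rewrite -[RHS]/((k *: x.1) * y.2 + (k *: x.2) * y.1) [LHS]scalerDr !scalerAl.
Qed.
HB.instance Definition _ :=
  GRing.Lmodule_isLalgebra.Build F dual_numbers dual_scaleAl.

Lemma dual_scaleAr (k : F) (x y : dual_numbers) :
  k *: (x * y) = x * (k *: y : dual_numbers).
Proof.
congr (_, _); first exact: scalerAr.
by rewrite -[RHS]/(x.1 * (k *: y.2) + x.2 * (k *: y.1)) [LHS]scalerDr !scalerAr.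
Qed.
HB.instance Definition _ :=
  GRing.Lalgebra_isAlgebra.Build F dual_numbers dual_scaleAr.

Definition dual_fst (x : dual_numbers) : A := x.1.
Definition dual_snd (x : dual_numbers) : A := x.2.
Lemma dual_fst_linear : linear dual_fst. Proof. by []. Qed.
Lemma dual_snd_linear : linear dual_snd. Proof. by []. Qed.
Lemma dual_fst_monoid : monoid_morphism dual_fst. Proof. by []. Qed.
HB.instance Definition _ :=
  GRing.isLinear.Build F dual_numbers A *:%R dual_fst dual_fst_linear.
HB.instance Definition _ :=
  GRing.isLinear.Build F dual_numbers A *:%R dual_snd dual_snd_linear.
HB.instance Definition _ :=
  GRing.isMonoidMorphism.Build dual_numbers A dual_fst dual_fst_monoid.
End DualNumbers.

Section LieTheory.
Context (F : fieldType) (L : lieAlgType F).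
Implicit Types x y z : L.

Lemma lieDl x x' y : lie (x + x') y = lie x y + lie x' y.
Proof. by have := lie_linearl y 1 x x'; rewrite /= !scale1r. Qed.
Lemma lieDr x y y' : lie x (y + y') = lie x y + lie x y'.
Proof. by have := lie_linearr x 1 y y'; rewrite /= !scale1r. Qed.
Lemma lie0x y : lie 0 y = 0.
Proof. by apply: (addrI (lie 0 y)); rewrite -lieDl !addr0. Qed.
Lemma liex0 x : lie x 0 = 0.
Proof. by apply: (addrI (lie x 0)); rewrite -lieDr !addr0. Qed.
Lemma lieZl a x y : lie (a *: x) y = a *: lie x y.
Proof. by have := lie_linearl y a x 0; rewrite /= !addr0 lie0x addr0. Qed.
Lemma lieZr a x y : lie x (a *: y) = a *: lie x y.
Proof. by have := lie_linearr x a y 0; rewrite /= !addr0 liex0 addr0. Qed.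
Lemma lieC x y : lie x y = - lie y x.
Proof.
apply/eqP; rewrite -addr_eq0; have := liexx (x + y).
by rewrite lieDl !lieDr !liexx add0r addr0 => ->.
Qed.
Lemma lie_leibniz x y z : lie x (lie y z) = lie (lie x y) z + lie y (lie x z).
Proof.
have := lie_jacobi x y z; rewrite (lieC z x) (lieC z (lie x y)).
rewrite -scaleN1r lieZr scaleN1r -addrA => /eqP; rewrite addr_eq0 => /eqP ->.
by rewrite opprD !opprK addrC.
Qed.
End LieTheory.

(** The map [x |-> iota x + iota (d x) e] sends brackets to commutators of dual
    numbers, hence it extends to the enveloping algebra. *)
Lemma enveloping_derivation (F : fieldType) (L : lieAlgType F) (U : algType F)
    (iota : {linear L -> U}) (d : {linear L -> L}) : is_universal_enveloping iota ->
  (forall x y, d (lie x y) = lie (d x) y + lie x (d y)) ->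
  exists2 delta : {linear U -> U}, derivation delta &
    forall x, delta (iota x) = iota (d x).
Proof.
move=> envU d_der; have [iota_comm univ] := envU.
pose f (x : L) : dual_numbers U := (iota x, iota (d x)).
have f_lin : linear f by move=> a x y; rewrite /f !linearP.
pose fL : {linear L -> dual_numbers U} :=
  HB.pack f (GRing.isLinear.Build F L _ *:%R f f_lin).
have f_comm : lie_to_commutator fL.
  move=> x y; congr (_, _); first exact: iota_comm.
  rewrite /= d_der raddfD /= !iota_comm.
  rewrite -[RHS]/(iota x * iota (d y) + iota (d x) * iota y
    - (iota y * iota (d x) + iota (d y) * iota x)).
  by rewrite [iota x * _ + iota (d x) * _]addrC opprD [RHS]addrACA.
have [g [gE _]] := univ _ _ f_comm.
have fst_g u : (g u).1 = u.
  apply: (enveloping_hom_eq (g := @dual_fst F U \o g) (h := idfun) envU) => x.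
  by rewrite /= -[g (iota x)]/((g \o iota) x) gE.
exists (@dual_snd F U \o g) => [a b|x]; last first.
  by rewrite /= -[g (iota x)]/((g \o iota) x) gE.
by rewrite /= rmorphM /= /dual_snd /= !fst_g addrC.
Qed.

(** * Differential polynomials *)

(** The ring of polynomials [\sum_i a_i Y ^ i] over [A] with
    [Y a = a Y + delta a]. *)
Section Ore.
Context (F : fieldType) (A : algType F) (delta : {linear A -> A}).
Context (delta_der : derivation delta).

(** The proof is an argument, as the ring structure depends on it. *)
Definition ore_of of derivation delta := {poly A}.
Local Notation ore := (ore_of delta_der).
HB.instance Definition _ := GRing.Zmodule.copy ore {poly A}.

Implicit Types p q r : {poly A}.

(** Left multiplication by [Y]. *)
Definition ore_shift q : {poly A} := q * 'X + map_poly delta q.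
Definition ore_mul p q : {poly A} := \sum_(i < size p) p`_i *: iter i ore_shift q.

Lemma ore_shiftD q r : ore_shift (q + r) = ore_shift q + ore_shift r.
Proof. by rewrite /ore_shift mulrDl raddfD addrACA. Qed.
Lemma ore_shift0 : ore_shift 0 = 0.
Proof. by rewrite /ore_shift mul0r raddf0 addr0. Qed.
Lemma ore_shiftZ a q : ore_shift (a *: q) = a *: ore_shift q + delta a *: q.
Proof.
rewrite /ore_shift scalerDr scalerAl -addrA; congr (_ + _).
apply/polyP => i; rewrite coefD !coefZ !coef_map_id0 ?linear0 //.
by rewrite coefZ delta_der addrC.
Qed.

Lemma iter_shiftD i q r :
  iter i ore_shift (q + r) = iter i ore_shift q + iter i ore_shift r.
Proof. by elim: i => //= i ->; rewrite ore_shiftD. Qed.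

Lemma ore_mulE n p q : (size p <= n)%N ->
  ore_mul p q = \sum_(i < n) p`_i *: iter i ore_shift q.
Proof.
move=> le_pn; rewrite /ore_mul (big_ord_widen n (fun i => p`_i *: iter i ore_shift q)) //.
rewrite big_mkcond; apply: eq_bigr => i _; case: ltnP => // le_pi.
by rewrite nth_default ?scale0r.
Qed.

Lemma ore_mulDl : left_distributive ore_mul +%R.
Proof.
move=> p q r; pose n := maxn (size p) (size q).
rewrite !(@ore_mulE n) ?leq_maxl ?leq_maxr ?size_polyD // -big_split.
by apply: eq_bigr => i _; rewrite coefD scalerDl.
Qed.
Lemma ore_mulDr : right_distributive ore_mul +%R.
Proof.
move=> p q r; rewrite /ore_mul -big_split; apply: eq_bigr => i _.
by rewrite iter_shiftD scalerDr.
Qed.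
Lemma ore_mul0r q : ore_mul 0 q = 0.
Proof. by rewrite /ore_mul size_poly0 big_ord0. Qed.
Lemma ore_mulZl a p q : ore_mul (a *: p) q = a *: ore_mul p q.
Proof.
rewrite (@ore_mulE (size p)) ?size_scale_leq // scaler_sumr.
by apply: eq_bigr => i _; rewrite coefZ scalerA.
Qed.
Lemma ore_mul_suml I (s : seq I) (f : I -> {poly A}) q :
  ore_mul (\sum_(i <- s) f i) q = \sum_(i <- s) ore_mul (f i) q.
Proof.
apply: (big_morph (fun p => ore_mul p q)) => [p r|]; first exact: ore_mulDl.
exact: ore_mul0r.
Qed.
Lemma ore_shift_sum n (f : 'I_n -> {poly A}) :
  ore_shift (\sum_i f i) = \sum_i ore_shift (f i).
Proof. by apply: big_morph; [exact: ore_shiftD | exact: ore_shift0]. Qed.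

Lemma ore_shift_mul p q : ore_shift (ore_mul p q) = ore_mul (ore_shift p) q.
Proof.
rewrite {2}/ore_shift ore_mulDl [in LHS]/ore_mul ore_shift_sum.
rewrite (@ore_mulE (size p).+1 (p * 'X)); last first.
  by rewrite (leq_trans (size_polyMleq _ _)) // size_polyX addn2.
rewrite (@ore_mulE (size p) (map_poly delta p)) ?size_poly //.
rewrite big_ord_recl coefMX eqxx scale0r add0r -big_split.
apply: eq_bigr => i _; rewrite ore_shiftZ coefMX /= coef_map_id0 ?linear0 //.
Qed.

Lemma ore_mulA : associative ore_mul.
Proof.
move=> p q r; rewrite [in RHS]/ore_mul -/(ore_mul _ _) ore_mul_suml.
apply: eq_bigr => i _; rewrite ore_mulZl; congr (_ *: _).
by elim: (i : nat) => //= j ->; rewrite ore_shift_mul.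
Qed.

Lemma map_polyXn i : map_poly delta 'X^i = 0.
Proof.
apply/polyP => j; rewrite coef_map_id0 ?linear0 // coefXn coef0.
by case: eqP => _; rewrite ?linear0 ?derivation1.
Qed.
Lemma ore_shiftXn i : ore_shift 'X^i = 'X^(i.+1).
Proof. by rewrite /ore_shift map_polyXn addr0 exprSr. Qed.
Lemma iter_shift1 i : iter i ore_shift 1 = 'X^i.
Proof. by elim: i => [|i IH]; rewrite ?expr0 //= IH ore_shiftXn. Qed.

Lemma ore_mulC a q : ore_mul a%:P q = a *: q.
Proof.
by rewrite (@ore_mulE 1) ?size_polyC_leq1 // big_ord1 coefC.
Qed.
Lemma ore_mul1x : left_id 1 ore_mul.
Proof. by move=> q; rewrite ore_mulC scale1r. Qed.
Lemma ore_mulx1 : right_id 1 ore_mul.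
Proof.
move=> p; rewrite /ore_mul -[RHS]coefK poly_def; apply: eq_bigr => i _.
by rewrite iter_shift1.
Qed.
Lemma ore_mulX q : ore_mul 'X q = ore_shift q.
Proof. by rewrite -[ 'X]expr1 -ore_shiftXn expr0 -ore_shift_mul ore_mul1x. Qed.

HB.instance Definition _ := GRing.Zmodule_isNzRing.Build ore
  ore_mulA ore_mul1x ore_mulx1 ore_mulDl ore_mulDr (oner_neq0 _).

Definition ore_scale (k : F) (p : ore) : ore := k%:A *: (p : {poly A}).

Lemma ore_scaleA a b p : ore_scale a (ore_scale b p) = ore_scale (a * b) p.
Proof. by rewrite /ore_scale scalerA -scalerAl mul1r scalerA. Qed.
Lemma ore_scale1 : left_id 1 ore_scale.
Proof. by move=> p; rewrite /ore_scale !scale1r. Qed.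
Lemma ore_scaleDr : right_distributive ore_scale +%R.
Proof. by move=> k p q; exact: scalerDr. Qed.
Lemma ore_scaleDl p : {morph ore_scale^~ p : a b / a + b}.
Proof. by move=> a b; rewrite /ore_scale !scalerDl. Qed.
HB.instance Definition _ := GRing.Zmodule_isLmodule.Build F ore
  ore_scaleA ore_scale1 ore_scaleDr ore_scaleDl.

Lemma ore_scaleAl (k : F) (p q : ore) : k *: (p * q) = (k *: p) * q.
Proof. by rewrite [RHS]ore_mulZl. Qed.
HB.instance Definition _ := GRing.Lmodule_isLalgebra.Build F ore ore_scaleAl.

Lemma ore_scaleAr (k : F) (p q : ore) : k *: (p * q) = p * (k *: q).
Proof.
rewrite -[LHS]/(k%:A *: ore_mul p q) -[RHS]/(ore_mul p (k%:A *: (q : {poly A}))).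
rewrite /ore_mul scaler_sumr; apply: eq_bigr => i _.
have -> : iter i ore_shift (k%:A *: (q : {poly A})) = k%:A *: iter i ore_shift q.
  elim: (i : nat) => //= j ->.
  have dk : delta k%:A = 0 by rewrite linearZ /= derivation1 // scaler0.
  by rewrite ore_shiftZ dk scale0r addr0.
by rewrite !scalerA mulr_algl mulr_algr.
Qed.
HB.instance Definition _ := GRing.Lalgebra_isAlgebra.Build F ore ore_scaleAr.

Definition ore_const (a : A) : ore := a%:P.
Definition ore_Y : ore := 'X.

Lemma ore_const_linear : linear ore_const.
Proof.
move=> k a b; rewrite /ore_const polyCD -[k *: a]mulr_algl polyCM mul_polyC.
by [].
Qed.
HB.instance Definition _ :=
  GRing.isLinear.Build F A ore *:%R ore_const ore_const_linear.
Lemma ore_const_monoid : monoid_morphism ore_const.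
Proof.
by split=> // a b; rewrite [RHS]ore_mulC /ore_const polyCM mul_polyC.
Qed.
HB.instance Definition _ :=
  GRing.isMonoidMorphism.Build A ore ore_const ore_const_monoid.

Lemma ore_Y_const a : ore_Y * ore_const a = ore_const a * ore_Y + ore_const (delta a).
Proof.
rewrite [LHS]ore_mulX [ore_const a * _]ore_mulC /ore_shift /ore_const mul_polyC.
by rewrite map_polyC.
Qed.

Lemma ore_sumE (p : {poly A}) :
  \sum_(i < size p) ore_const p`_i * ore_Y ^+ i = p :> {poly A}.
Proof.
rewrite -[RHS]coefK poly_def; apply: eq_bigr => i _.
rewrite [LHS]ore_mulC; congr (_ *: _); elim: (i : nat) => [|j IH] //.
by rewrite [LHS]exprS [LHS]ore_mulX IH ore_shiftXn.
Qed.
End Ore.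

Lemma commutator_line (F : fieldType) (A : algType F) (a a' y : A) (k k' : F) :
  commutator (a + k *: y) (a' + k' *: y) =
  commutator a a' + k *: commutator y a' - k' *: commutator y a.
Proof.
have regroup (A1 B1 C1 A2 B2 C2 E : A) : A1 + B1 + (C1 + E) - (A2 + B2 + (C2 + E)) =
    A1 - A2 + (C1 - B2) - (C2 - B1).
  rewrite opprD addrACA [- (C2 + E)]opprD [C1 + E + _]addrACA subrr addr0.
  rewrite opprD [A1 + B1 + _]addrACA opprB -!addrA; congr (_ + (_ + _)).
  by rewrite !addrA [B1 - B2 + C1]addrAC [C1 - B2 + B1]addrAC [B1 + C1]addrC.
rewrite /commutator !mulrDl !mulrDr -!scalerAl -!scalerAr !scalerBr.
by rewrite [k' *: (k *: _)]scalerA [k' * k]mulrC -scalerA regroup.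
Qed.

(** * One step of the Poincare-Birkhoff-Witt theorem *)

Section EnvelopingStep.
Context (F : fieldType) (V W : lieAlgType F) (i : {linear V -> W}) (y : W).
Context (pr : {linear W -> V}) (co : {scalar W}).
Context (i_lie : forall v v', i (lie v v') = lie (i v) (i v')).
Context (prK : cancel i pr) (co_i : forall v, co (i v) = 0).
Context (co_y : co y = 1).
Context (decomp : forall w, w = i (pr w) + co w *: y).
Context (V_ideal : forall v, co (lie y (i v)) = 0).
Context (UV UW : algType F) (jV : {linear V -> UV}) (jW : {linear W -> UW}).
Context (envV : is_universal_enveloping jV) (envW : is_universal_enveloping jW).
Context (psi : {lrmorphism UV -> UW}) (psiE : forall v, psi (jV v) = jW (i v)).

Let ad v := pr (lie y (i v)).

Let i_ad v : i (ad v) = lie y (i v).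
Proof. by rewrite [RHS]decomp V_ideal scale0r addr0. Qed.

Let ad_linear : linear ad.
Proof. by move=> a u v; rewrite /ad linearP lieDr lieZr linearP. Qed.

Let ad_der v v' : ad (lie v v') = lie (ad v) v' + lie v (ad v').
Proof.
by apply: (can_inj prK); rewrite raddfD /= i_ad !i_lie !i_ad lie_leibniz.
Qed.

Let lie_decomp w w' : lie w w' =
  i (lie (pr w) (pr w') + co w *: ad (pr w') - co w' *: ad (pr w)).
Proof.
rewrite {1}(decomp w) {1}(decomp w') lieDl !lieDr !lieZl !lieZr liexx !scaler0 addr0.
rewrite raddfB raddfD /= !linearZ /= i_lie !i_ad [lie (i (pr w)) y]lieC scalerN.
by rewrite addrAC.
Qed.

(** [W] is the direct sum of the ideal [V] and the line of [y]. Over the enveloping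
    algebra of [V], on which [y] acts by a derivation, form the differential
    polynomials; sending [y] to the variable extends to a morphism on the enveloping
    algebra of [W], and powers of the variable are independent. *)
Theorem enveloping_step (p : {poly UV}) :
  \sum_(k < size p) psi p`_k * jW y ^+ k = 0 -> p = 0.
Proof.
pose adL : {linear V -> V} := HB.pack ad (GRing.isLinear.Build F V V *:%R ad ad_linear).
have [delta delta_der deltaE] := enveloping_derivation (d := adL) envV ad_der.
pose O : algType F := ore_of delta_der.
pose Y : O := ore_Y delta_der; pose C : {lrmorphism UV -> O} := ore_const delta_der.
pose f (w : W) : O := C (jV (pr w)) + co w *: Y.
have f_lin : linear f.
  move=> a u v; rewrite /f !linearP scalerDl -scalerA scalerDr addrACA.
  by [].
pose fL : {linear W -> O} := HB.pack f (GRing.isLinear.Build F W O *:%R f f_lin).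
have YC a : Y * C a = C a * Y + C (delta a) by exact: ore_Y_const.
have [jV_comm univV] := envV; have [jW_comm univW] := envW.
have f_comm : lie_to_commutator fL.
  move=> w w'; rewrite /= /f lie_decomp prK co_i scale0r addr0.
  set v := pr w; set v' := pr w'; set c := co w; set c' := co w'.
  have YC' a : commutator Y (C a) = C (delta a).
    by rewrite /commutator YC addrAC subrr add0r.
  rewrite -[RHS]/(commutator (C (jV v) + c *: Y) (C (jV v') + c' *: Y)).
  rewrite commutator_line !YC' !deltaE.
  have jE : jV (lie v v' + c *: ad v' - c' *: ad v) =
      jV v * jV v' - jV v' * jV v + c *: jV (ad v') - c' *: jV (ad v).
    by rewrite raddfB raddfD /= !linearZ /= jV_comm.
  by rewrite jE !raddfB raddfD /= !linearZ /= raddfB /= !rmorphM.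
have [phi [phiE _]] := univW _ _ f_comm.
have phi_psi u : phi (psi u) = C u.
  apply: (enveloping_hom_eq (g := phi \o psi) (h := C) envV) => v.
  rewrite /= psiE -[phi (jW _)]/((phi \o jW) _) phiE /= /f prK co_i scale0r.
  by rewrite addr0.
move=> /(congr1 phi); rewrite raddf0 raddf_sum => p0.
rewrite -[p](ore_sumE delta_der) -[RHS]p0; apply: eq_bigr => k _.
have phi_y : phi (jW y) = Y.
  rewrite -[phi (jW y)]/((phi \o jW) y) phiE /= /f co_y scale1r.
  have -> : pr y = 0.
    apply: (can_inj prK); apply: (addIr (co y *: y)).
    by rewrite -decomp co_y scale1r raddf0 add0r.
  by rewrite !raddf0 add0r.
by rewrite /= rmorphM rmorphXn /= phi_psi phi_y.
Qed.
End EnvelopingStep.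

(** * The tower of an enveloping algebra *)

Section SubLie.
Context (F : fieldType) (L : finDimLieAlgType F) (V : {vspace L}).

(** The proof is an argument, as the bracket depends on it. *)
Definition ideal_algebra of lie_ideal V : Type := subvs_of V.
Context (V_ideal : lie_ideal V).
Local Notation T := (ideal_algebra V_ideal).
HB.instance Definition _ := GRing.Lmodule.copy T (subvs_of V).

Definition ideal_val (v : T) : L := vsval v.
Definition ideal_proj (x : L) : T := vsproj V x.

Arguments ideal_val : simpl never.
Arguments ideal_proj : simpl never.

Lemma ideal_val_linear : linear ideal_val. Proof. by move=> a u v; exact: linearP. Qed.
Lemma ideal_proj_linear : linear ideal_proj. Proof. by move=> a u v; exact: linearP. Qed.
HB.instance Definition _ := GRing.isLinear.Build F T L *:%R ideal_val ideal_val_linear.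
HB.instance Definition _ := GRing.isLinear.Build F L T *:%R ideal_proj ideal_proj_linear.

Lemma ideal_valD u v : ideal_val (u + v) = ideal_val u + ideal_val v.
Proof. exact: raddfD. Qed.
Lemma ideal_valZ a v : ideal_val (a *: v) = a *: ideal_val v.
Proof. exact: linearZ. Qed.
Lemma ideal_valK : cancel ideal_val ideal_proj. Proof. exact: vsvalK. Qed.
Lemma ideal_projK x : x \in V -> ideal_val (ideal_proj x) = x. Proof. exact: vsprojK. Qed.
Lemma ideal_val_mem v : ideal_val v \in V. Proof. exact: subvsP. Qed.

Definition ideal_lie (u v : T) : T := ideal_proj (lie (ideal_val u) (ideal_val v)).
Lemma ideal_val_lie u v : ideal_val (ideal_lie u v) = lie (ideal_val u) (ideal_val v).
Proof. by rewrite ideal_projK //; apply: V_ideal; exact: ideal_val_mem. Qed.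

Lemma ideal_lie_linearl v : linear (ideal_lie^~ v).
Proof. by move=> a u u'; rewrite /ideal_lie linearP lieDl lieZl linearP. Qed.
Lemma ideal_lie_linearr v : linear (ideal_lie v).
Proof. by move=> a u u'; rewrite /ideal_lie linearP lieDr lieZr linearP. Qed.
Lemma ideal_liexx v : ideal_lie v v = 0.
Proof. by rewrite /ideal_lie liexx linear0. Qed.
Lemma ideal_lie_jacobi u v w : ideal_lie u (ideal_lie v w) +
  ideal_lie v (ideal_lie w u) + ideal_lie w (ideal_lie u v) = 0.
Proof.
apply: (can_inj ideal_valK).
by rewrite [RHS]raddf0 !raddfD /= !ideal_val_lie lie_jacobi.
Qed.
HB.instance Definition _ := Lmodule_isLieAlgebra.Build F T
  ideal_lie_linearl ideal_lie_linearr ideal_liexx ideal_lie_jacobi.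
End SubLie.

Section EnvelopingTower.
Import EnvelopingExistence.
Context (F : fieldType) (L : finDimLieAlgType F) (n : nat) (c : nat -> {vspace L}).
Context (c0 : c 0%N = 0%VS) (cn : c n = fullv).
Context (c_sub : forall k, (k < n)%N -> (c k <= c k.+1)%VS).
Context (c_ideal : forall k, lie_ideal (c k)).
Context (c_dim : forall k, (k <= n)%N -> \dim (c k) = k).
Context (U : algType F) (iota : {linear L -> U}).
Context (envU : is_universal_enveloping iota).

Let iota_comm : lie_to_commutator iota. Proof. by case: envU. Qed.

Local Notation "'V_ k" := (ideal_algebra (@c_ideal k)) (at level 8, k at level 2).

Definition iota_ideal k : 'V_k -> U := iota \o @ideal_val F L (c k) (@c_ideal k).
HB.instance Definition _ k := GRing.Linear.on (@iota_ideal k).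
Lemma iota_ideal_comm k : lie_to_commutator (@iota_ideal k : {linear 'V_k -> U}).
Proof. by move=> u v; rewrite /= /iota_ideal /= ideal_val_lie iota_comm. Qed.

(** For [k <= n] the map [enveloping_map k] is injective by [enveloping_map_inj], so
    that [level k] is a copy of the enveloping algebra of [c k]. *)
Definition enveloping_map k : {lrmorphism env 'V_k -> U} := lift (@iota_ideal_comm k).
Definition level k : set U := range (enveloping_map k).

Lemma enveloping_map_gen k v : enveloping_map k (egen v) = iota (ideal_val v).
Proof. exact: (value_gen (@iota_ideal_comm k)). Qed.

Lemma level_iota k x : x \in c k -> level k (iota x).
Proof.
move=> cx; exists (egen (ideal_proj (@c_ideal k) x)) => //.
by rewrite enveloping_map_gen ideal_projK.
Qed.

Lemma level_const k a : level k a%:A.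
Proof. by exists a%:A => //; rewrite linearZ /= rmorph1. Qed.

Lemma level_ring k : subring_set (level k).
Proof.
split; first split=> [|_ _ [u _ <-] [v _ <-]].
- by exists 0 => //; rewrite raddf0.
- by exists (u - v) => //; rewrite raddfB.
- by exists 1 => //; rewrite rmorph1.
- by move=> _ _ [u _ <-] [v _ <-]; exists (u * v) => //; rewrite rmorphM.
Qed.

Lemma level_ind k (S : set U) : subring_set S -> (forall a, S a%:A) ->
  (forall x, x \in c k -> S (iota x)) -> level k `<=` S.
Proof.
move=> [S_add S1 SM] Sa Si _ [u _ <-].
apply: (enveloping_ind (S := [set u | S (enveloping_map k u)]) (envP 'V_k)) => /=.
- by move=> a; rewrite linearZ /= rmorph1.
- by move=> v; rewrite enveloping_map_gen; apply: Si; exact: ideal_val_mem.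
- by move=> v w Sv Sw; rewrite raddfD; exact: additiveD.
- by move=> v w Sv Sw; rewrite rmorphM; exact: SM.
Qed.

Context (e : nat -> L).
Context (e_in : forall k, (k < n)%N -> e k \in c k.+1).
Context (e_out : forall k, (k < n)%N -> e k \notin c k).

Lemma coef_uniq k x a b : (k < n)%N -> x - a *: e k \in c k -> x - b *: e k \in c k ->
  a = b.
Proof.
move=> lt_kn xa xb; apply/eqP; rewrite -subr_eq0; apply: contraNT (e_out lt_kn) => ab.
rewrite -[e k]scale1r -(mulVf ab) -scalerA; apply: memvZ.
suff -> : (a - b) *: e k = x - b *: e k - (x - a *: e k) by apply: memvB.
by rewrite scalerBl opprB [RHS]addrC subrKA.
Qed.

Lemma coef_exists k x : (k < n)%N -> x \in c k.+1 -> exists a, x - a *: e k \in c k.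
Proof.
move=> lt_kn; have -> : c k.+1 = (c k + <[e k]>)%VS.
  apply/eqP; rewrite eq_sym eqEdim subv_add c_sub //= -memvE e_in //=.
  rewrite c_dim // dimv_disjoint_sum ?c_dim ?(ltnW lt_kn) // ?dim_vline.
    rewrite (_ : e k != 0) ?addn1 //.
    by apply: contraNneq (e_out lt_kn) => ->; exact: mem0v.
  apply/eqP; rewrite -subv0; apply/subvP => z /memv_capP[cz /vlineP[a az]].
  rewrite memv0; apply: contraNT (e_out lt_kn) => z0; have a0 : a != 0.
    by apply: contraNneq z0 => a0; rewrite az a0 scale0r.
  by rewrite -[e k]scale1r -(mulVf a0) -scalerA -az; exact: memvZ.
move=> /memv_addP[v cv [_ /vlineP[a ->] ->]]; exists a.
by rewrite addrK.
Qed.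

(** The inclusion of [c k] into [c (k + 1)] satisfies the hypotheses of
    [enveloping_step]. *)
Lemma level_step k (lt_kn : (k < n)%N) :
  exists psi : {lrmorphism env 'V_k -> env 'V_k.+1},
    (forall u, enveloping_map k u = enveloping_map k.+1 (psi u)) /\
    forall p : {poly env 'V_k},
      \sum_(i < size p) psi p`_i * egen (ideal_proj (@c_ideal k.+1) (e k)) ^+ i = 0 ->
      p = 0.
Proof.
pose i : {linear 'V_k -> 'V_k.+1} :=
  ideal_proj (@c_ideal k.+1) \o @ideal_val F L _ (@c_ideal k).
have val_i v : ideal_val (i v) = ideal_val v.
  by rewrite ideal_projK //; apply: (subvP (c_sub lt_kn)); exact: ideal_val_mem.
clearbody i.
have i_lie v v' : i (lie v v') = lie (i v) (i v').
  by apply: (can_inj (@ideal_valK _ _ _ _)); rewrite val_i !ideal_val_lie !val_i.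
pose y := ideal_proj (@c_ideal k.+1) (e k).
have val_y : ideal_val y = e k by rewrite ideal_projK // e_in.
have /choice[co coP] : forall w : 'V_k.+1, exists a, ideal_val w - a *: e k \in c k.
  by move=> w; apply: coef_exists => //; exact: ideal_val_mem.
have coE w a : ideal_val w - a *: e k \in c k -> co w = a.
  by move=> wa; exact: coef_uniq lt_kn (coP w) wa.
have co_lin : scalar co.
  move=> a u v; apply: coE; rewrite linearP scalerDl -scalerA opprD addrACA -scalerBr.
  by apply: memvD; [apply: memvZ; exact: coP | exact: coP].
pose coL : {scalar 'V_k.+1} := HB.pack co (GRing.isLinear.Build F _ _ _ co co_lin).
pose pr w := ideal_proj (@c_ideal k) (ideal_val w - co w *: e k).
have pr_lin : linear pr.
  move=> a u v; rewrite /pr -linearP; congr (ideal_proj _ _).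
  by rewrite co_lin linearP scalerDl -scalerA opprD addrACA -scalerBr.
pose prL : {linear 'V_k.+1 -> 'V_k} :=
  HB.pack pr (GRing.isLinear.Build F _ _ _ pr pr_lin).
have co_i v : co (i v) = 0.
  by apply: coE; rewrite scale0r subr0 val_i; exact: ideal_val_mem.
have prK : cancel i prL.
  by move=> v; change (pr (i v) = v); rewrite /pr co_i scale0r subr0 val_i ideal_valK.
have co_y : co y = 1 by apply: coE; rewrite scale1r val_y subrr mem0v.
have decomp w : w = i (pr w) + co w *: y.
  apply: (can_inj (@ideal_valK _ _ _ _)).
  rewrite ideal_valD ideal_valZ val_i val_y.
  by rewrite ideal_projK // subrK.
have V_ideal v : co (lie y (i v)) = 0.
  apply: coE; rewrite scale0r subr0 ideal_val_lie; apply: c_ideal.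
  by rewrite val_i; exact: ideal_val_mem.
pose f : {linear 'V_k -> env 'V_k.+1} := @egen F 'V_k.+1 \o i.
have f_comm : lie_to_commutator f.
  by move=> v v'; rewrite /= i_lie; case: (envP 'V_k.+1) => comm _; exact: comm.
pose psi : {lrmorphism env 'V_k -> env 'V_k.+1} := lift f_comm.
have psiE v : psi (egen v) = egen (i v) by exact: (value_gen f_comm).
exists psi; split=> [u|p].
  apply: (enveloping_hom_eq (g := enveloping_map k) (h := enveloping_map k.+1 \o psi)
    (envP 'V_k)) => v.
  rewrite [RHS]/= [psi _]psiE.
  by rewrite [LHS]enveloping_map_gen enveloping_map_gen val_i.
exact: (@enveloping_step F _ _ i y prL coL i_lie prK co_i co_y decomp V_ideal
  _ _ _ _ (envP _) (envP _) psi psiE p).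
Qed.

(** At the top the map is an isomorphism, as [c n] is all of [L]; going down, each
    map is the composition of the next one with the injective map of
    [level_step]. *)
Lemma enveloping_map_inj k : (k <= n)%N -> injective (enveloping_map k).
Proof.
pose ker0 k := forall u, enveloping_map k u = 0 -> u = 0.
move=> le_kn; suff k0 : ker0 k.
  move=> u v uv; apply/eqP; rewrite -subr_eq0; apply/eqP/k0.
  by rewrite raddfB /= uv subrr.
rewrite -(subKn le_kn); elim: (n - k)%N (leq_subr k n) => [|j IH] le_jn.
  rewrite subn0.
  have [egen_comm _] := envP 'V_n.
  pose f : {linear L -> env 'V_n} := @egen F 'V_n \o ideal_proj (@c_ideal n).
  have f_comm : lie_to_commutator f.
    move=> x y; rewrite /= -egen_comm; congr (egen _).
    apply: (can_inj (@ideal_valK _ _ _ _)).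
    by rewrite ideal_val_lie !ideal_projK ?cn ?memvf.
  have [_ /(_ _ _ f_comm)[g [gE _]]] := envU.
  have gK v : g (enveloping_map n v) = v.
    apply: (enveloping_hom_eq (g := g \o enveloping_map n) (h := idfun) (envP 'V_n)) => w.
    rewrite /= enveloping_map_gen -[g _]/((g \o iota) _) gE /=.
    by rewrite ideal_valK.
  by move=> u /(congr1 g); rewrite gK raddf0.
have lt_n : (n - j.+1 < n)%N by rewrite ltn_subrL (leq_trans _ le_jn).
have [psi [psiE psi_free]] := level_step lt_n.
have {}IH : ker0 (n - j.+1).+1 by rewrite subnSK //; apply: IH; exact: ltnW.
move=> u; rewrite psiE => /IH psi0.
have : u%:P = 0.
  apply: psi_free; rewrite big1 // => i _; rewrite coefC.
  by case: eqP => _; rewrite ?psi0 ?raddf0 mul0r.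
by move=> /eqP; rewrite polyC_eq0 => /eqP.
Qed.

Theorem enveloping_tower : tower (range iota) n level (iota \o e).
Proof.
have iota_e k : (k < n)%N -> level k.+1 (iota (e k)).
  by move=> lt_kn; apply: level_iota; exact: e_in.
split.
- by move=> k _; exact: level_ring.
- have B0 : level 0 `<=` [set b | exists a : F, b = a%:A].
    apply: level_ind => /=.
    + split=> [|/=|_ _ [a ->] [b ->]].
      * split=> [|_ _ [a ->] [b ->]]; first by exists 0; rewrite scale0r.
        by exists (a - b); rewrite scalerBl.
      * by exists 1; rewrite scale1r.
      * by exists (a * b); rewrite -scalerAl mul1r scalerA.
    + by move=> a; exists a.
    + by move=> x; rewrite c0 memv0 => /eqP ->; exists 0; rewrite scale0r raddf0.
  move=> _ /B0[a ->] a0; exists (a^-1)%:A; first exact: level_const.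
  rewrite -scalerAl mul1r scalerA mulVf ?scale1r //.
  by apply: contraNneq a0 => ->; rewrite scale0r.
- apply: (enveloping_ind (S := level n) envU).
  + exact: level_const.
  + by move=> x; apply: level_iota; rewrite cn memvf.
  + by move=> u v nu nv; have [add _ _] := level_ring n; exact: additiveD.
  + by move=> u v nu nv; have [_ _ mul] := level_ring n; exact: mul.
- by move=> k _; exists (e k).
- move=> k lt_kn; split=> [||S S_ring BS Sy].
  + apply: level_ind; [exact: level_ring | exact: level_const |].
    by move=> x cx; apply: level_iota; exact: (subvP (c_sub lt_kn)).
  + exact: iota_e.
  + have [S_add _ SM] := S_ring.
    have Sa a : S a%:A by apply: BS; exact: level_const.
    apply: level_ind => // x cx; have [a xa] := coef_exists lt_kn cx.
    rewrite -[x](subrK (a *: e k)) raddfD /=; apply: additiveD => //.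
      by apply: BS; exact: level_iota.
    by rewrite linearZ /= -mulr_algl; exact: SM.
- move=> k _ b le_kn [x _ <-] Bb.
  have B_ring := level_ring k; have [B_add B1 BM] := B_ring.
  suff /(_ b Bb)[] :
    level k `<=` [set b | level k b /\ level k (commutator (iota x) b)] by [].
  apply: level_ind => [|a|v cv].
  + split=> [||u v [Bu Bu'] [Bv Bv']].
    * split=> [|u v [Bu Bu'] [Bv Bv']].
        by rewrite /= commutator0; split; exact: additive0.
      split; first exact: additiveB.
      rewrite commutatorD (_ : commutator _ (- v) = - commutator (iota x) v).
        exact: additiveB.
      by rewrite /commutator mulrN mulNr opprB opprK addrC.
    * by split=> //; rewrite /commutator mulr1 mul1r subrr; exact: additive0.
    * split; first exact: BM.
      by rewrite commutatorM; apply: additiveD => //; exact: BM.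
  + split; first exact: level_const.
    by rewrite /commutator mulr_algl mulr_algr subrr; exact: additive0.
  + split; first exact: level_iota.
    by rewrite /commutator -iota_comm; apply: level_iota; exact: c_ideal.
- move=> k _ lt_kn [x _ <-].
  have [a xa] : exists a, lie x (e k) - a *: e k \in c k.
    by apply: coef_exists => //; apply: c_ideal; exact: e_in.
  exists a%:A; split; first exact: level_const.
    by move=> r; rewrite mulr_algl mulr_algr.
  rewrite /commutator /= -iota_comm mulr_algl -linearZ -raddfB.
  exact: level_iota.
- move=> S [S_add S1 SM] BS ZS; apply: (enveloping_ind envU).
  + by move=> a; apply: BS; exact: level_const.
  + by move=> x; apply: ZS; exists x.
  + by move=> u v; exact: additiveD.
  + exact: SM.
- move=> k p lt_kn Bp py.
  have [psi [psiE psi_free]] := level_step lt_kn.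
  have /choice[q qE] : forall i, exists u, enveloping_map k u = p`_i.
    by move=> i; have [u _ <-] := Bp i; exists u.
  pose p' := \poly_(i < size p) q i.
  have p'E i : enveloping_map k p'`_i = p`_i.
    rewrite coef_poly; case: ltnP => [//|le_pi].
    by rewrite raddf0 nth_default.
  suff p'0 : p' = 0 by apply/polyP => i; rewrite -p'E p'0 !coef0 raddf0.
  apply: psi_free; apply: (enveloping_map_inj lt_kn).
  have le_pp' : (size p <= size p')%N.
    by apply/leq_sizeP => j le_j; rewrite -p'E nth_default ?raddf0.
  rewrite raddf0 -[RHS]py (horner_coef_wide _ le_pp') raddf_sum.
  apply: eq_bigr => i _; rewrite /= rmorphM rmorphXn /= -psiE p'E.
  by rewrite enveloping_map_gen ideal_projK // e_in.
Qed.

End EnvelopingTower.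

Lemma completely_solvable_tower (F : fieldType) (L : finDimLieAlgType F)
    (U : algType F) (iota : {linear L -> U}) :
  completely_solvable L -> is_universal_enveloping iota ->
  exists B y, tower (range iota) (\dim {:L}) B y.
Proof.
move=> [c0 [c00 c0n c0_sub c0_ideal c0_dim]] envU.
set n := \dim _ in c0n c0_sub c0_ideal c0_dim *.
(* the chain is constant beyond [n] *)
pose c k := c0 (minn k n).
have cE k : (k <= n)%N -> c k = c0 k by move=> le_kn; rewrite /c (minn_idPl le_kn).
have c_sub k : (k < n)%N -> (c k <= c k.+1)%VS.
  by move=> lt_kn; rewrite !cE ?(ltnW lt_kn) //; exact: c0_sub.
have c_ideal k : lie_ideal (c k) by apply: c0_ideal; exact: geq_minr.
have c_dim k : (k <= n)%N -> \dim (c k) = k by move=> le_kn; rewrite cE // c0_dim.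
have /choice[e eP] : forall k, exists x, (k < n)%N -> x \in c k.+1 /\ x \notin c k.
  move=> k; have [lt_kn|_] := ltnP k n; last by exists 0.
  suff /subvPn[x xc' xc] : ~~ (c k.+1 <= c k)%VS by exists x.
  by apply/negP => /dimvS; rewrite !c_dim ?(ltnW lt_kn) // ltnn.
exists (level c_ideal envU), (iota \o e); apply: enveloping_tower => //.
- by rewrite cE.
- by rewrite cE.
- by move=> k /eP[].
- by move=> k /eP[].
Qed.

(** * Completely solvable Lie algebras *)

Theorem corollary3p8 (F : fieldType) (L : finDimLieAlgType F) (n : nat)
    (dimL : \dim {:L} = n) (n_ge1 : (1 <= n)%N)
    (solvL : completely_solvable L)
    (U : algType F) (iota : {linear L -> U})
    (envU : is_universal_enveloping iota) :
  (forall I : set U, two_sided_ideal I -> I <> setT ->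
     ideal_iter_residual I n = [set 0]) /\
  (forall P : lmodType U, projective_module P ->
     finitely_generated_module P \/ free_module P).
Proof.
have [B [y T]] := completely_solvable_tower solvL envU.
rewrite dimL in T.
split=> [|P]; first exact: (tower_residual T).
apply: projective_fg_or_free.
- move=> I I_id I1; exists n; apply: (tower_residual T) => // IT.
  by apply: I1; rewrite IT.
- exact: (tower_left_noetherian T).
- exact: (tower_right_noetherian T).
Qed.
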